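(* Let $A\in\mathbb{R}^{n\times n}$ be nonsingular with $\kappa=\operatorname{cond}(A)$ and numerically full rank, $\kappa u\ll 1$; let $b\in\mathbb{R}^n$; and let $P\in\mathbb{R}^{n\times n}$ be a high-quality preconditioner, $\operatorname{cond}(AP^{-1})\le C$ for an absolute constant $C$, scaled so that $\|AP^{-1}\|\asymp 1$. Assume that the operations $Az$, $A^\top z$, $P^{-1}z$, $P^{-\top}z$ are performed in a backward stable way. Run the following meta-solver in floating point arithmetic with unit roundoff $u$: set $x_0=0$ and, for $i=0,1,\dots,t-1$, (a) $c_i\leftarrow P^{-\top}(A^\top(b-Ax_i))$; (b) $\delta y_i\leftarrow$ output of the Lanczos method for linear solves (without reorthogonalization, as specified in the context), run with $q=\mathcal{O}(\log(1/(\kappa u)))$ iterations on the system $(P^{-\top}A^\top AP^{-1})\,\delta y_i=c_i$, with matrix–vector products evaluated as $z\mapsto P^{-\top}(A^\top(A(P^{-1}z)))$; (c) $x_{i+1}\leftarrow x_i+P^{-1}\delta y_i$. Then, with $t=\mathcal{O}\big(\log(1/u)/\log(1/(\kappa u))\big)$ iterative refinement steps, this algorithm (with output $x_t$) is backward stable. The total cost is $\mathcal{O}(\log(1/u))$ matrix–vector products with each of $A$, $A^\top$, $P^{-1}$, and $P^{-\top}$, and $\mathcal{O}(n\log(1/u))$ additional arithmetic operations.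
   Context: Norms: $\|\cdot\|$ is the Euclidean norm of vectors and the spectral norm of matrices; $\operatorname{cond}(B)=\sigma_{\max}(B)/\sigma_{\min}(B)$. Floating point: computations follow the standard model of floating point arithmetic with unit roundoff $u$ (each basic operation incurs relative error at most $u$; no overflow or underflow). $\operatorname{fl}(\cdot)$ gives the computed value of an expression. A vector $z$ is exactly representable if $\operatorname{fl}(z)=z$. Order notation: for $a,b\ge 0$, $a\lesssim b$ means $a\le p(n,\log(1/u))\,b$ for some polynomial $p$ (not depending on the particular $A,P,b$, but possibly on absolute constants such as $C$ and on the polynomials in the hypotheses). As a hypothesis, $a\ll b$ means $a\le b/p(n,\log(1/u))$ for a polynomial $p$ that may be taken as large as needed for the conclusion (i.e. there exists such a $p$ for which the conclusion holds). $a\asymp b$ means $a$ and $b$ are comparable up to absolute constants. Backward stable operations: for exactly representable $z$, $\|\operatorname{fl}(Az)-Az\|\lesssim\|A\|\|z\|u$ and $\|\operatorname{fl}(A^\top z)-A^\top z\|\lesssim\|A\|\|z\|u$; and the computed $\operatorname{fl}(P^{-1}z)$ satisfies $(P+\Delta P)\operatorname{fl}(P^{-1}z)=z$ for some $\Delta P$ (depending on $z$) with $\|\Delta P\|\lesssim\|P\|u$, and similarly for $P^{-\top}z$ with $P^\top$ in place of $P$. Backward stability of a linear solver: there exists a prefactor $c$, polynomially large in $n$ and $\log(1/u)$, such that whenever $c\operatorname{cond}(A)u<1$ the computed output $\hat x$ satisfies $(A+\Delta A)\hat x=b$ for some $\Delta A$ with $\|\Delta A\|\le cu\|A\|$. Lanczos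 method for $M^{-1}c$ with $q$ iterations, given a subroutine Apply for $z\mapsto Mz$: set $q_0=0$, $\gamma=\|c\|$, $q_1=c/\gamma$, $\beta_1=0$, $k=q$. For $i=1,\dots,q$: $q_{i+1}\leftarrow \mathrm{Apply}(q_i)-\beta_i q_{i-1}$; $\alpha_i\leftarrow q_{i+1}^\top q_i$; $q_{i+1}\leftarrow q_{i+1}-\alpha_i q_i$; $\beta_{i+1}\leftarrow\|q_{i+1}\|$; if $\beta_{i+1}=0$, set $k\leftarrow i$ and stop the loop; otherwise $q_{i+1}\leftarrow q_{i+1}/\beta_{i+1}$. Let $T$ be the $k\times k$ symmetric tridiagonal matrix with diagonal $\alpha_1,\dots,\alpha_k$ and off-diagonal entries $\beta_2,\dots,\beta_k$, let $Q=[q_1\ \cdots\ q_k]$, and output $y=\gamma\, Q(T^{-1}\mathbf{e}_1)$, where $\mathbf{e}_1$ is the first standard basis vector of $\mathbb{R}^k$. All steps are executed in floating point arithmetic. *)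

(* Defs.v *)
From HB Require Import structures.
From mathcomp Require Import all_boot all_order all_algebra.
From mathcomp Require Import classical_sets reals exp.

Set Implicit Arguments.
Unset Strict Implicit.
Unset Printing Implicit Defensive.

Import Order.TTheory GRing.Theory Num.Theory.
Local Open Scope ring_scope.
Local Open Scope classical_set_scope.

Section LinearAlgebra.
Variable R : realType.

Definition norm2 n (x : 'cV[R]_n) : R := Num.sqrt (\sum_i x i 0 ^+ 2).

Definition specnorm m n (B : 'M[R]_(m, n)) : R :=
  sup [set norm2 (B *m x) | x in [set x : 'cV[R]_n | norm2 x <= 1]].

Definition singular_values n (B : 'M[R]_n) : set R :=
  [set s | 0 <= s /\ eigenvalue (B^T *m B) (s ^+ 2)].

Definition sigma_max n (B : 'M[R]_n) : R := sup (singular_values B).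
Definition sigma_min n (B : 'M[R]_n) : R := inf (singular_values B).

(* For singular B this is 0, not +oo: the uses below assume B nonsingular. *)
Definition cond n (B : 'M[R]_n) : R := sigma_max B / sigma_min B.

(* The symmetric tridiagonal matrix with diagonal a_0, ..., a_(k-1) and
   off-diagonal b_0, ..., b_(k-2). *)
Definition tridiag k (a b : nat -> R) : 'M[R]_k :=
  \matrix_(i, j) if i == j then a i
                 else if j == i.+1 :> nat then b i
                 else if i == j.+1 :> nat then b j
                 else 0.

(* The prefactor p(n, log(1/u)) of the order notation. *)
Definition prefactor (p : {poly {poly R}}) (n : nat) (u : R) : R :=
  p.[n%:R, ln u^-1].

(* The computed solution x of B x = c satisfies the requirement in the
   definition of backward stability, with prefactor p(k, log(1/u)). *)
Definition backward_stable_output (p : {poly {poly R}}) (u : R) k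
    (B : 'M[R]_k) (c x : 'cV[R]_k) : Prop :=
  B \in unitmx -> prefactor p k u * cond B * u < 1 ->
  exists2 dB : 'M[R]_k, specnorm dB <= prefactor p k u * u * specnorm B
                      & (B + dB) *m x = c.

End LinearAlgebra.

(* The standard model: fl is the rounding map, its fixed points are the
   exactly representable numbers.  The basic operations need not be correctly
   rounded, and are constrained on representable operands only. *)
Record fparith (R : realType) (u : R) := FPArith {
  fl : R -> R;
  fladd : R -> R -> R;
  flsub : R -> R -> R;
  flmul : R -> R -> R;
  fldiv : R -> R -> R;
  flsqrt : R -> R;
  fl_err x : `|fl x - x| <= u * `|x|;
  fl_fl x : fl (fl x) = fl x;
  fladd_err x y : fl x = x -> fl y = y ->
    `|fladd x y - (x + y)| <= u * `|x + y|;
  flsub_err x y : fl x = x -> fl y = y ->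
    `|flsub x y - (x - y)| <= u * `|x - y|;
  flmul_err x y : fl x = x -> fl y = y ->
    `|flmul x y - x * y| <= u * `|x * y|;
  fldiv_err x y : fl x = x -> fl y = y -> y != 0 ->
    `|fldiv x y - x / y| <= u * `|x / y|;
  flsqrt_err x : fl x = x -> 0 <= x ->
    `|flsqrt x - Num.sqrt x| <= u * `|Num.sqrt x|;
  fl_fladd x y : fl x = x -> fl y = y -> fl (fladd x y) = fladd x y;
  fl_flsub x y : fl x = x -> fl y = y -> fl (flsub x y) = flsub x y;
  fl_flmul x y : fl x = x -> fl y = y -> fl (flmul x y) = flmul x y;
  fl_fldiv x y : fl x = x -> fl y = y -> y != 0 ->
    fl (fldiv x y) = fldiv x y;
  fl_flsqrt x : fl x = x -> 0 <= x -> fl (flsqrt x) = flsqrt x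
}.

Definition representable (R : realType) (u : R) (F : fparith u) m n
    (B : 'M[R]_(m, n)) : Prop := map_mx (fl F) B = B.

(* A computation returns its value together with the trace of the operations
   executed: products with A, A^T, P^-1, P^-T, and scalar operations. *)
Inductive op := MulA | MulAt | MulPinv | MulPinvt | Flop.

Definition op_eqb (o1 o2 : op) : bool :=
  match o1, o2 with
  | MulA, MulA | MulAt, MulAt | MulPinv, MulPinv | MulPinvt, MulPinvt
  | Flop, Flop => true
  | _, _ => false
  end.

Lemma op_eqP : Equality.axiom op_eqb.
Proof. by case; case; constructor. Qed.

HB.instance Definition _ := hasDecEq.Build op op_eqP.

Definition fpcomp (T : Type) : Type := (T * seq op)%type.
Definition ret T (x : T) : fpcomp T := (x, [::]).
Definition tick T (o : op) (x : T) : fpcomp T := (x, [:: o]).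
Definition bind T S (c : fpcomp T) (f : T -> fpcomp S) : fpcomp S :=
  ((f c.1).1, c.2 ++ (f c.1).2).

Notation "'let*' x := c 'in' e" := (bind c (fun x => e))
  (at level 200, x name, c at level 200, e at level 200).

(* The computed products z |-> A z, A^T z, P^-1 z, P^-T z. *)
Record products (R : realType) (n : nat) := Products {
  mulA : 'cV[R]_n -> 'cV[R]_n;
  mulAt : 'cV[R]_n -> 'cV[R]_n;
  mulPinv : 'cV[R]_n -> 'cV[R]_n;
  mulPinvt : 'cV[R]_n -> 'cV[R]_n
}.

Definition backward_stable_products (R : realType) (u : R) (F : fparith u)
    (p : {poly {poly R}}) n (A P : 'M[R]_n) (O : products R n) : Prop :=
  forall z : 'cV[R]_n, representable F z ->
  [/\ [/\ representable F (mulA O z), representable F (mulAt O z),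
          representable F (mulPinv O z) & representable F (mulPinvt O z)],
      norm2 (mulA O z - A *m z)
        <= prefactor p n u * specnorm A * norm2 z * u,
      norm2 (mulAt O z - A^T *m z)
        <= prefactor p n u * specnorm A * norm2 z * u,
      (exists2 dP : 'M[R]_n, specnorm dP <= prefactor p n u * specnorm P * u
                           & (P + dP) *m mulPinv O z = z)
    & (exists2 dP : 'M[R]_n, specnorm dP <= prefactor p n u * specnorm P * u
                           & (P^T + dP) *m mulPinvt O z = z)].

(* A subroutine for T^-1 e_1, with T symmetric tridiagonal. *)
Definition tridiag_solver (R : realType) : Type :=
  forall k : nat, 'M[R]_k -> fpcomp 'cV[R]_k.

Definition e1 (R : realType) k : 'cV[R]_k :=
  \col_(i < k) (i == 0 :> nat)%:R.

(* T^-1 e_1 is evaluated by a backward stable method using at most c k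
   arithmetic operations. *)
Definition backward_stable_tridiag (R : realType) (u : R) (F : fparith u)
    (p : {poly {poly R}}) (c : R) (slv : tridiag_solver R) : Prop :=
  forall (k : nat) (a b : nat -> R), (0 < k)%N ->
  let T := tridiag k a b in representable F T ->
  [/\ T \in unitmx -> prefactor p k u * cond T * u < 1 ->
        representable F (slv k T).1,
      backward_stable_output p u T (e1 R k) (slv k T).1,
      all (pred1 Flop) (slv k T).2
    & (size (slv k T).2)%:R <= c * k%:R].

Section Algorithm.
Variables (R : realType) (u : R) (F : fparith u).

Definition add (x y : R) : fpcomp R := tick Flop (fladd F x y).
Definition sub (x y : R) : fpcomp R := tick Flop (flsub F x y).
Definition mul (x y : R) : fpcomp R := tick Flop (flmul F x y).
Definition div (x y : R) : fpcomp R := tick Flop (fldiv F x y).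
Definition sqrt (x : R) : fpcomp R := tick Flop (flsqrt F x).

(* Inner products by recursive summation, from left to right. *)
Fixpoint dot_from (acc : R) (s : seq (R * R)) : fpcomp R :=
  if s is xy :: s' then
    let* p := mul xy.1 xy.2 in
    let* acc' := add acc p in
    dot_from acc' s'
  else ret acc.

Definition dot_seq (s : seq (R * R)) : fpcomp R :=
  if s is xy :: s' then let* p := mul xy.1 xy.2 in dot_from p s' else ret 0.

Definition dot k (x y : 'cV[R]_k) : fpcomp R :=
  dot_seq [seq (x i 0, y i 0) | i <- enum 'I_k].

Definition vec k (f : 'I_k -> fpcomp R) : fpcomp 'cV[R]_k :=
  (\col_i (f i).1, \big[cat/[::]]_i (f i).2).

Definition vadd k (x y : 'cV[R]_k) := vec (fun i => add (x i 0) (y i 0)).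
Definition vsub k (x y : 'cV[R]_k) := vec (fun i => sub (x i 0) (y i 0)).
Definition vscale k (a : R) (x : 'cV[R]_k) := vec (fun i => mul a (x i 0)).
Definition vdiv k (x : 'cV[R]_k) (a : R) := vec (fun i => div (x i 0) a).
Definition matvec m k (B : 'M[R]_(m, k)) (x : 'cV[R]_k) : fpcomp 'cV[R]_m :=
  vec (fun i => dot (row i B)^T x).
Definition norm k (x : 'cV[R]_k) : fpcomp R :=
  let* s := dot x x in sqrt s.

Variable slv : tridiag_solver R.

Section Lanczos.
Variables (n : nat) (apply : 'cV[R]_n -> fpcomp 'cV[R]_n).

(* Returns the triples (q_i, alpha_i, beta_(i+1)) of at most m iterations,
   from q_(i-1) = q0, q_i = q, beta_i = beta. *)
Fixpoint lanczos_loop (m : nat) (q0 : 'cV[R]_n) (beta : R) (q : 'cV[R]_n) :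
    fpcomp (seq ('cV[R]_n * R * R)) :=
  if m is m'.+1 then
    let* z := apply q in
    let* w := vscale beta q0 in
    let* z := vsub z w in
    let* alpha := dot z q in
    let* w := vscale alpha q in
    let* z := vsub z w in
    let* beta' := norm z in
    if beta' == 0 then ret [:: (q, alpha, beta')]
    else
      let* q' := vdiv z beta' in
      let* s := lanczos_loop m' q beta' q' in
      ret ((q, alpha, beta') :: s)
  else ret [::].

Definition lanczos_basis (s : seq ('cV[R]_n * R * R)) : 'M[R]_(n, size s) :=
  \matrix_(i, j) (nth (0, 0, 0) s j).1.1 i 0.

Definition lanczos_tridiag (s : seq ('cV[R]_n * R * R)) : 'M[R]_(size s) :=
  tridiag (size s) (fun i => (nth (0, 0, 0) s i).1.2)
                   (fun i => (nth (0, 0, 0) s i).2).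

(* For c = 0 the normalization c / |c| is undefined; the output is then 0. *)
Definition lanczos (q : nat) (c : 'cV[R]_n) : fpcomp 'cV[R]_n :=
  let* gamma := norm c in
  if gamma == 0 then ret 0
  else
    let* q1 := vdiv c gamma in
    let* s := lanczos_loop q 0 0 q1 in
    let* w := slv (lanczos_tridiag s) in
    let* y := matvec (lanczos_basis s) w in
    vscale gamma y.

End Lanczos.

Section MetaSolver.
Variables (n : nat) (O : products R n).

Definition opA (z : 'cV[R]_n) := tick MulA (mulA O z).
Definition opAt (z : 'cV[R]_n) := tick MulAt (mulAt O z).
Definition opPinv (z : 'cV[R]_n) := tick MulPinv (mulPinv O z).
Definition opPinvt (z : 'cV[R]_n) := tick MulPinvt (mulPinvt O z).

Definition apply_normal (z : 'cV[R]_n) : fpcomp 'cV[R]_n :=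
  let* z := opPinv z in
  let* z := opA z in
  let* z := opAt z in
  opPinvt z.

Definition refine (q : nat) (b x : 'cV[R]_n) : fpcomp 'cV[R]_n :=
  let* r := opA x in
  let* r := vsub b r in
  let* c := opAt r in
  let* c := opPinvt c in
  let* dy := lanczos apply_normal q c in
  let* dx := opPinv dy in
  vadd x dx.

Fixpoint refine_iter (t q : nat) (b x : 'cV[R]_n) : fpcomp 'cV[R]_n :=
  if t is t'.+1 then
    let* x' := refine q b x in refine_iter t' q b x'
  else ret x.

(* The right-hand side is stored in floating point. *)
Definition meta_solver (t q : nat) (b : 'cV[R]_n) : fpcomp 'cV[R]_n :=
  refine_iter t q (map_mx (fl F) b) 0.

End MetaSolver.
End Algorithm.

(* Main.v *)
Require Import Defs.
From mathcomp Require Import all_boot all_order all_algebra.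
From mathcomp Require Import classical_sets reals exp.
From mathcomp Require Import boolp ring lra zify.

(** Write [B = A P^-1]. By hypothesis [cond B] and [|B|] are bounded, so the
    spectrum of [M = B^T B] lies between positive constants [lam] and
    [Lam], and everything below is measured in units of [kappa u] times
    polynomial factors.

    A product with [M] is computed with relative error [O(kappa u)]: errors made
    by [P^-1] and [A] are magnified by at most [|A| |P^-1| <= kappa |B|]
    ([apply_normal_err]). The computed Lanczos vectors therefore satisfy the
    three-term recurrence up to small local errors and are nearly normalized;
    consecutive vectors are nearly orthogonal ([lanczos_loop_ok]). Global
    orthogonality is lost.

    What has to be saved is that the tridiagonal matrix [T] stays as definite as
    [M]. The pivots of [T - th] are, up to rounding, the energies of the conjugate
    gradient directions of [M - th], an identity that only involves neighbouring
    Lanczos vectors ([direction_energy]). For [th] below the spectrum of [M]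
    energies are nonnegative. The rounding terms are harmless as long as the
    earlier pivots are not small, and this is arranged by lowering [th] a little
    at each step: pivots are concave decreasing functions of [th], so pivots which
    were positive before the move are bounded below after it
    ([perturbed_pivot_pos]). Hence [T] has form at least [lam / 2], and then a
    norm [O(Lam)] which does not grow with the number of steps
    ([projected_form_ge], [projected_norm_le]).

    Let [w = T^-1 e_1]. The recurrence shows that [M Q w - q_1] consists of
    rounding errors and of a multiple of the last entry of [w]
    ([lanczos_residual]). That entry decays geometrically in the order of [T]:
    Richardson's iteration for [T w = e_1] converges at a rate depending on
    [lam / Lam] only, while its [i]-th iterate vanishes beyond the first [i] entries
    ([tridiag_inverse_decay]). So [O(log (1 / (kappa u)))] steps solve the inner
    system to relative accuracy [O(kappa u)] ([lanczos_output]).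

    Consequently a refinement step multiplies the residual by [O(kappa u)] and
    adds the unavoidable rounding error [O(u |A| |x|)] of the computed residual
    ([refine_err]). Since [kappa u] times any polynomial factor may be assumed
    small, the contraction factor is at most [sqrt (kappa u)], and
    [2 log (1 / u) / log (1 / (kappa u))] steps leave a residual
    [O(u |A| |x|)] ([refinement_backward_error]), which a rank-one perturbation
    of [A] absorbs ([residual_backward_error]).

    All polynomial factors are dominated by powers of one gauge [g] with
    [g ^ 200 kappa u <= 1]; estimates of the form [a <= g ^ i x] are combined
    mechanically ([pow_le]). Operation counts follow the structure of the
    program. *)

Import Order.TTheory GRing.Theory Num.Theory.
Local Open Scope ring_scope.

Set Implicit Arguments.
Unset Strict Implicit.
Unset Printing Implicit Defensive.

(** * Euclidean geometry of column vectors *)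

Ltac nonneg := repeat first
  [ assumption | by apply: ltW | by [] | apply: sqr_ge0 | apply: exprn_ge0 | apply: addr_ge0
  | apply: mulr_ge0 | by rewrite invr_ge0 ltW | rewrite invr_ge0 ].

Section InnerProduct.
Context {R : realType}.
Implicit Types (n : nat) (a c : R).

Definition inner n (x y : 'cV[R]_n) : R := \sum_i x i 0 * y i 0.

Lemma innerC n (x y : 'cV[R]_n) : inner x y = inner y x.
Proof. by apply: eq_bigr => i _; rewrite mulrC. Qed.

Lemma innerDl n (x y z : 'cV[R]_n) : inner (x + y) z = inner x z + inner y z.
Proof. by rewrite -big_split; apply: eq_bigr => i _; rewrite mxE mulrDl. Qed.

Lemma innerZl n a (x y : 'cV[R]_n) : inner (a *: x) y = a * inner x y.
Proof. by rewrite mulr_sumr; apply: eq_bigr => i _; rewrite mxE mulrA. Qed.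

Lemma innerNl n (x y : 'cV[R]_n) : inner (- x) y = - inner x y.
Proof. by rewrite -scaleN1r innerZl mulN1r. Qed.

Lemma innerBl n (x y z : 'cV[R]_n) : inner (x - y) z = inner x z - inner y z.
Proof. by rewrite innerDl innerNl. Qed.

Lemma innerDr n (x y z : 'cV[R]_n) : inner z (x + y) = inner z x + inner z y.
Proof. by rewrite ![inner z _]innerC innerDl. Qed.

Lemma innerZr n a (x y : 'cV[R]_n) : inner x (a *: y) = a * inner x y.
Proof. by rewrite ![inner x _]innerC innerZl. Qed.

Lemma innerNr n (x y : 'cV[R]_n) : inner x (- y) = - inner x y.
Proof. by rewrite ![inner x _]innerC innerNl. Qed.

Lemma innerBr n (x y z : 'cV[R]_n) : inner z (x - y) = inner z x - inner z y.
Proof. by rewrite innerDr innerNr. Qed.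

Lemma inner0l n (x : 'cV[R]_n) : inner 0 x = 0.
Proof. by rewrite -[0](scale0r x) innerZl mul0r. Qed.

Definition innerE := (@innerDl, @innerDr, @innerNl, @innerNr, @innerZl, @innerZr).

Lemma inner_sub_scale n c (x y z w : 'cV[R]_n) : inner (x - c *: y) (z - c *: w) =
  inner x z - c * inner x w - c * inner y z + c ^+ 2 * inner y w.
Proof. by rewrite !(innerBl, innerBr, innerZl, innerZr); ring. Qed.

Lemma inner_mx m n (B : 'M[R]_(m, n)) (x : 'cV[R]_n) (y : 'cV[R]_m) :
  inner (B *m x) y = inner x (B^T *m y).
Proof.
have E k (v w : 'cV[R]_k) : inner v w = (v^T *m w) 0 0.
  by rewrite mxE; apply: eq_bigr => i _; rewrite mxE.
by rewrite !E trmx_mul mulmxA.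
Qed.

Lemma inner_ge0 n (x : 'cV[R]_n) : 0 <= inner x x.
Proof. by apply: sumr_ge0 => i _; rewrite -expr2 sqr_ge0. Qed.

Lemma norm2_ge0 n (x : 'cV[R]_n) : 0 <= norm2 x.
Proof. exact: sqrtr_ge0. Qed.

Lemma norm2_sqr n (x : 'cV[R]_n) : norm2 x ^+ 2 = inner x x.
Proof.
rewrite /norm2 sqr_sqrtr; last by apply: sumr_ge0 => i _; rewrite sqr_ge0.
by apply: eq_bigr => i _; rewrite expr2.
Qed.

Lemma norm2_eq0 n (x : 'cV[R]_n) : norm2 x = 0 -> x = 0.
Proof.
move=> x0; have := norm2_sqr x; rewrite x0 expr0n /= => /esym /eqP.
rewrite psumr_eq0 => [|i _]; last by rewrite -expr2 sqr_ge0.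
move=> /allP xi0; apply/matrixP => i j; rewrite ord1 mxE.
by have := xi0 i (mem_index_enum i); rewrite /= mulf_eq0 orbb => /eqP.
Qed.

Lemma norm2_0 n : norm2 (0 : 'cV[R]_n) = 0.
Proof.
by apply/eqP; rewrite -(@eqrXn2 _ 2) ?norm2_ge0 // norm2_sqr inner0l expr0n.
Qed.

Lemma norm2Z n a (x : 'cV[R]_n) : norm2 (a *: x) = `|a| * norm2 x.
Proof.
apply/eqP; rewrite -(@eqrXn2 _ 2) ?mulr_ge0 ?norm2_ge0 //.
by rewrite exprMn !norm2_sqr !innerE real_normK ?num_real // mulrA expr2.
Qed.

Lemma norm2N n (x : 'cV[R]_n) : norm2 (- x) = norm2 x.
Proof. by rewrite -scaleN1r norm2Z normrN1 mul1r. Qed.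

Lemma norm2_subC n (x y : 'cV[R]_n) : norm2 (x - y) = norm2 (y - x).
Proof. by rewrite -norm2N opprB. Qed.

Lemma cauchy_schwarz n (x y : 'cV[R]_n) : `|inner x y| <= norm2 x * norm2 y.
Proof.
rewrite -(@ler_sqr R) ?nnegrE ?mulr_ge0 ?norm2_ge0 // exprMn real_normK ?num_real //.
rewrite !norm2_sqr.
have [y0|y0] := eqVneq (inner y y) 0.
  have {}y0 : y = 0.
    by apply: norm2_eq0; apply/eqP; rewrite -(sqrf_eq0 (norm2 y)) norm2_sqr y0.
  by rewrite y0 ![inner _ 0]innerC !inner0l expr0n /= mulr0.
have {}y0 : 0 < inner y y by rewrite lt_def y0 inner_ge0.
have := inner_ge0 (inner y y *: x - inner x y *: y).
rewrite !innerE (innerC y x).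
set a := inner x x; set b := inner x y; set d := inner y y.
rewrite [X in 0 <= X](_ : _ = d * (a * d - b ^+ 2)); last by ring.
by rewrite pmulr_rge0 // subr_ge0.
Qed.

Lemma inner_le n (x y : 'cV[R]_n) : inner x y <= norm2 x * norm2 y.
Proof. exact: le_trans (ler_norm _) (cauchy_schwarz x y). Qed.

Lemma norm2D n (x y : 'cV[R]_n) : norm2 (x + y) <= norm2 x + norm2 y.
Proof.
rewrite -(@ler_sqr R) ?nnegrE ?addr_ge0 ?norm2_ge0 // norm2_sqr !innerE.
have := inner_le x y; rewrite (innerC y x) sqrrD !norm2_sqr; lra.
Qed.

Lemma norm2B n (x y : 'cV[R]_n) : norm2 (x - y) <= norm2 x + norm2 y.
Proof. by rewrite -[norm2 y]norm2N norm2D. Qed.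

(** Reverse triangle inequality, in the form used to bound a perturbed vector. *)
Lemma norm2_near n (x y : 'cV[R]_n) : norm2 x <= norm2 y + norm2 (x - y).
Proof. by have := norm2D y (x - y); rewrite addrC subrK. Qed.

Lemma norm2_sum n m (f : 'I_m -> 'cV[R]_n) :
  norm2 (\sum_i f i) <= \sum_i norm2 (f i).
Proof.
elim/big_ind2: _ => [|x1 x2 y1 y2 h1 h2|//]; first by rewrite norm2_0.
exact: le_trans (norm2D _ _) (lerD h1 h2).
Qed.

Lemma coord_le n (x : 'cV[R]_n) i : `|x i 0| <= norm2 x.
Proof.
rewrite -(@ler_sqr R) ?nnegrE ?norm2_ge0 // norm2_sqr real_normK ?num_real //.
rewrite /inner (bigD1 i) //= expr2 lerDl.
by apply: sumr_ge0 => j _; rewrite -expr2 sqr_ge0.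
Qed.

Lemma norm2_le_coord n (x y : 'cV[R]_n) a : 0 <= a ->
  (forall i, `|x i 0| <= a * `|y i 0|) -> norm2 x <= a * norm2 y.
Proof.
move=> a0 h; rewrite -(@ler_sqr R) ?nnegrE ?mulr_ge0 ?norm2_ge0 //.
rewrite exprMn !norm2_sqr mulr_sumr ler_sum // => i _.
have : `|x i 0| ^+ 2 <= (a * `|y i 0|) ^+ 2 by rewrite ler_sqr ?nnegrE ?mulr_ge0.
by rewrite exprMn !real_normK ?num_real // !expr2.
Qed.

End InnerProduct.

(** * Spectral norm and inverse *)

Section SpectralNorm.
Context {R : realType}.

Lemma mulmx_norm2_bounded m n (B : 'M[R]_(m, n)) :
  exists2 K, 0 < K & forall x, norm2 (B *m x) <= K * norm2 x.
Proof.
exists (1 + \sum_j norm2 (col j B)).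
  by rewrite ltr_pwDl ?ltr01 // sumr_ge0 // => j _; apply: norm2_ge0.
move=> x; have -> : B *m x = \sum_j x j 0 *: col j B.
  apply/matrixP => i k; rewrite ord1 !mxE summxE.
  by apply: eq_bigr => j _; rewrite !mxE mulrC.
apply: le_trans (norm2_sum _) _.
rewrite mulrDl mul1r mulr_suml ler_wpDl ?norm2_ge0 // ler_sum // => j _.
by rewrite norm2Z mulrC ler_wpM2l ?norm2_ge0 ?coord_le.
Qed.

Lemma norm2_mulmx m n (B : 'M[R]_(m, n)) x : norm2 (B *m x) <= specnorm B * norm2 x.
Proof.
have [K K0 hK] := mulmx_norm2_bounded B.
have [x0|x0] := eqVneq (norm2 x) 0.
  by rewrite x0 mulr0 (norm2_eq0 x0) mulmx0 norm2_0.
have {}x0 : 0 < norm2 x by rewrite lt_def x0 norm2_ge0.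
have nx : norm2 ((norm2 x)^-1 *: x) = 1.
  by rewrite norm2Z ger0_norm ?invr_ge0 ?ltW // mulVf ?gt_eqF.
rewrite -ler_pdivrMr // mulrC -[(norm2 x)^-1]gtr0_norm ?invr_gt0 // -norm2Z.
rewrite scalemxAr; apply: ub_le_sup; last by eexists; last reflexivity; rewrite /= nx.
exists K => _ [y /= y1 <-]; apply: le_trans (hK y) _.
by rewrite ler_piMr // ltW.
Qed.

Lemma specnorm_le m n (B : 'M[R]_(m, n)) c : 0 <= c ->
  (forall x, norm2 (B *m x) <= c * norm2 x) -> specnorm B <= c.
Proof.
move=> c0 hB; apply: ge_sup.
  by exists (norm2 (B *m 0)), 0 => //=; rewrite norm2_0.
by move=> _ [x /= x1 <-]; apply: le_trans (hB x) _; rewrite ler_piMr.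
Qed.

Lemma specnorm_ge0 m n (B : 'M[R]_(m, n)) : 0 <= specnorm B.
Proof.
have [K K0 hK] := mulmx_norm2_bounded B.
apply: (le_trans (norm2_ge0 (B *m 0))); apply: ub_le_sup.
  exists K => _ [y /= y1 <-]; apply: le_trans (hK y) _.
  by rewrite ler_piMr // ltW.
by exists 0 => //=; rewrite norm2_0.
Qed.

Lemma norm2_trmx_mulmx m n (B : 'M[R]_(m, n)) x :
  norm2 (B^T *m x) <= specnorm B * norm2 x.
Proof.
have [->|x0] := eqVneq (norm2 (B^T *m x)) 0.
  by rewrite mulr_ge0 ?specnorm_ge0 ?norm2_ge0.
have {}x0 : 0 < norm2 (B^T *m x) by rewrite lt_def x0 norm2_ge0.
rewrite -(ler_pM2l x0) -expr2 norm2_sqr -inner_mx.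
apply: le_trans (inner_le _ _) _; rewrite mulrA ler_wpM2r ?norm2_ge0 //.
by rewrite mulrC norm2_mulmx.
Qed.

Lemma norm2_comb_le n k c (f : 'cV[R]_k) (q : 'I_k -> 'cV[R]_n) : 0 <= c ->
  (forall i, norm2 (q i) <= c) -> norm2 (\sum_i f i 0 *: q i) <= k%:R * c * norm2 f.
Proof.
move=> c0 hq; apply: le_trans (norm2_sum _) _.
apply: le_trans (_ : \sum_(i < k) norm2 f * c <= _).
  by apply: ler_sum => i _; rewrite norm2Z ler_pM ?norm2_ge0 ?coord_le.
by rewrite sumr_const card_ord -[_ *+ _]mulr_natl; lra.
Qed.

Lemma unitmx_norm2_ge n (B : 'M[R]_n) d : 0 < d ->
  (forall x, d * norm2 x <= norm2 (B *m x)) -> B \in unitmx.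
Proof.
move=> d0 hB; rewrite -unitmx_tr -row_free_unit -kermx_eq0.
apply/rowV0P => v /sub_kermxP vB.
have : norm2 v^T = 0.
  apply/eqP; rewrite eq_le norm2_ge0 andbT -(pmulr_rle0 _ d0).
  apply: le_trans (hB _) _; rewrite -[B]trmxK -trmx_mul vB trmx0.
  by rewrite norm2_0.
by move/norm2_eq0 => v0; rewrite -[v]trmxK v0 trmx0.
Qed.

Lemma specnorm_inv_ge1 n (A : 'M[R]_n) : (0 < n)%N -> A \in unitmx ->
  1 <= specnorm A * specnorm (invmx A).
Proof.
move=> n0 Au; pose v : 'cV[R]_n := const_mx 1.
have v0 : 0 < norm2 v.
  rewrite lt_def norm2_ge0 andbT; apply/eqP => /norm2_eq0 /matrixP /(_ (Ordinal n0) 0).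
  by rewrite !mxE => /eqP; rewrite oner_eq0.
rewrite -(ler_pM2r v0) mul1r -{1}[v](mulKVmx Au).
apply: le_trans (norm2_mulmx _ _) _; rewrite -mulrA.
by rewrite ler_wpM2l ?specnorm_ge0 ?norm2_mulmx.
Qed.

(** A residual small relative to [|x|] is absorbed by the rank-one
    perturbation [r x^T / |x|^2] of the matrix. *)
Lemma residual_backward_error n (A : 'M[R]_n) (b x : 'cV[R]_n) eta : 0 <= eta ->
  norm2 (b - A *m x) <= eta * norm2 x ->
  exists2 dA : 'M[R]_n, specnorm dA <= eta & (A + dA) *m x = b.
Proof.
move=> eta0 hr; have [x0|x0] := eqVneq (norm2 x) 0.
  exists 0; first by apply: specnorm_le => // y; rewrite mul0mx norm2_0 mulr_ge0 ?norm2_ge0.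
  move: hr; rewrite x0 mulr0 addr0 => hr.
  by apply/esym/eqP; rewrite -subr_eq0; apply/eqP/norm2_eq0/eqP; rewrite eq_le hr norm2_ge0.
have {}x0 : 0 < norm2 x by rewrite lt_def x0 norm2_ge0.
have tE (y : 'cV[R]_n) : x^T *m y = (inner x y)%:M.
  apply/matrixP => i j; rewrite !ord1 !mxE eqxx mulr1n.
  by apply: eq_bigr => l _; rewrite mxE.
exists ((norm2 x ^- 2) *: ((b - A *m x) *m x^T)).
  apply: specnorm_le => // y; rewrite -scalemxAl -mulmxA tE mul_mx_scalar scalerA norm2Z.
  apply: le_trans (_ : (norm2 x ^- 2 * (norm2 x * norm2 y)) * (eta * norm2 x) <= _).
    apply: ler_pM; rewrite ?norm2_ge0 // normrM ger0_norm ?invr_ge0 ?sqr_ge0 //.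
    by rewrite ler_wpM2l ?invr_ge0 ?sqr_ge0 // cauchy_schwarz.
  by rewrite le_eqVlt; apply/orP; left; apply/eqP; field; rewrite gt_eqF.
rewrite mulmxDl -scalemxAl -mulmxA tE mul_mx_scalar scalerA -norm2_sqr mulVf ?scale1r.
  by rewrite addrC subrK.
by rewrite expf_eq0 /= gt_eqF.
Qed.

End SpectralNorm.

(** * Extreme singular values and the condition number *)

Section Conditioning.
Context {R : realType}.

(** A positive semidefinite form dominates [|N x|^2] up to a constant, so it
    is bounded below on the unit sphere as soon as [N] is invertible. *)
Lemma psd_degenerate_singular n (N : 'M[R]_n) : N^T = N ->
  (forall x, 0 <= inner x (N *m x)) ->
  (forall c, 0 < c -> exists x, inner x (N *m x) < c * inner x x) ->
  N \notin unitmx.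
Proof.
move=> Nsym Npsd small; apply/negP => Nunit.
have [K K0 hK] := mulmx_norm2_bounded (invmx N).
have [L L0 hL] := mulmx_norm2_bounded N.
have [|x] := small (K ^+ 2 * L)^-1; first by rewrite invr_gt0 mulr_gt0 ?exprn_gt0.
apply/negP; rewrite -leNgt mulrC ler_pdivrMr ?mulr_gt0 ?exprn_gt0 // mulrC -mulrA.
have xN : inner x x <= K ^+ 2 * inner (N *m x) (N *m x).
  have := hK (N *m x); rewrite mulKmx // -!norm2_sqr -exprMn.
  by rewrite ler_sqr ?nnegrE ?mulr_ge0 ?norm2_ge0 // ltW.
apply: le_trans xN _; rewrite ler_wpM2l ?sqr_ge0 //.
have := Npsd (x - L^-1 *: (N *m x)).
have : inner (N *m x) (N *m (N *m x)) <= L * inner (N *m x) (N *m x).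
  apply: le_trans (inner_le _ _) _; rewrite -norm2_sqr expr2 mulrA mulrC.
  by rewrite ler_wpM2r ?norm2_ge0.
rewrite mulmxBr -scalemxAr !(innerBl, innerBr, innerZl, innerZr).
have -> : inner x (N *m (N *m x)) = inner (N *m x) (N *m x) by rewrite inner_mx Nsym.
set a := inner x _; set b := inner _ (N *m x); set d := inner _ _.
move=> dLb /(mulr_ge0 (ltW L0)).
rewrite [X in 0 <= X](_ : _ = L * a - 2 * b + L^-1 * d); last by field; rewrite gt_eqF.
have : L^-1 * d <= b by rewrite mulrC ler_pdivrMr // mulrC.
lra.
Qed.

(** The best lower bound [mu] of the Rayleigh quotient is an eigenvalue: were
    [S - mu] invertible, the bound could be raised. *)
Lemma rayleigh_min n (S : 'M[R]_n) : (0 < n)%N -> S^T = S ->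
  exists2 mu, eigenvalue S mu & forall x, mu * inner x x <= inner x (S *m x).
Proof.
move=> n0 Ssym; pose D := [set mu | forall x, mu * inner x x <= inner x (S *m x)]%classic.
have [K K0 hK] := mulmx_norm2_bounded S.
pose e : 'cV[R]_n := \col_i (i == Ordinal n0)%:R.
have ee : inner e e = 1.
  rewrite /inner (bigD1 (Ordinal n0)) //= big1 => [|i /negPf i0]; rewrite !mxE.
    by rewrite eqxx mulr1 addr0.
  by rewrite i0 mulr0.
have Dub : has_ubound D.
  by exists (inner e (S *m e)) => mu /(_ e); rewrite ee mulr1.
have D0 : D (- K).
  move=> x; rewrite mulNr lerNl -innerNr; apply: le_trans (inner_le _ _) _.
  by rewrite norm2N -norm2_sqr expr2 mulrA mulrC ler_wpM2r ?norm2_ge0.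
have muD : D (sup D).
  move=> x; have [x0|x0] := eqVneq (inner x x) 0.
    have -> : x = 0.
      by apply/norm2_eq0/eqP; rewrite -(sqrf_eq0 (norm2 x)) norm2_sqr x0.
    by rewrite !inner0l mulr0.
  have {}x0 : 0 < inner x x by rewrite lt_def x0 inner_ge0.
  rewrite -ler_pdivlMr //; apply: ge_sup; first by exists (- K).
  by move=> nu /(_ x); rewrite ler_pdivlMr.
exists (sup D) => //.
rewrite /eigenvalue /eigenspace kermx_eq0 row_free_unit.
apply: psd_degenerate_singular => [|x|c c0].
- by rewrite linearB /= Ssym tr_scalar_mx.
- by rewrite mulmxBl mul_scalar_mx innerBr innerZr subr_ge0.
apply: contrapT => h; suff : D (sup D + c).
  by move/(ub_le_sup Dub); rewrite gerDl leNgt c0.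
move=> x; rewrite leNgt; apply/negP => hx; apply: h; exists x.
by rewrite mulmxBl mul_scalar_mx innerBr innerZr ltrBlDl -mulrDl.
Qed.

Lemma singular_value_form n (B : 'M[R]_n) s : singular_values B s ->
  exists2 x, 0 < norm2 x & norm2 (B *m x) = s * norm2 x.
Proof.
move=> [s0 /eigenvalueP [v vB v0]]; exists v^T.
  rewrite lt_def norm2_ge0 andbT; apply: contra v0 => /eqP/norm2_eq0 v0.
  by rewrite -[v]trmxK v0 linear0.
have Bv : B^T *m B *m v^T = s ^+ 2 *: v^T.
  by rewrite -linearZ /= -vB !trmx_mul trmxK.
apply/eqP; rewrite -(@eqrXn2 _ 2) ?mulr_ge0 ?norm2_ge0 //.
by rewrite exprMn !norm2_sqr inner_mx mulmxA Bv innerZr.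
Qed.

Lemma gram_eigenvalue_sqrt n (B : 'M[R]_n) mu : eigenvalue (B^T *m B) mu ->
  0 <= mu /\ singular_values B (Num.sqrt mu).
Proof.
move=> eigmu; suff mu0 : 0 <= mu by do !split=> //; rewrite ?sqrtr_ge0 // sqr_sqrtr.
have /eigenvalueP [v vB v0] := eigmu.
have h : mu * inner v^T v^T = norm2 (B *m v^T) ^+ 2.
  rewrite norm2_sqr inner_mx mulmxA -innerZr; congr (inner _ _).
  by rewrite -linearZ /= -vB !trmx_mul trmxK.
have v1 : 0 < inner v^T v^T.
  rewrite lt_def inner_ge0 andbT -norm2_sqr sqrf_eq0; apply: contra v0.
  by move=> /eqP/norm2_eq0 v0; rewrite -[v]trmxK v0 linear0.
by rewrite -(pmulr_lge0 _ v1) h sqr_ge0.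
Qed.

Lemma sigma_max_ge0 n (B : 'M[R]_n) : 0 <= sigma_max B.
Proof.
have [[s sB]|sB] := pselect (singular_values B !=set0)%classic.
  have [s0 _] := sB; apply: le_trans s0 _; apply: ub_le_sup => //.
  exists (specnorm B) => r /singular_value_form [y y0 By].
  by rewrite -(ler_pM2r y0) -By norm2_mulmx.
rewrite /sigma_max (_ : singular_values B = set0) ?sup0 //.
by rewrite -subset0 => s sB'; apply: sB; exists s.
Qed.

Lemma sigma_max_le n (B : 'M[R]_n) c : 0 <= c ->
  (forall x, norm2 (B *m x) <= c * norm2 x) -> sigma_max B <= c.
Proof.
move=> c0 hB; have [[s sB]|sB] := pselect (singular_values B !=set0)%classic.
  apply: ge_sup; first by exists s.
  move=> s' /singular_value_form [x x0 Bx]; have := hB x.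
  by rewrite Bx ler_pM2r.
rewrite /sigma_max (_ : singular_values B = set0) ?sup0 //.
by rewrite -subset0 => s sB'; apply: sB; exists s.
Qed.

(** With no singular value at all [sigma_min] is [inf set0 = 0], and then the
    quotient [cond B] is [0]; the bound survives this degenerate case. *)
Lemma cond_le n (B : 'M[R]_n) c d : 0 <= c -> 0 < d ->
  (forall x, norm2 (B *m x) <= c * norm2 x) ->
  (forall x, d * norm2 x <= norm2 (B *m x)) -> cond B <= c / d.
Proof.
move=> c0 d0 hc hd; rewrite /cond.
have [[s sB]|sB] := pselect (singular_values B !=set0)%classic.
  have h : d <= sigma_min B.
    apply: lb_le_inf; first by exists s.
    move=> s' /singular_value_form [x x0 Bx]; have := hd x.
    by rewrite Bx ler_pM2r.
  apply: le_trans (_ : c / sigma_min B <= _).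
    by rewrite ler_wpM2r ?invr_ge0 ?sigma_max_le // (le_trans (ltW d0)).
  by rewrite ler_wpM2l // lef_pV2 // posrE (lt_le_trans d0).
rewrite /sigma_min (_ : singular_values B = set0).
  by rewrite inf0 invr0 mulr0 divr_ge0 // ltW.
by rewrite -subset0 => s sB'; apply: sB; exists s.
Qed.

Lemma norm2_le_sigma_max n (B : 'M[R]_n) x : (0 < n)%N ->
  norm2 (B *m x) <= sigma_max B * norm2 x.
Proof.
move=> n0; have Ssym : (- (B^T *m B))^T = - (B^T *m B).
  by rewrite linearN /= trmx_mul trmxK.
have [mu mueig mumin] := rayleigh_min n0 Ssym.
have formE y : inner y (- (B^T *m B) *m y) = - norm2 (B *m y) ^+ 2.
  by rewrite mulNmx innerNr norm2_sqr inner_mx mulmxA.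
have eigN : eigenvalue (B^T *m B) (- mu).
  have /eigenvalueP [v vB v0] := mueig; apply/eigenvalueP; exists v => //.
  by rewrite scaleNr -vB mulmxN opprK.
have [mu0 sB] := gram_eigenvalue_sqrt eigN.
have le_sqrt : norm2 (B *m x) <= Num.sqrt (- mu) * norm2 x.
  rewrite -(@ler_sqr R) ?nnegrE ?mulr_ge0 ?norm2_ge0 ?sqrtr_ge0 //.
  rewrite exprMn (sqr_sqrtr mu0) norm2_sqr [norm2 x ^+ 2]norm2_sqr.
  have := mumin x; rewrite formE norm2_sqr; lra.
apply: le_trans le_sqrt _; rewrite ler_wpM2r ?norm2_ge0 //.
apply: ub_le_sup => //; exists (specnorm B) => s /singular_value_form [y y0 By].
by rewrite -(ler_pM2r y0) -By norm2_mulmx.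
Qed.

Lemma sigma_min_le_norm2 n (B : 'M[R]_n) x : (0 < n)%N ->
  sigma_min B * norm2 x <= norm2 (B *m x).
Proof.
move=> n0; have Ssym : (B^T *m B)^T = B^T *m B by rewrite trmx_mul trmxK.
have [mu mueig mumin] := rayleigh_min n0 Ssym.
have formE y : inner y ((B^T *m B) *m y) = norm2 (B *m y) ^+ 2.
  by rewrite norm2_sqr inner_mx mulmxA.
have [mu0 sB] := gram_eigenvalue_sqrt mueig.
apply: le_trans (_ : Num.sqrt mu * norm2 x <= _).
  by rewrite ler_wpM2r ?norm2_ge0 //; apply: ge_inf => //; exists 0 => s [].
rewrite -(@ler_sqr R) ?nnegrE ?mulr_ge0 ?norm2_ge0 ?sqrtr_ge0 //.
by rewrite exprMn (sqr_sqrtr mu0) -formE norm2_sqr.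
Qed.

(** The link between the condition number, defined by eigenvalues of the Gram
    matrix, and the norm estimates used everywhere else. *)
Lemma specnorm_inv_le_cond n (B : 'M[R]_n) : (0 < n)%N -> B \in unitmx ->
  specnorm B * specnorm (invmx B) <= cond B.
Proof.
move=> n0 Bunit; have [K K0 hK] := mulmx_norm2_bounded (invmx B).
have smin : 0 < sigma_min B.
  have Ssym : (B^T *m B)^T = B^T *m B by rewrite trmx_mul trmxK.
  have [mu /gram_eigenvalue_sqrt [_ sB] _] := rayleigh_min n0 Ssym.
  apply: lt_le_trans (_ : K^-1 <= _); first by rewrite invr_gt0.
  apply: lb_le_inf; first by exists (Num.sqrt mu).
  move=> s /singular_value_form [x x0 Bx]; rewrite -(ler_pM2r x0) -Bx.
  by rewrite mulrC ler_pdivrMr // mulrC -{1}(mulKmx Bunit x) hK.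
rewrite /cond; apply: ler_pM; rewrite ?specnorm_ge0 //.
  by apply: specnorm_le => [|x]; [apply: sigma_max_ge0 | apply: norm2_le_sigma_max].
apply: specnorm_le => [|x]; first by rewrite invr_ge0 ltW.
rewrite mulrC ler_pdivlMr // mulrC -{2}[x](mulKVmx Bunit).
exact: sigma_min_le_norm2.
Qed.

Lemma cond_ge0 n (B : 'M[R]_n) : 0 <= cond B.
Proof.
rewrite divr_ge0 ?sigma_max_ge0 //.
have [[s sB]|sB] := pselect (singular_values B !=set0)%classic.
  by apply: lb_le_inf; [exists s | move=> s' []].
rewrite /sigma_min (_ : singular_values B = set0) ?inf0 //.
by rewrite -subset0 => s sB'; apply: sB; exists s.
Qed.

End Conditioning.

(** * Positivity of the projected tridiagonal matrix *)

Section Pivots.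
Context {R : realType}.
Variables al b : nat -> R.

(** The pivots of the [L D L^T] factorization of [T - th], where [T] is the
    tridiagonal matrix with diagonal [al] and off-diagonal [b]. *)
Fixpoint pivot (th : R) (m : nat) : R :=
  al m - th - (if m is j.+1 then b j ^+ 2 / pivot th j else 0).

(** The squared norm of column [m] of [L^-T]; it is also minus the derivative
    of [pivot th m] with respect to [th]. *)
Fixpoint dirsq (th : R) (m : nat) : R :=
  1 + (if m is j.+1 then (b j / pivot th j) ^+ 2 * dirsq th j else 0).

Lemma dirsq_ge1 th m : 1 <= dirsq th m.
Proof.
by elim: m => [|m IH] /=; rewrite ?addr0 // lerDl mulr_ge0 ?sqr_ge0 ?(le_trans ler01).
Qed.

(** Concavity of the pivots in the shift: [dirsq] is minus their derivative. *)
Lemma pivot_shift th del m : 0 <= del ->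
  (forall i, (i < m)%N -> 0 < pivot (th + del) i) ->
  pivot (th + del) m + del * dirsq th m <= pivot th m.
Proof.
move=> del0; elim: m => [_|m IH pos]; first by rewrite /=; lra.
have {IH} := IH (fun i im => pos i (ltnW im)).
have := pos m (ltnSn m); rewrite /=; have := dirsq_ge1 th m.
set p' := pivot (th + del) m; set p := pivot th m; set S := dirsq th m => S1 p'0 IH.
have y0 : 0 <= del * S by rewrite mulr_ge0 // (le_trans ler01).
have p0 : 0 < p by lra.
have key : p^-1 + del * S / p ^+ 2 <= p'^-1.
  have -> : p^-1 + del * S / p ^+ 2 = (p + del * S) / p ^+ 2.
    by field; rewrite gt_eqF.
  rewrite ler_pdivrMr ?exprn_gt0 // [_ * p ^+ 2]mulrC ler_pdivlMr //.
  by move: (del * S) y0 IH => y y0 IH; nra.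
have := ler_wpM2l (sqr_ge0 (b m)) key.
have -> : b m ^+ 2 * (p^-1 + del * S / p ^+ 2) =
          b m ^+ 2 / p + del * ((b m / p) ^+ 2 * S) by field; rewrite gt_eqF.
lra.
Qed.

Lemma pivot_pos_shift th del m : 0 <= del ->
  (forall i, (i < m)%N -> 0 < pivot (th + del) i) ->
  forall i, (i < m)%N -> 0 < pivot th i /\ del * dirsq th i <= pivot th i.
Proof.
move=> del0 pos i im; have := pivot_shift del0 (fun j ji => pos j (ltn_trans ji im)).
have := pos i im; have : 0 <= del * dirsq th i.
  by rewrite mulr_ge0 // (le_trans ler01) ?dirsq_ge1.
lra.
Qed.

(** Near-singularity at [th] is excluded by positivity at [th + del]: the drop of
    the pivots between the two shifts already pays for [dirsq]. *)
Lemma dirsq_le th del B m : 0 < del ->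
  (forall i, (i < m)%N -> 0 < pivot (th + del) i) ->
  (forall i, (i < m)%N -> `|b i| <= B) -> dirsq th m <= 1 + (B / del) ^+ 2.
Proof.
case: m => [|m] del0 pos hB /=; first by rewrite lerD2l sqr_ge0.
rewrite lerD2l; have [p0 hS] := pivot_pos_shift (ltW del0) pos (ltnSn m).
have S1 := dirsq_ge1 th m; move: hS S1 p0.
set p := pivot th m; set S := dirsq th m => hS S1 p0.
have delp : del <= p by nra.
have -> : (b m / p) ^+ 2 * S = b m ^+ 2 * (S / p ^+ 2) by field; rewrite gt_eqF.
rewrite exprMn; apply: ler_pM; rewrite ?sqr_ge0 ?divr_ge0 ?sqr_ge0 ?(le_trans ler01) //.
  by rewrite -(real_normK (num_real (b m))) ler_sqr ?nnegrE ?hB // (le_trans _ (hB m _)).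
rewrite exprVn ler_pdivrMr ?exprn_gt0 // mulrC ler_pdivlMr ?exprn_gt0 //.
by nra.
Qed.

(** Completing the squares one variable at a time leaves the last pivot. *)
Lemma pivot_form th (x : nat -> R) m : (forall i, (i < m)%N -> 0 < pivot th i) ->
  pivot th m * x m ^+ 2 <=
  \sum_(0 <= i < m.+1) (al i - th) * x i ^+ 2
  + 2 * \sum_(0 <= i < m) b i * x i * x i.+1.
Proof.
elim: m => [_|m IH pos]; first by rewrite big_nat1 big_geq //=; lra.
have {IH} := IH (fun i im => pos i (ltnW im)); have p0 := pos m (ltnSn m).
move: p0 => /[swap] IH p0; rewrite (big_nat_recr m.+1) // [X in 2 * X](big_nat_recr m) //=.
move: p0 IH; set p := pivot th m => p0.
set s1 := \sum_(0 <= i < m.+1) _; set s2 := \sum_(0 <= i < m) _ => IH.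
have sq : 0 <= p * (x m + b m / p * x m.+1) ^+ 2 by rewrite mulr_ge0 ?sqr_ge0 ?ltW.
have E : p * (x m + b m / p * x m.+1) ^+ 2 =
  p * x m ^+ 2 + 2 * (b m * x m * x m.+1) + b m ^+ 2 / p * x m.+1 ^+ 2.
  by field; rewrite gt_eqF.
lra.
Qed.

Lemma pivot_le_diag th m : (forall i, (i < m)%N -> 0 < pivot th i) ->
  pivot th m <= al m - th.
Proof.
case: m => [|m] pos /=; first by lra.
by rewrite gerBl divr_ge0 ?sqr_ge0 ?ltW ?pos.
Qed.

(** The pivot [m.+1] is a Schur complement, so the principal minor of order
    two at [m] is nonnegative. *)
Lemma offdiag_sqr_le th m : 0 <= th -> (forall i, (i <= m.+1)%N -> 0 < pivot th i) ->
  b m ^+ 2 <= al m * al m.+1.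
Proof.
move=> th0 pos; have p0 := pos _ (leqnSn m); have := pos _ (leqnn m.+1).
have dm : pivot th m <= al m - th by apply: pivot_le_diag => i im; rewrite pos // ltnW // ltnS ltnW.
rewrite /= subr_gt0 ltr_pdivrMr // => /ltW hb; apply: le_trans hb _.
rewrite mulrC; have dmS := pivot_le_diag (fun i (im : (i < m.+1)%N) => pos i (ltnW im)).
have pS := pos _ (leqnn m.+1).
by apply: ler_pM; lra.
Qed.

End Pivots.

Section PerturbedLanczos.
Context {R : realType}.
Variables (n : nat) (M : 'M[R]_n) (q : nat -> 'cV[R]_n) (al b : nat -> R).
Variables (k : nat) (eps : R).

Definition prev (j : nat) : 'cV[R]_n := if j is i.+1 then b i *: q i else 0.

Definition recurrence_error (j : nat) : 'cV[R]_n :=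
  M *m q j - prev j - al j *: q j - b j *: q j.+1.

Hypothesis M_sym : M^T = M.
Hypothesis eps0 : 0 <= eps.
Hypothesis eps1 : eps <= 1.
Hypothesis rec_err : forall j, (j < k)%N -> norm2 (recurrence_error j) <= eps.
Hypothesis q_unit : forall j, (j < k)%N -> `|inner (q j) (q j) - 1| <= eps.
Hypothesis q_local : forall j, (j < k)%N -> `|b j * inner (q j) (q j.+1)| <= eps.

(** The directions of conjugate gradients for [M - th], i.e. the columns of
    [Q L^-T]. *)
Fixpoint direction (th : R) (m : nat) : 'cV[R]_n :=
  q m - (if m is j.+1 then (b j / pivot al b th j) *: direction th j else 0).

Definition shifted (th : R) (x : 'cV[R]_n) := M *m x - th *: x.

Lemma inner_shifted th x y : inner x (shifted th y) = inner (shifted th x) y.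
Proof.
by rewrite /shifted innerBr innerBl innerZr innerZl inner_mx M_sym.
Qed.

Lemma norm2_q j : (j < k)%N -> norm2 (q j) <= 2.
Proof.
move=> /q_unit h; rewrite -(@ler_sqr R) ?nnegrE ?norm2_ge0 // norm2_sqr.
move: h; rewrite ler_norml; have := eps1; lra.
Qed.

Definition direction_error th m : 'cV[R]_n :=
  shifted th (direction th m) - pivot al b th m *: q m - b m *: q m.+1.

Lemma shifted_q th m : shifted th (q m) =
  prev m + (al m - th) *: q m + b m *: q m.+1 + recurrence_error m.
Proof.
rewrite /shifted /recurrence_error scalerBl; move: (M *m q m) (prev m) => x y.
move: (al m *: _) (th *: _) (b m *: _) => z w v.
by apply/matrixP => i j; rewrite !mxE; ring.
Qed.

Lemma shifted_direction th m : shifted th (direction th m) =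
  pivot al b th m *: q m + b m *: q m.+1 + direction_error th m.
Proof.
rewrite /direction_error; move: (shifted _ _) (_ *: q m) (_ *: q m.+1) => x y z.
by apply/matrixP => i j; rewrite !mxE; ring.
Qed.

Lemma shifted_lin th c x y : shifted th (x - c *: y) = shifted th x - c *: shifted th y.
Proof.
rewrite /shifted mulmxBr -scalemxAr !scalerBr !scalerA [th * c]mulrC.
move: (M *m x) (c *: _) (th *: _) (_ *: y) => s t v w.
by apply/matrixP => i j; rewrite !mxE; ring.
Qed.

(** The definition of the directions cancels the components along [q m], the
    pivot recurrence those along [q m.+1]. *)
Lemma direction_errorS th m : pivot al b th m != 0 ->
  direction_error th m.+1 =
  recurrence_error m.+1 - (b m / pivot al b th m) *: direction_error th m.
Proof.
move=> p0; rewrite {1}/direction_error [direction _ _]/= shifted_lin.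
rewrite shifted_q shifted_direction /=.
set c := b m / _; have cp : c * pivot al b th m = b m by rewrite /c divfK.
have -> : b m ^+ 2 / pivot al b th m = c * b m by rewrite /c; ring.
move: (direction_error th m) (recurrence_error m.+1) (pivot al b th m) cp => D E p <-.
by apply/matrixP => i j; rewrite !mxE; ring.
Qed.

(** The errors obey the same two-term recurrence as the directions, hence are
    controlled by the same quantity [dirsq]; the factor [m.+1] comes from
    the weighted arithmetic-geometric mean inequality used at each step. *)
Lemma norm2_direction_error th m : (m < k)%N ->
  (forall i, (i < m)%N -> 0 < pivot al b th i) ->
  norm2 (direction_error th m) ^+ 2 <= eps ^+ 2 * m.+1%:R * dirsq al b th m.
Proof.
elim: m => [|m IH] mk pos.
  have -> : direction_error th 0 = recurrence_error 0.
    rewrite /direction_error /= !subr0 shifted_q /prev /= add0r.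
    move: (recurrence_error 0) => E; apply/matrixP => i j; rewrite !mxE; ring.
  by rewrite /= addr0 !mulr1 ler_sqr ?nnegrE ?norm2_ge0 ?rec_err.
have {IH} := IH (ltnW mk) (fun i im => pos i (ltnW im)).
rewrite direction_errorS ?gt_eqF ?pos // [dirsq _ _ _ _]/=.
set c := b m / _; set f := norm2 (direction_error _ _); set S := dirsq _ _ _ _ => IH.
have tri : norm2 (recurrence_error m.+1 - c *: direction_error th m) <= eps + `|c| * f.
  by apply: le_trans (norm2B _ _) _; rewrite norm2Z lerD2r rec_err.
have f0 : 0 <= f := norm2_ge0 _.
have : norm2 (recurrence_error m.+1 - c *: direction_error th m) ^+ 2 <=
       (eps + `|c| * f) ^+ 2.
  by rewrite ler_sqr ?nnegrE ?norm2_ge0 ?addr_ge0 ?mulr_ge0.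
move=> /le_trans; apply.
have cf : (`|c| * f) ^+ 2 <= c ^+ 2 * (eps ^+ 2 * m.+1%:R * S).
  by rewrite exprMn real_normK ?num_real // ler_wpM2l ?sqr_ge0.
rewrite -[m.+2]addn1 natrD; have m1 : 1 <= m.+1%:R :> R by rewrite ler1n.
move: (m.+1%:R) m1 (`|c| * f) cf => N N1 y.
set z := c ^+ 2 * _ => cf.
have -> : eps ^+ 2 * (N + 1) * (1 + c ^+ 2 * S) = eps ^+ 2 * (N + 1) + z * (N + 1) / N.
  by rewrite /z; field; lra.
have N0 : 0 < N by lra.
have amgm : 2 * eps * y <= N * eps ^+ 2 + y ^+ 2 / N.
  have : 0 <= (N * eps - y) ^+ 2 / N by rewrite divr_ge0 ?sqr_ge0 // ltW.
  have -> : (N * eps - y) ^+ 2 / N = N * eps ^+ 2 - 2 * eps * y + y ^+ 2 / N.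
    by field; rewrite gt_eqF.
  by lra.
have : y ^+ 2 * (1 + N^-1) <= z * (1 + N^-1).
  by rewrite ler_wpM2r // addr_ge0 // invr_ge0 ltW.
have -> : z * (N + 1) / N = z * (1 + N^-1) by field; rewrite gt_eqF.
rewrite mulrDr mulr1; lra.
Qed.

(** The energy of a conjugate gradient direction equals its pivot up to
    rounding. The cross terms involve only neighbouring basis vectors, so local
    orthogonality suffices. *)
Lemma direction_energy th D G Sb m : (m < k)%N -> 0 <= G ->
  (forall i, (i < m)%N -> 0 < pivot al b th i) ->
  (forall i, (i <= m)%N -> `|al i - th| <= D) ->
  (forall i, (i < m)%N -> b i ^+ 2 / pivot al b th i <= G) ->
  (forall i, (i <= m)%N -> dirsq al b th i <= Sb) ->
  `|inner (direction th m) (shifted th (direction th m)) - pivot al b th m|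
  <= eps * (D + 4 + 2 * G + 4 * k%:R * Sb) * dirsq al b th m.
Proof.
move=> + G0; elim: m => [|m IH] mk pos hD hG hS.
  have -> : direction th 0 = q 0 by rewrite /= subr0.
  have e0 := rec_err mk; have qe := cauchy_schwarz (q 0%N) (recurrence_error 0).
  rewrite shifted_q; move: (recurrence_error 0) e0 qe => E0 e0 qe.
  rewrite /prev add0r !innerDr !innerZr [pivot _ _ _ _]/= [dirsq _ _ _ _]/=.
  rewrite subr0 addr0 mulr1.
  have := q_unit mk; have := q_local mk; have := hD _ (leqnn 0); have q2 := norm2_q mk.
  have := hS _ (leqnn 0); rewrite [dirsq _ _ _ _]/= addr0 => S1.
  set a := al 0%N - th; set h := b 0%N * _; set e := inner _ E0.
  move=> aD hh nu.
  have -> : a * inner (q 0%N) (q 0%N) + h + e - a = a * (inner (q 0%N) (q 0%N) - 1) + h + e.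
    by ring.
  have eb : `|e| <= 2 * eps.
    by apply: le_trans qe _; apply: ler_pM; rewrite ?norm2_ge0.
  have ab : `|a * (inner (q 0%N) (q 0%N) - 1)| <= D * eps by rewrite normrM ler_pM.
  have kS : 0 <= k%:R * Sb by rewrite mulr_ge0 // (le_trans ler01).
  have epsX : 0 <= eps * (2 * G + 4 * (k%:R * Sb)) by rewrite mulr_ge0 //; lra.
  apply: le_trans (ler_normD _ _) _; apply: le_trans (lerD (ler_normD _ _) (lexx _)) _.
  by have := eps0; lra.
have [p0 IHm] : 0 < pivot al b th m /\ `|inner (direction th m) (shifted th (direction th m)) -
     pivot al b th m| <= eps * (D + 4 + 2 * G + 4 * k%:R * Sb) * dirsq al b th m.
  split; first exact: pos.
  apply: IH => [|i im|i im|i im|i im]; first exact: ltnW.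
  - exact: pos (ltnW im).
  - exact: hD (leqW im).
  - exact: hG (leqW im).
  - exact: hS (leqW im).
have F2 := norm2_direction_error (ltnW mk) (fun i im => pos i (ltnW im)).
have e0 := rec_err mk; have qe := cauchy_schwarz (q m.+1) (recurrence_error m.+1).
have q2 := norm2_q mk.
have fF := cauchy_schwarz (q m.+1) (direction_error th m).
have nu := q_unit mk; have hloc := q_local mk; have gloc := q_local (ltnW mk).
have aD := hD _ (leqnn m.+1); have Gm := hG _ (ltnSn m).
have Sm := hS _ (leqnn m.+1).
have E : inner (direction th m.+1) (shifted th (direction th m.+1)) - pivot al b th m.+1
  = - (b m * inner (q m) (q m.+1)) + (al m.+1 - th) * (inner (q m.+1) (q m.+1) - 1)
    + b m.+1 * inner (q m.+1) (q m.+2) + inner (q m.+1) (recurrence_error m.+1)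
    - 2 * (b m ^+ 2 / pivot al b th m * (inner (q m.+1) (q m.+1) - 1))
    - 2 * (b m / pivot al b th m * inner (q m.+1) (direction_error th m))
    + (b m / pivot al b th m) ^+ 2 *
      (inner (direction th m) (shifted th (direction th m)) - pivot al b th m).
  rewrite [direction _ m.+1]/= [pivot _ _ _ m.+1]/= shifted_lin inner_sub_scale.
  rewrite (inner_shifted th (direction th m) (q m.+1)).
  rewrite (innerC (shifted th (direction th m)) (q m.+1)).
  have -> : inner (q m.+1) (shifted th (direction th m)) =
    pivot al b th m * inner (q m) (q m.+1) + b m * inner (q m.+1) (q m.+1)
    + inner (q m.+1) (direction_error th m).
    rewrite shifted_direction; move: (direction_error th m) => F.
    by rewrite !innerDr !innerZr (innerC (q m.+1) (q m)).
  have -> : inner (q m.+1) (shifted th (q m.+1)) =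
    b m * inner (q m) (q m.+1) + (al m.+1 - th) * inner (q m.+1) (q m.+1)
    + b m.+1 * inner (q m.+1) (q m.+2) + inner (q m.+1) (recurrence_error m.+1).
    rewrite shifted_q; move: (recurrence_error m.+1) => E1.
    by rewrite /prev !innerDr !innerZr (innerC (q m.+1) (q m)).
  by field; rewrite gt_eqF.
rewrite {}E [dirsq _ _ _ m.+1]/=.
move: Sm; rewrite [dirsq _ _ _ m.+1]/=.
set p := pivot al b th m; set c := b m / p; set S := dirsq al b th m.
set psi := inner (direction th m) _; set nu1 := inner (q m.+1) (q m.+1) - 1.
set f := inner _ (direction_error th m); set X := eps * _ => Sm.
have S1 : 1 <= S := dirsq_ge1 _ _ _ _.
have cS0 : 0 <= c ^+ 2 * S by rewrite mulr_ge0 ?sqr_ge0 // (le_trans ler01).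
have Sb1 : 1 <= Sb by lra.
have k1 : 1 <= k%:R :> R by rewrite ler1n (leq_ltn_trans _ mk).
have eb : `|inner (q m.+1) (recurrence_error m.+1)| <= 2 * eps.
  by apply: le_trans qe _; apply: ler_pM; rewrite ?norm2_ge0.
have ab : `|(al m.+1 - th) * nu1| <= D * eps by rewrite normrM ler_pM.
have Gb : `|2 * (b m ^+ 2 / p * nu1)| <= 2 * (G * eps).
  rewrite normrM ger0_norm // ler_pM2l // normrM ler_pM //.
  by rewrite ger0_norm // divr_ge0 ?sqr_ge0 // ltW.
have cF : `|c| * norm2 (direction_error th m) <= eps * (k%:R * Sb).
  have kS1 : 1 <= k%:R * Sb by rewrite mulr_ege1.
  have nn1 : 0 <= `|c| * norm2 (direction_error th m) by rewrite mulr_ge0 ?norm2_ge0.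
  have nn2 : 0 <= eps * (k%:R * Sb) by rewrite mulr_ge0 // (le_trans ler01).
  rewrite -(@ler_sqr R) ?nnegrE //.
  rewrite [X in X <= _]exprMn real_normK ?num_real //.
  apply: le_trans (ler_wpM2l (sqr_ge0 c) F2) _.
  rewrite [X in _ <= X]exprMn [X in X <= _](_ : _ = eps ^+ 2 * (m.+1%:R * (c ^+ 2 * S))).
    rewrite ler_wpM2l ?sqr_ge0 // (le_trans _ (ler_eXnr _ kS1)) // ler_pM //; last by lra.
    by rewrite ler_nat ltnW.
  by rewrite /S; ring.
have fb : `|2 * (c * f)| <= 4 * (eps * (k%:R * Sb)).
  rewrite normrM ger0_norm // normrM.
  have : `|c| * `|f| <= `|c| * (2 * norm2 (direction_error th m)).
    by rewrite ler_wpM2l // (le_trans fF) // ler_wpM2r ?norm2_ge0.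
  lra.
have cpsi : `|c ^+ 2 * (psi - p)| <= c ^+ 2 * S * X.
  rewrite normrM ger0_norm ?sqr_ge0 // -mulrA ler_wpM2l ?sqr_ge0 // mulrC.
  exact: IHm.
rewrite -/psi -/p; move: cpsi fb Gb ab eb hloc gloc.
rewrite (mulrDr X) (mulr1 X) [X * (c ^+ 2 * S)]mulrC {2}/X.
set t1 := c ^+ 2 * (psi - p); set t2 := 2 * (c * f); set t3 := 2 * _.
set t4 := _ * nu1; set t5 := inner _ _; set t6 := b m.+1 * _; set t7 := b m * _.
set T := c ^+ 2 * S * X; rewrite !ler_norml.
by have := eps0; lra.
Qed.

(** The smallest Ritz value of a perturbed Lanczos process cannot escape below
    the spectrum of [M]. Lowering the shift a little at each step keeps the
    previous pivots above [del], hence the conjugate gradient directions of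
    moderate size; the new pivot is then nonnegative up to [del], being almost
    the energy of a direction. *)
Lemma perturbed_pivot_pos lam B del :
  0 < del -> (forall x, lam * inner x x <= inner x (M *m x)) ->
  (forall j, (j < k)%N -> `|al j| <= B) -> (forall j, (j < k)%N -> `|b j| <= B) ->
  `|lam| <= B -> 2 * k%:R * del <= B ->
  eps * (3 * B + 4 + 2 * (B ^+ 2 / del) + 4 * k%:R * (1 + (B / del) ^+ 2))
    * (1 + (B / del) ^+ 2) < del ->
  forall j, (j <= k)%N ->
  forall i, (i < j)%N -> 0 < pivot al b (lam - 2 * j%:R * del) i.
Proof.
move=> del0 Mlam alB bB lamB kdel small; elim=> [//|j IH] jk.
have {IH}pos := IH (ltnW jk).
pose th := lam - 2 * j%:R * del - del.
have thE : th + del = lam - 2 * j%:R * del by rewrite /th; ring.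
have pos1 i : (i < j)%N -> 0 < pivot al b (th + del) i by rewrite thE; apply: pos.
have B0 : 0 <= B by apply: le_trans lamB.
have pos2 := pivot_pos_shift (ltW del0) pos1.
have S_le i : (i <= j)%N -> dirsq al b th i <= 1 + (B / del) ^+ 2.
  move=> ij; apply: dirsq_le => // l li; first exact: pos1 (leq_trans li ij).
  exact: bB (ltn_trans (leq_trans li ij) jk).
have jdel : 0 <= 2 * j%:R * del + del <= B.
  have j0 : 0 <= j%:R * del by rewrite mulr_ge0 ?ler0n ?ltW.
  have : j.+1%:R * del <= k%:R * del by rewrite ler_pM2r // ler_nat.
  by rewrite -[j.+1]addn1 natrD => h; apply/andP; split; lra.
have D_le i : (i <= j)%N -> `|al i - th| <= 3 * B.
  move=> ij; have := alB i (leq_ltn_trans ij jk); move: lamB jdel; rewrite /th !ler_norml.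
  by lra.
have G_le i : (i < j)%N -> b i ^+ 2 / pivot al b th i <= B ^+ 2 / del.
  move=> ij; have [p0 hp] := pos2 i ij; have S1 := dirsq_ge1 al b th i.
  have delp : del <= pivot al b th i by nra.
  apply: ler_pM; rewrite ?sqr_ge0 ?invr_ge0 ?(ltW p0) //.
    by rewrite -(real_normK (num_real (b i))) ler_sqr ?nnegrE ?bB // (ltn_trans ij).
  by rewrite lef_pV2 ?posrE.
have := direction_energy jk (divr_ge0 (sqr_ge0 B) (ltW del0))
  (fun i ij => (pos2 i ij).1) D_le G_le S_le.
have psi0 : 0 <= inner (direction th j) (shifted th (direction th j)).
  rewrite /shifted innerBr innerZr subr_ge0; apply: le_trans (Mlam _).
  by rewrite ler_wpM2r ?inner_ge0 // /th; lra.
have S0 : 0 <= dirsq al b th j by rewrite (le_trans ler01) ?dirsq_ge1.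
set X := eps * _ => energy.
have X0 : 0 <= X.
  rewrite mulr_ge0 ?eps0 // !addr_ge0 // ?mulr_ge0 ?invr_ge0 ?exprn_ge0 ?ler0n ?(ltW del0) //.
  by rewrite addr_ge0 // exprn_ge0 // divr_ge0 // ltW.
have pj : - del < pivot al b th j.
  have := ler_wpM2l X0 (S_le j (leqnn j)); move: energy; rewrite ler_norml.
  by move: small; rewrite -/X; lra.
have -> : lam - 2 * j.+1%:R * del = th - del by rewrite /th -[j.+1]addn1 natrD; ring.
have pos3 i : (i < j)%N -> 0 < pivot al b (th - del + del) i.
  by rewrite subrK => ij; have [] := pos2 i ij.
move=> i; rewrite ltnS leq_eqVlt => /orP [/eqP ->|ij].
  have := pivot_shift (ltW del0) pos3; rewrite subrK.
  have := dirsq_ge1 al b (th - del) j; have := pj; nra.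
by have [] := pivot_pos_shift (ltW del0) pos3 ij.
Qed.

End PerturbedLanczos.

(** * Tridiagonal systems and the residual of a Galerkin solution *)

Section Tridiagonal.
Context {R : realType}.
Variables a b : nat -> R.

(** Coordinates extended by zero, so that the recurrence needs no case
    distinction at the last row. *)
Definition coord k (x : 'cV[R]_k) (m : nat) : R :=
  if insub m is Some i then x i 0 else 0.

Lemma coordE k (x : 'cV[R]_k) (i : 'I_k) : coord x i = x i 0.
Proof. by rewrite /coord valK. Qed.

Lemma coord_out k (x : 'cV[R]_k) m : (k <= m)%N -> coord x m = 0.
Proof. by move=> km; rewrite /coord insubN // -leqNgt. Qed.

Definition tri_row (f : nat -> R) (i : nat) : R :=
  (if i is j.+1 then b j * f j else 0) + a i * f i + b i * f i.+1.

Lemma sum_ord_delta k m (F : nat -> R) :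
  \sum_(j < k) (if (j : nat) == m then F j else 0) = if (m < k)%N then F m else 0.
Proof.
rewrite -big_mkcond /=; case: ltnP => mk.
  by rewrite (big_pred1 (Ordinal mk)).
by rewrite big1 // => j /eqP jm; have := ltn_ord j; rewrite jm ltnNge mk.
Qed.

Lemma tridiag_mulE k (x : 'cV[R]_k) i : (tridiag k a b *m x) i 0 = tri_row (coord x) i.
Proof.
rewrite mxE.
have E j : tridiag k a b i j * x j 0 =
   (if j == i :> nat then a j * coord x j else 0)
   + (if j == i.+1 :> nat then b i * coord x j else 0)
   + (if j == i.-1 :> nat then (if (0 < i)%N then b j * coord x j else 0) else 0).
  rewrite mxE -coordE -val_eqE /=.
  case: (ltngtP i j) => [ij|ji|->].
  - rewrite [j == i.-1 :> nat]gtn_eqF ?(leq_ltn_trans (leq_pred i)) // addr0 add0r.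
    have [ji1|ji1] := eqVneq (j : nat) i.+1; rewrite ?mul0r //.
    by rewrite (_ : (i == j.+1 :> nat) = false) ?mul0r //; apply/ltn_eqF/leqW.
  - rewrite [j == i.+1 :> nat]ltn_eqF ?(ltn_trans ji) // !add0r.
    have i0 : (0 < i)%N := leq_ltn_trans (leq0n _) ji.
    by rewrite i0 -[in LHS](prednK i0) eqSS eq_sym; case: eqP => _; rewrite ?mul0r.
  - rewrite ltn_eqF // addr0; case: (j : nat) => [|l]; first by rewrite addr0.
    by rewrite gtn_eqF // addr0.
rewrite (eq_bigr _ (fun j _ => E j)) !big_split /=.
rewrite (sum_ord_delta _ _ (fun j => a j * coord x j)).
rewrite (sum_ord_delta _ _ (fun j => b i * coord x j)).
rewrite (sum_ord_delta _ _ (fun j => if (0 < i)%N then b j * coord x j else 0)).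
rewrite ltn_ord (leq_ltn_trans (leq_pred i)) // /tri_row.
case: ltnP => ik; last rewrite (coord_out x ik) mulr0.
  by case: (i : nat) => [|l] /=; rewrite ?addr0 ?add0r //; ring.
by case: (i : nat) => [|l] /=; rewrite ?addr0 ?add0r //; ring.
Qed.

Lemma inner_coord k (x y : 'cV[R]_k) : inner x y = \sum_(0 <= i < k) coord x i * coord y i.
Proof. by rewrite big_mkord; apply: eq_bigr => i _; rewrite !coordE. Qed.

Lemma tri_form (f : nat -> R) m :
  \sum_(0 <= i < m.+1) f i * tri_row f i =
  \sum_(0 <= i < m.+1) a i * f i ^+ 2
  + 2 * \sum_(0 <= i < m) b i * f i * f i.+1 + b m * f m * f m.+1.
Proof.
elim: m => [|m IH]; first by rewrite !big_nat1 big_geq // /tri_row; ring.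
rewrite (big_nat_recr m.+1) //= IH [in RHS](big_nat_recr m.+1) //=.
by rewrite [X in _ = _ + 2 * X + _](big_nat_recr m) //= /tri_row; ring.
Qed.

Lemma tridiag_form_ge k th (x : 'cV[R]_k) :
  (forall i, (i < k)%N -> 0 < pivot a b th i) ->
  th * inner x x <= inner x (tridiag k a b *m x).
Proof.
case: k x => [|k] x pos; first by rewrite /inner !big_ord0 mulr0.
have -> : inner x (tridiag k.+1 a b *m x) =
  \sum_(0 <= i < k.+1) coord x i * tri_row (coord x) i.
  by rewrite big_mkord; apply: eq_bigr => i _; rewrite tridiag_mulE coordE.
rewrite tri_form [coord x k.+1]coord_out // mulr0 addr0 inner_coord.
have := pivot_form (coord x) (fun i ik => pos i (ltnW ik)).
have := mulr_ge0 (ltW (pos _ (ltnSn k))) (sqr_ge0 (coord x k)).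
have -> : \sum_(0 <= i < k.+1) (a i - th) * coord x i ^+ 2 =
  \sum_(0 <= i < k.+1) a i * coord x i ^+ 2 - th * \sum_(0 <= i < k.+1) coord x i * coord x i.
  by rewrite mulr_sumr -sumrB; apply: eq_bigr => i _; ring.
lra.
Qed.

Lemma norm2_tridiag_le k tau (x : 'cV[R]_k) : 0 <= tau ->
  (forall i, (i < k)%N -> `|a i| <= tau) ->
  (forall i, (i.+1 < k)%N -> `|b i| <= tau) ->
  norm2 (tridiag k a b *m x) <= 3 * tau * norm2 x.
Proof.
move=> tau0 ha hb.
rewrite -(@ler_sqr R) ?nnegrE ?norm2_ge0 ?mulr_ge0 ?norm2_ge0 //.
rewrite exprMn !norm2_sqr.
pose f := coord x; pose p i := if i is j.+1 then f j else 0.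
have sq i : (i < k)%N -> tri_row f i ^+ 2 <= 3 * tau ^+ 2 * (p i ^+ 2 + f i ^+ 2 + f i.+1 ^+ 2).
  move=> ik; have le : `|tri_row f i| <= tau * (`|p i| + `|f i| + `|f i.+1|).
    rewrite /tri_row; apply: le_trans (ler_normD _ _) _.
    apply: le_trans (lerD (ler_normD _ _) (lexx _)) _; rewrite !mulrDr.
    rewrite !normrM; apply: lerD; first apply: lerD.
    - case: i ik => [|j] ik /=; first by rewrite normr0 mulr0.
      by rewrite normrM ler_wpM2r // hb.
    - by rewrite ler_wpM2r // ha.
    - case: (ltnP i.+1 k) => ik1; first by rewrite ler_wpM2r // hb.
      by rewrite /f coord_out // normr0 !mulr0.
  rewrite -(real_normK (num_real (tri_row f i))).
  apply: le_trans (_ : (tau * (`|p i| + `|f i| + `|f i.+1|)) ^+ 2 <= _).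
    by rewrite ler_sqr ?nnegrE ?mulr_ge0 ?addr_ge0.
  rewrite exprMn [3 * _]mulrC -(mulrA (tau ^+ 2)) ler_wpM2l ?sqr_ge0 //.
  rewrite -(real_normK (num_real (p i))) -(real_normK (num_real (f i))).
  rewrite -(real_normK (num_real (f i.+1))).
  move: `|p i| `|f i| `|f i.+1| => r s t.
  have := sqr_ge0 (r - s); have := sqr_ge0 (r - t); have := sqr_ge0 (s - t).
  by rewrite !expr2; lra.
have -> : inner (tridiag k a b *m x) (tridiag k a b *m x) =
    \sum_(0 <= i < k) tri_row f i ^+ 2.
  by rewrite big_mkord; apply: eq_bigr => i _; rewrite tridiag_mulE expr2.
apply: le_trans (_ : \sum_(0 <= i < k) 3 * tau ^+ 2 * (p i ^+ 2 + f i ^+ 2 + f i.+1 ^+ 2) <= _).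
  by rewrite !big_mkord; apply: ler_sum => i _; apply: sq.
have -> : inner x x = \sum_(0 <= i < k) f i ^+ 2.
  by rewrite inner_coord; apply: eq_bigr => i _; rewrite expr2.
rewrite -mulr_sumr !big_split /=.
have sp m : \sum_(0 <= i < m) p i ^+ 2 <= \sum_(0 <= i < m) f i ^+ 2.
  case: m => [|m]; first by rewrite !big_geq.
  rewrite big_nat_recl // [X in _ <= X]big_nat_recr //= expr0n /= add0r.
  by rewrite lerDl sqr_ge0.
have sn : \sum_(0 <= i < k) f i.+1 ^+ 2 <= \sum_(0 <= i < k) f i ^+ 2.
  have : \sum_(0 <= i < k.+1) f i ^+ 2 = \sum_(0 <= i < k) f i ^+ 2.
    by rewrite big_nat_recr //= /f coord_out // expr0n addr0.
  by move=> <-; rewrite big_nat_recl // lerDr sqr_ge0.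
move: (sp k) sn; set s1 := \sum_(0 <= i < k) p i ^+ 2; set s2 := \sum_(0 <= i < k) f i.+1 ^+ 2.
set s0 := \sum_(0 <= i < k) f i ^+ 2 => h1 h2.
have := ler_wpM2l (sqr_ge0 tau) (lerD h1 h2); rewrite exprMn; lra.
Qed.

(** The last entry of [T^-1 e_1] decays geometrically: Richardson iterates from
    zero converge at a rate depending only on the conditioning of [T], while
    each product with [T] propagates the support by one entry only. *)
Lemma tridiag_inverse_decay k lam Lam (w : 'cV[R]_k.+1) : 0 < lam -> 0 < Lam ->
  (forall x, lam * inner x x <= inner x (tridiag k.+1 a b *m x)) ->
  (forall x, norm2 (tridiag k.+1 a b *m x) <= Lam * norm2 x) ->
  tridiag k.+1 a b *m w = e1 R k.+1 ->
  `|w ord_max 0| <= Num.sqrt (1 - (lam / Lam) ^+ 2) ^+ k * norm2 w.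
Proof.
move=> lam0 Lam0 Tlam TLam Tw; set T := tridiag k.+1 a b in Tlam TLam Tw *.
set rho := Num.sqrt _; pose c := lam / Lam ^+ 2.
have contr x : norm2 (x - c *: (T *m x)) <= rho * norm2 x.
  have E : norm2 (x - c *: (T *m x)) ^+ 2 <= (1 - (lam / Lam) ^+ 2) * norm2 x ^+ 2.
    rewrite norm2_sqr !(innerBl, innerBr, innerZl, innerZr) (innerC (T *m x) x) -!norm2_sqr.
    have := Tlam x; rewrite -norm2_sqr => h1.
    have h2 : norm2 (T *m x) ^+ 2 <= Lam ^+ 2 * norm2 x ^+ 2.
      by rewrite -exprMn ler_sqr ?nnegrE ?norm2_ge0 ?mulr_ge0 ?norm2_ge0 ?(ltW Lam0).
    have c0 : 0 <= c by rewrite divr_ge0 ?sqr_ge0 ?ltW.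
    have h3 := ler_wpM2l c0 h1; have h4 := ler_wpM2l (sqr_ge0 c) h2.
    have -> : (lam / Lam) ^+ 2 = c * lam by rewrite /c; field; rewrite gt_eqF.
    have E : c ^+ 2 * (Lam ^+ 2 * norm2 x ^+ 2) = c * lam * norm2 x ^+ 2.
      by rewrite /c; field; rewrite gt_eqF.
    by rewrite E in h4; lra.
  have [n0|n0] := eqVneq (norm2 x) 0.
    by rewrite (norm2_eq0 n0) mulmx0 scaler0 subr0 norm2_0 mulr0.
  have rho2 : 0 <= 1 - (lam / Lam) ^+ 2.
    rewrite -(@pmulr_lge0 _ (norm2 x ^+ 2)) ?exprn_gt0 ?lt_def ?n0 ?norm2_ge0 //.
    exact: le_trans (sqr_ge0 _) E.
  rewrite -(@ler_sqr R) ?nnegrE ?norm2_ge0 ?mulr_ge0 ?norm2_ge0 ?sqrtr_ge0 //.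
  by rewrite exprMn (sqr_sqrtr rho2).
pose fix it i : 'cV[R]_k.+1 :=
  if i is j.+1 then it j + c *: (e1 R k.+1 - T *m it j) else 0.
have conv i : norm2 (w - it i) <= rho ^+ i * norm2 w.
  elim: i => [|i IH]; first by rewrite subr0 mul1r.
  have -> : w - it i.+1 = (w - it i) - c *: (T *m (w - it i)).
    by rewrite mulmxBr Tw /= opprD addrA.
  apply: le_trans (contr _) _; rewrite exprS -mulrA ler_wpM2l ?sqrtr_ge0 //.
have supp i m : (i <= m)%N -> coord (it i) m = 0.
  elim: i m => [|i IH] [|m] im //; rewrite /coord; case: insubP => // j _ jm.
    by rewrite mxE.
    by rewrite mxE.
  have -> : it i.+1 j 0 = coord (it i) m.+1 + c * ((e1 R k.+1) j 0 - (T *m it i) j 0).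
    have lin (x y z : 'cV[R]_k.+1) : (x + c *: (y - z)) j 0 = x j 0 + c * (y j 0 - z j 0).
      by rewrite !mxE.
    by rewrite -jm coordE; apply: lin.
  have -> : (e1 R k.+1) j 0 = 0 by rewrite mxE jm.
  rewrite /T tridiag_mulE jm /tri_row.
  rewrite (IH m im) (IH m.+1 (leqW im)) (IH m.+2 (leqW (leqW im))).
  by rewrite !mulr0 !addr0 subrr mulr0 addr0.
have := conv k; apply: le_trans.
have -> : w ord_max 0 = (w - it k) ord_max 0.
  by rewrite mxE [X in _ = _ + X]mxE -(coordE (it k)) supp // oppr0 addr0.
exact: coord_le.
Qed.

End Tridiagonal.

Section Residual.
Context {R : realType}.
Variables (n : nat) (M : 'M[R]_n) (q : nat -> 'cV[R]_n) (al b : nat -> R).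

(** Multiplying the recurrence by the coefficients of [w] telescopes: apart from
    [T w] only the vector beyond the basis survives, with the last entry of [w]. *)
Lemma lanczos_residual k (w : 'cV[R]_k.+1) :
  M *m (\sum_(i < k.+1) w i 0 *: q i) =
  \sum_(i < k.+1) (tridiag k.+1 al b *m w) i 0 *: q i
  + (b k * w ord_max 0) *: q k.+1
  + \sum_(i < k.+1) w i 0 *: recurrence_error M q al b i.
Proof.
pose f := coord w.
have step m : \sum_(0 <= i < m.+1) f i *: (M *m q i) =
  \sum_(0 <= i < m.+1) tri_row al b f i *: q i + (b m * f m) *: q m.+1
  - (b m * f m.+1) *: q m + \sum_(0 <= i < m.+1) f i *: recurrence_error M q al b i.
  elim: m => [|m IH].
    rewrite !big_nat1 /recurrence_error /prev /tri_row.
    by apply/matrixP => i j; rewrite !mxE; ring.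
  rewrite (big_nat_recr m.+1) //= IH [X in _ = X + _ - _ + _](big_nat_recr m.+1) //=.
  rewrite [X in _ = _ + X](big_nat_recr m.+1) //=.
  move: (\sum_(0 <= i < m.+1) _) (\sum_(0 <= i < m.+1) _) => s1 s2.
  rewrite /recurrence_error /prev /tri_row.
  by apply/matrixP => i j; rewrite !mxE; ring.
have := step k; rewrite !big_mkord /f [coord w k.+1]coord_out // mulr0 scale0r subr0.
rewrite [coord w k](coordE w ord_max) => h; rewrite mulmx_sumr.
rewrite (eq_bigr (fun i : 'I_k.+1 => coord w i *: (M *m q i))) => [|i _]; last first.
  by rewrite coordE scalemxAr.
rewrite h; congr (_ + _ + _); apply: eq_bigr => i _; first by rewrite tridiag_mulE.
by rewrite coordE.
Qed.

End Residual.

(** * Floating point primitives *)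

Section Rounding.
Context {R : realType} {u : R} (F : fparith u).
Hypothesis u0 : 0 <= u.
Hypothesis u1 : u <= 1.

Lemma representableP m n (B : 'M[R]_(m, n)) :
  representable F B <-> forall i j, fl F (B i j) = B i j.
Proof.
split=> [<- i j|h]; first by rewrite !mxE fl_fl.
by apply/matrixP => i j; rewrite mxE h.
Qed.

Lemma fl0 : fl F 0 = 0.
Proof.
by have := fl_err F 0; rewrite normr0 mulr0 subr0 normr_le0 => /eqP.
Qed.

Lemma representable0 m n : representable F (0 : 'M[R]_(m, n)).
Proof. by apply/representableP => i j; rewrite mxE fl0. Qed.

Lemma representable_fl m n (B : 'M[R]_(m, n)) : representable F (map_mx (fl F) B).
Proof. by apply/representableP => i j; rewrite mxE fl_fl. Qed.

Lemma vec_err n (f : 'I_n -> fpcomp R) (x : 'cV[R]_n) a : 0 <= a ->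
  (forall i, `|(f i).1 - x i 0| <= a * `|x i 0|) ->
  norm2 ((vec f).1 - x) <= a * norm2 x.
Proof. by move=> a0 h; apply: norm2_le_coord => // i; rewrite !mxE. Qed.

Lemma fl_vec_err n (x : 'cV[R]_n) : norm2 (map_mx (fl F) x - x) <= u * norm2 x.
Proof. by apply: norm2_le_coord => // i; rewrite !mxE fl_err. Qed.

Lemma vadd_err n (x y : 'cV[R]_n) : representable F x -> representable F y ->
  representable F (vadd F x y).1 /\ norm2 ((vadd F x y).1 - (x + y)) <= u * norm2 (x + y).
Proof.
move=> /representableP rx /representableP ry; split.
  by apply/representableP => i j; rewrite mxE fl_fladd.
by apply: vec_err => // i; rewrite mxE fladd_err.
Qed.

Lemma vsub_err n (x y : 'cV[R]_n) : representable F x -> representable F y ->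
  representable F (vsub F x y).1 /\ norm2 ((vsub F x y).1 - (x - y)) <= u * norm2 (x - y).
Proof.
move=> /representableP rx /representableP ry; split.
  by apply/representableP => i j; rewrite mxE fl_flsub.
by apply: vec_err => // i; rewrite mxE [(- y) _ _]mxE flsub_err.
Qed.

Lemma vscale_err n a (x : 'cV[R]_n) : fl F a = a -> representable F x ->
  representable F (vscale F a x).1 /\
  norm2 ((vscale F a x).1 - a *: x) <= u * (`|a| * norm2 x).
Proof.
move=> ra /representableP rx; split.
  by apply/representableP => i j; rewrite mxE fl_flmul.
by rewrite -norm2Z; apply: vec_err => // i; rewrite mxE flmul_err.
Qed.

Lemma vdiv_err n a (x : 'cV[R]_n) : fl F a = a -> a != 0 -> representable F x ->
  representable F (vdiv F x a).1 /\
  norm2 ((vdiv F x a).1 - a^-1 *: x) <= u * (norm2 x / `|a|).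
Proof.
move=> ra a0 /representableP rx; split.
  by apply/representableP => i j; rewrite mxE fl_fldiv.
rewrite mulrC (mulrC (norm2 x)) -normfV -norm2Z mulrC.
by apply: vec_err => // i; rewrite mxE mulrC fldiv_err.
Qed.

(** Accumulated relative error of [k] roundings. *)
Definition gam (k : nat) : R := (1 + u) ^+ k - 1.

Lemma gam_ge0 k : 0 <= gam k.
Proof. by rewrite subr_ge0 exprn_ege1 // lerDl. Qed.

Lemma gamS k : gam k.+1 = gam k * (1 + u) + u.
Proof. by rewrite /gam exprS; ring. Qed.

Lemma gam_le_mono k l : (k <= l)%N -> gam k <= gam l.
Proof. by move=> kl; rewrite lerD2r ler_weXn2l // lerDl. Qed.

Lemma gam_le k : 2 * k%:R * u <= 1 -> gam k <= 2 * k%:R * u.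
Proof.
elim: k => [|k IH] h; first by rewrite /gam expr0; lra.
have k0 : 0 <= k%:R * u by rewrite mulr_ge0.
move: h; rewrite gamS -[k.+1]addn1 natrD => h.
have {}IH : gam k <= 2 * k%:R * u by apply: IH; have := u0; lra.
have := ler_wpM2r (_ : 0 <= 1 + u) IH; rewrite addr_ge0 // => /(_ isT).
have : 2 * (k%:R * u) * u <= 1 * u by rewrite ler_wpM2r //; have := u0; lra.
lra.
Qed.

Definition rep_pairs (s : seq (R * R)) :=
  forall p, p \in s -> fl F p.1 = p.1 /\ fl F p.2 = p.2.

Lemma rep_pairs_cons p s : rep_pairs (p :: s) ->
  [/\ fl F p.1 = p.1, fl F p.2 = p.2 & rep_pairs s].
Proof.
move=> h; have [h1 h2] := h p (mem_head _ _).
by split=> // p' p's; apply: h; rewrite inE p's orbT.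
Qed.

Lemma dot_from_err s acc : fl F acc = acc -> rep_pairs s ->
  fl F (dot_from F acc s).1 = (dot_from F acc s).1 /\
  `|(dot_from F acc s).1 - (acc + \sum_(p <- s) p.1 * p.2)| <=
  gam (size s) * `|acc| + gam (size s).+1 * \sum_(p <- s) `|p.1 * p.2|.
Proof.
elim: s acc => [|[x y] s IH] acc racc /=.
  by rewrite !big_nil addr0 subrr normr0 mulr0 addr0 mulr_ge0 ?gam_ge0.
move=> /rep_pairs_cons /= [rx ry rs]; rewrite !big_cons /=.
set p := flmul F x y; set acc' := fladd F acc p.
have rp : fl F p = p by apply: fl_flmul.
have [|r' e'] := IH acc' _ rs; first exact: fl_fladd.
split=> //; have ep : `|p - x * y| <= u * `|x * y| := flmul_err rx ry.
have ea : `|acc' - (acc + p)| <= u * `|acc + p| := fladd_err racc rp.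
move: (dot_from _ _ _).1 e' => z e'.
set s1 := \sum_(j <- s) _ in e' *; set s2 := \sum_(j <- s) `|_| in e' *.
have s20 : 0 <= s2 by apply: sumr_ge0.
set G := gam (size s) in e' *; have G0 : 0 <= G := gam_ge0 _.
have hp : `|p| <= (1 + u) * `|x * y|.
  have := ler_normD (p - x * y) (x * y); rewrite subrK; lra.
have hap : `|acc + p| <= `|acc| + `|p| := ler_normD _ _.
have ha : `|acc'| <= (1 + u) * (`|acc| + `|p|).
  have := ler_normD (acc' - (acc + p)) (acc + p); rewrite subrK => h.
  have := ler_wpM2l u0 hap; lra.
have hd : `|acc' - (acc + x * y)| <= u * `|acc| + (u * (1 + u) + u) * `|x * y|.
  have -> : acc' - (acc + x * y) = (acc' - (acc + p)) + (p - x * y) by ring.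
  apply: le_trans (ler_normD _ _) _.
  have := ler_wpM2l u0 hap; have := ler_wpM2l u0 hp; lra.
have -> : z - (acc + (x * y + s1)) = (z - (acc' + s1)) + (acc' - (acc + x * y)) by ring.
apply: le_trans (ler_normD _ _) _.
have hG : G * `|acc'| <= G * ((1 + u) * (`|acc| + (1 + u) * `|x * y|)).
  rewrite ler_wpM2l // (le_trans ha) // ler_wpM2l ?addr_ge0 // lerD2l //.
have Gs2 : gam (size s).+1 * s2 <= gam (size s).+2 * s2.
  by rewrite ler_wpM2r // gam_le_mono.
move: Gs2 e'; rewrite mulrDr [gam (size s).+2]gamS [gam (size s).+1]gamS -/G; lra.
Qed.

Lemma dot_seq_err s : rep_pairs s ->
  fl F (dot_seq F s).1 = (dot_seq F s).1 /\
  `|(dot_seq F s).1 - \sum_(p <- s) p.1 * p.2| <=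
  gam (size s) * \sum_(p <- s) `|p.1 * p.2|.
Proof.
case: s => [|[x y] s] /=; first by rewrite fl0 !big_nil subrr normr0 mulr0.
move=> /rep_pairs_cons /= [rx ry rs]; rewrite !big_cons /=.
set p := flmul F x y; have rp : fl F p = p by apply: fl_flmul.
have ep : `|p - x * y| <= u * `|x * y| := flmul_err rx ry.
have [r' e'] := dot_from_err rp rs; split=> //.
move: (dot_from _ _ _).1 e' => z e'.
set s1 := \sum_(j <- s) _ in e' *; set s2 := \sum_(j <- s) `|_| in e' *.
have hp : `|p| <= (1 + u) * `|x * y|.
  have := ler_normD (p - x * y) (x * y); rewrite subrK; lra.
have -> : z - (x * y + s1) = (z - (p + s1)) + (p - x * y) by ring.
apply: le_trans (ler_normD _ _) _.
have := ler_wpM2l (gam_ge0 (size s)) hp; move: e'; rewrite mulrDr gamS; lra.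
Qed.

Lemma norm2_abs k (x : 'cV[R]_k) : norm2 (map_mx Num.norm x) = norm2 x.
Proof.
rewrite /norm2; congr Num.sqrt; apply: eq_bigr => i _.
by rewrite mxE real_normK ?num_real.
Qed.

Lemma sum_abs_le k (x y : 'cV[R]_k) : \sum_i `|x i 0 * y i 0| <= norm2 x * norm2 y.
Proof.
rewrite -[norm2 x]norm2_abs -[norm2 y]norm2_abs; apply: le_trans (inner_le _ _).
by apply: ler_sum => i _; rewrite !mxE normrM.
Qed.

Lemma rep_pairs_coords k (x y : 'cV[R]_k) : representable F x -> representable F y ->
  rep_pairs [seq (x i 0, y i 0) | i <- enum 'I_k].
Proof.
by move=> /representableP rx /representableP ry p /mapP [i _ ->]; rewrite /= rx ry.
Qed.

Lemma dot_err_abs k (x y : 'cV[R]_k) : representable F x -> representable F y ->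
  fl F (dot F x y).1 = (dot F x y).1 /\
  `|(dot F x y).1 - inner x y| <= gam k * \sum_i `|x i 0 * y i 0|.
Proof.
move=> rx ry; have [r e] := dot_seq_err (rep_pairs_coords rx ry); split=> //.
by move: e; rewrite !big_map size_map size_enum_ord /inner [index_enum _]unlock.
Qed.

Lemma dot_err k (x y : 'cV[R]_k) : representable F x -> representable F y ->
  fl F (dot F x y).1 = (dot F x y).1 /\
  `|(dot F x y).1 - inner x y| <= gam k * (norm2 x * norm2 y).
Proof.
move=> rx ry; have [r e] := dot_err_abs rx ry; split=> //.
by apply: le_trans e _; rewrite ler_wpM2l ?gam_ge0 ?sum_abs_le.
Qed.

Lemma rel_err_ge0 (x y : R) : `|x - y| <= u * `|y| -> 0 <= y -> 0 <= x.
Proof.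
by move=> h y0; move: h; rewrite (ger0_norm y0) ler_norml; have := u1; nra.
Qed.

Lemma dot_from_ge0 s acc : fl F acc = acc -> rep_pairs s -> 0 <= acc ->
  (forall p, p \in s -> p.1 = p.2) -> 0 <= (dot_from F acc s).1.
Proof.
elim: s acc => [|[x y] s IH] acc racc //= /rep_pairs_cons /= [rx ry rs] acc0 sq.
have rp : fl F (flmul F x y) = flmul F x y by apply: fl_flmul.
have p0 : 0 <= flmul F x y.
  apply: rel_err_ge0 (flmul_err rx ry) _.
  by have /= -> := sq _ (mem_head _ _); rewrite -expr2 sqr_ge0.
apply: IH => //; first exact: fl_fladd.
  by apply: rel_err_ge0 (fladd_err racc rp) _; rewrite addr_ge0.
by move=> p ps; apply: sq; rewrite inE ps orbT.
Qed.

Lemma dot_self_ge0 k (x : 'cV[R]_k) : representable F x -> 0 <= (dot F x x).1.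
Proof.
move=> rx; have := rep_pairs_coords rx rx; rewrite /dot.
have : forall p, p \in [seq (x i 0, x i 0) | i <- enum 'I_k] -> p.1 = p.2.
  by move=> p /mapP [i _ ->].
case: [seq _ | _ <- _] => [|[a c] s] //= sq /rep_pairs_cons /= [ra rc rs].
apply: dot_from_ge0 => //; first exact: fl_flmul.
  apply: rel_err_ge0 (flmul_err ra rc) _.
  by have /= -> := sq _ (mem_head _ _); rewrite -expr2 sqr_ge0.
by move=> p ps; apply: sq; rewrite inE ps orbT.
Qed.

(** Passing from squares to roots divides the error by at least the norm itself,
    so the relative accuracy of the inner product survives. *)
Lemma norm_err k (x : 'cV[R]_k) : representable F x ->
  fl F (norm F x).1 = (norm F x).1 /\
  `|(norm F x).1 - norm2 x| <= gam k.+1 * norm2 x.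
Proof.
move=> rx; have [rd ed] := dot_err rx rx; have d0 := dot_self_ge0 rx.
have -> : (norm F x).1 = flsqrt F (dot F x x).1 by [].
split; first exact: fl_flsqrt.
move: ed (flsqrt_err rd d0) (sqr_sqrtr d0) (sqrtr_ge0 (dot F x x).1); rewrite -norm2_sqr.
move: (flsqrt F _) (Num.sqrt _) => s r ed es r2 r0; rewrite -r2 in ed.
have X0 := norm2_ge0 x; move: (norm2 x) X0 ed => X X0 ed.
have g0 := gam_ge0 k.
have rX : `|r - X| <= gam k * X.
  have [x0|x0] := eqVneq X 0.
    move: ed; rewrite x0 expr0n !mulr0 !subr0 normr_le0 sqrf_eq0 => /eqP ->.
    by rewrite normr0.
  have {}X0 : 0 < X by rewrite lt_def x0.
  move: ed; have -> : r ^+ 2 - X ^+ 2 = (r - X) * (r + X) by ring.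
  rewrite normrM [`|r + X|]ger0_norm ?addr_ge0 ?(ltW X0) // => ed.
  rewrite -(ler_pM2r X0) -mulrA; apply: le_trans ed.
  by rewrite ler_wpM2l // lerDr.
move: es; rewrite (ger0_norm r0) => es.
have -> : s - X = (s - r) + (r - X) by ring.
apply: le_trans (ler_normD _ _) _; rewrite gamS.
have rle : r <= (1 + gam k) * X by move: rX; rewrite ler_norml; lra.
have := ler_wpM2l u0 rle; lra.
Qed.

(** The columns are weighted separately, so the bound does not involve the
    number of rows. *)
Lemma matvec_err m k (B : 'M[R]_(m, k)) (w : 'cV[R]_k) :
  representable F B -> representable F w ->
  representable F (matvec F B w).1 /\
  norm2 ((matvec F B w).1 - B *m w) <= gam k * \sum_j `|w j 0| * norm2 (col j B).
Proof.
move=> /representableP rB rw.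
have rr i : representable F (row i B)^T.
  by apply/representableP => a c; rewrite !mxE.
split; first by apply/representableP => i j; rewrite mxE; have [] := dot_err_abs (rr i) rw.
pose y : 'cV[R]_m := \sum_j `|w j 0| *: map_mx Num.norm (col j B).
have -> : \sum_j `|w j 0| * norm2 (col j B) =
          \sum_j norm2 (`|w j 0| *: map_mx Num.norm (col j B)).
  by apply: eq_bigr => j _; rewrite norm2Z normr_id norm2_abs.
apply: le_trans (_ : gam k * norm2 y <= _); last by rewrite ler_wpM2l ?gam_ge0 ?norm2_sum.
apply: norm2_le_coord => [|i]; first exact: gam_ge0.
have [_ e] := dot_err_abs (rr i) rw.
have yE : y i 0 = \sum_j `|(row i B)^T j 0 * w j 0|.
  by rewrite summxE; apply: eq_bigr => j _; rewrite !mxE normrM mulrC.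
rewrite yE [X in _ <= _ * X]ger0_norm ?sumr_ge0 //.
have -> : ((matvec F B w).1 - B *m w) i 0 = (dot F (row i B)^T w).1 - inner (row i B)^T w.
  rewrite mxE [X in X + _]mxE; congr (_ + _); rewrite [LHS]mxE [X in - X]mxE.
  by congr (- _); apply: eq_bigr => j _; rewrite !mxE.
exact: e.
Qed.

End Rounding.

(** * Operation counts *)

Definition cost_le (s : seq op) (m f : nat) : Prop :=
  (forall o, o != Flop -> (count_mem o s <= m)%N) /\ (count_mem Flop s <= f)%N.

Lemma cost_le_cat s1 s2 m1 m2 f1 f2 :
  cost_le s1 m1 f1 -> cost_le s2 m2 f2 -> cost_le (s1 ++ s2) (m1 + m2) (f1 + f2).
Proof.
move=> [h1 g1] [h2 g2]; split=> [o oF|]; rewrite count_cat leq_add //.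
  exact: h1.
exact: h2.
Qed.

Lemma cost_le_weaken s m f m' f' : (m <= m')%N -> (f <= f')%N ->
  cost_le s m f -> cost_le s m' f'.
Proof.
move=> mm ff [h g]; split=> [o oF|]; last exact: leq_trans g ff.
exact: leq_trans (h o oF) mm.
Qed.

Lemma cost_le_nil : cost_le [::] 0 0.
Proof. by split. Qed.

Lemma cost_le_flops s f : all (pred1 Flop) s -> (size s <= f)%N -> cost_le s 0 f.
Proof.
move=> /allP sF sf; split=> [o oF|]; last by apply: leq_trans (count_size _ _) sf.
rewrite leqn0 -leqn0 leqNgt -has_count; apply/hasPn => o' /sF /= /eqP ->.
by rewrite eq_sym.
Qed.

Lemma cost_le_vec (R : realType) k (f : 'I_k -> fpcomp R) c :
  (forall i, cost_le (f i).2 0 c) -> cost_le (vec f).2 0 (k * c).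
Proof.
move=> h; rewrite /=.
have: cost_le (\big[cat/[::]]_(i < k) (f i).2) (\sum_(i < k) 0) (\sum_(i < k) c).
  by elim/big_ind3: _ => [|s1 m1 f1 s2 m2 f2|i _]; [| apply: cost_le_cat | apply: h].
by rewrite !sum_nat_const !card_ord muln0.
Qed.

Section Costs.
Context {R : realType} {u : R} (F : fparith u).

Lemma cost_flop (x : R) : cost_le (tick Flop x).2 0 1.
Proof. exact: cost_le_flops. Qed.

Lemma cost_dot_from acc s : cost_le (dot_from F acc s).2 0 (2 * size s).
Proof.
elim: s acc => [|[x y] s IH] acc; first exact: cost_le_nil.
rewrite mulnS; exact: cost_le_cat (cost_flop 0) (cost_le_cat (cost_flop 0) (IH _)).
Qed.

Lemma cost_dot k (x y : 'cV[R]_k) : cost_le (dot F x y).2 0 (2 * k).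
Proof.
rewrite /dot -[X in (2 * X)%N](size_enum_ord k) -(size_map (fun i => (x i 0, y i 0))).
case: [seq _ | _ <- _] => [|p s]; first exact: cost_le_nil.
by rewrite mulnS; apply: cost_le_weaken (cost_le_cat (cost_flop 0) (cost_dot_from _ _)).
Qed.

Lemma cost_norm k (x : 'cV[R]_k) : cost_le (norm F x).2 0 (2 * k + 1).
Proof. exact: cost_le_cat (cost_dot _ _) (cost_flop 0). Qed.

Lemma cost_matvec m k (B : 'M[R]_(m, k)) w : cost_le (matvec F B w).2 0 (m * (2 * k)).
Proof. by apply: cost_le_vec => i; apply: cost_dot. Qed.

Lemma cost_vec1 k (f : 'I_k -> R) : cost_le (vec (fun i => tick Flop (f i))).2 0 k.
Proof.
by rewrite -[X in cost_le _ _ X]muln1; apply: cost_le_vec => i; apply: cost_flop.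
Qed.

End Costs.

(** * The Lanczos recurrence in floating point *)

Section LanczosStep.
Context {R : realType} {u : R} (F : fparith u).
Variables (n : nat) (M : 'M[R]_n) (apply : 'cV[R]_n -> fpcomp 'cV[R]_n) (Lam e : R).
Hypothesis u0 : 0 <= u.
Hypothesis gam_e : gam (u := u) n.+1 <= e.
Hypothesis e_small : e <= 1 / 100.
Hypothesis Lam1 : 1 <= Lam.
Hypothesis M_le : forall x, norm2 (M *m x) <= Lam * norm2 x.
Hypothesis apply_rep : forall z, representable F z -> representable F (apply z).1.
Hypothesis apply_err : forall z, representable F z ->
  norm2 ((apply z).1 - M *m z) <= e * norm2 z.

(* Real arithmetic from chosen hypotheses and those of the section: in a long
   proof the whole context is too large for the decision procedure. *)
Local Tactic Notation "linear" "from" hyp_list(hs) :=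
  clear - hs u0 gam_e e_small Lam1 M_le apply_rep apply_err; lra.

Lemma u_le_e : u <= e.
Proof.
apply: le_trans gam_e; rewrite gamS; have := gam_ge0 u0 n.
by move: (gam _) => g g0; have := mulr_ge0 g0 u0; lra.
Qed.

Lemma u_le1 : u <= 1.
Proof. by have := u_le_e; have := e_small; lra. Qed.

Lemma gam_n_le_e : gam (u := u) n <= e.
Proof. exact: le_trans (gam_le_mono u0 (leqnSn n)) gam_e. Qed.

Lemma e_ge0 : 0 <= e.
Proof. exact: le_trans u0 u_le_e. Qed.

(** Normalization in floating point; only the relative size of the rounding
    errors matters, since the computed norm vanishes for the zero vector only. *)
Lemma normalize_err (z : 'cV[R]_n) : representable F z -> (norm F z).1 != 0 ->
  let b := (norm F z).1 in let q := (vdiv F z b).1 in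
  [/\ representable F q, 0 < b, b <= (1 + e) * norm2 z,
      norm2 (b *: q - z) <= e * norm2 z & `|inner q q - 1| <= 8 * e].
Proof.
move=> rz b0; cbv zeta; have [rb eb] := norm_err u0 u_le1 rz.
have [rq eq] := vdiv_err u0 rb b0 rz.
move: (norm F z).1 (vdiv F z _).1 b0 rb eb rq eq => b q b0 rb eb rq eq.
have e0 := e_ge0; have es := e_small.
have z0 : 0 < norm2 z.
  rewrite lt_def norm2_ge0 andbT; apply: contra b0 => /eqP z0.
  by move: eb; rewrite z0 mulr0 subr0 normr_le0.
have eb' : `|b - norm2 z| <= e * norm2 z.
  by apply: le_trans eb _; rewrite ler_wpM2r // ltW.
have bpos : 0 < b.
  by move: eb'; rewrite ler_norml; move: (norm2 z) z0 => X X0; nra.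
have ebq : norm2 (b *: q - z) <= e * norm2 z.
  have -> : b *: q - z = b *: (q - b^-1 *: z) by rewrite scalerBr scalerA divff // scale1r.
  rewrite norm2Z gtr0_norm //; move: eq; rewrite gtr0_norm // => eq.
  have := ler_wpM2l (ltW bpos) eq.
  have -> : b * (u * (norm2 z / b)) = u * norm2 z by field.
  by move=> /le_trans; apply; rewrite ler_wpM2r ?u_le_e // ltW.
have bz : b <= (1 + e) * norm2 z by move: eb'; rewrite ler_norml; lra.
split=> //; rewrite -norm2_sqr.
have N1 : b * norm2 q <= (1 + e) * norm2 z.
  have := norm2_near (b *: q) z; rewrite norm2Z gtr0_norm //; lra.
have N2 : (1 - e) * norm2 z <= b * norm2 q.
  have := norm2_near z (b *: q); rewrite norm2Z gtr0_norm // norm2_subC; lra.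
have bz' : (1 - e) * norm2 z <= b by move: eb'; rewrite ler_norml; lra.
have := norm2_ge0 q; move: (norm2 q) N1 N2 => N N1 N2 N0.
have N3 : (1 - e) * N <= 1 + e.
  rewrite -(ler_pM2r z0); apply: le_trans N1.
  by have := ler_wpM2r N0 bz'; lra.
have N4 : 1 - e <= (1 + e) * N.
  rewrite -(ler_pM2r z0); apply: le_trans N2 _.
  by have := ler_wpM2r N0 bz; lra.
have N5 : N <= 1 + 3 * e by nra.
have N6 : 1 - 2 * e <= N by nra.
by rewrite ler_norml; apply/andP; split; nra.
Qed.

Definition step_z (q0 : 'cV[R]_n) (b : R) (q : 'cV[R]_n) : 'cV[R]_n :=
  (vsub F (apply q).1 (vscale F b q0).1).1.
Definition step_alpha q0 b q : R := (dot F (step_z q0 b q) q).1.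
Definition step_next q0 b q : 'cV[R]_n :=
  (vsub F (step_z q0 b q) (vscale F (step_alpha q0 b q) q).1).1.

Lemma lanczos_loopS m q0 b q :
  (lanczos_loop F apply m.+1 q0 b q).1 =
  let z := step_next q0 b q in let b' := (norm F z).1 in
  if b' == 0 then [:: (q, step_alpha q0 b q, b')]
  else (q, step_alpha q0 b q, b') :: (lanczos_loop F apply m q b' (vdiv F z b').1).1.
Proof. by rewrite /step_next /step_alpha /step_z /=; case: ifP. Qed.

(** Removing from [x] its component along the nearly unit vector [q] does not
    lengthen [x], which keeps the growth of the coefficients linear. *)
Lemma norm2_orthogonalize (x q : 'cV[R]_n) : inner q q <= 2 ->
  norm2 (x - inner x q *: q) <= norm2 x.
Proof.
move=> q2; rewrite -(@ler_sqr R) ?nnegrE ?norm2_ge0 // !norm2_sqr.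
rewrite !(innerBl, innerBr, innerZl, innerZr) (innerC q x).
move: (inner x q) (inner q q) q2 => a c c2; have := sqr_ge0 a; nra.
Qed.

Lemma lanczos_step_err q0 b q : representable F q0 -> representable F q -> fl F b = b ->
  0 <= b -> inner q0 q0 <= 1 + 8 * e -> `|inner q q - 1| <= 8 * e ->
  let al := step_alpha q0 b q in let z := step_next q0 b q in let S := Lam + b in
  [/\ representable F z, fl F al = al, `|al| <= 3 * S &
   [/\ norm2 (M *m q - b *: q0 - al *: q - z) <= 20 * e * S,
       `|inner q z| <= 60 * e * S & norm2 z <= (1 + 27 * e) * S]].
Proof.
move=> rq0 rq rb b0 q0n qn; cbv zeta; rewrite /step_next.
have e0 := e_ge0; have es := e_small; have ue := u_le_e; have L1 := Lam1.
have nrm (x : 'cV[R]_n) : inner x x <= 1 + 8 * e -> norm2 x <= 1 + 4 * e.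
  move=> h; rewrite -(@ler_sqr R) ?nnegrE ?norm2_ge0 ?addr_ge0 ?mulr_ge0 //.
  by rewrite norm2_sqr; nra.
have {}q0n := nrm _ q0n; have qq : norm2 q <= 1 + 4 * e.
  by apply: nrm; move: qn; rewrite ler_norml; lra.
have q0p := norm2_ge0 q0; have qp := norm2_ge0 q.
set S := Lam + b; have S0 : 0 <= S by rewrite /S; lra.
have SL : Lam <= S by rewrite /S; lra.
have eS0 : 0 <= e * S by rewrite mulr_ge0.
have eeS : e * (e * S) <= e * S / 100 by have := ler_wpM2r eS0 es; lra.
have eS : e * S <= S / 100 by have := ler_wpM2r S0 es; lra.
have z1e : norm2 ((apply q).1 - M *m q) <= 2 * e.
  by apply: le_trans (apply_err rq) _; nra.
have z1n : norm2 (apply q).1 <= (1 + 6 * e) * Lam.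
  apply: le_trans (norm2_near _ (M *m q)) _.
  have := M_le q; have : Lam * norm2 q <= Lam * (1 + 4 * e).
    by rewrite ler_wpM2l // (le_trans ler01).
  have : 2 * e <= 2 * e * Lam by rewrite ler_peMr // mulr_ge0.
  linear from z1e.
have [rw1 w1e] := vscale_err u0 rb rq0.
rewrite (ger0_norm b0) in w1e.
have bq0 : b * norm2 q0 <= b * (1 + 4 * e) by rewrite ler_wpM2l.
have bq00 : 0 <= b * norm2 q0 by rewrite mulr_ge0.
have eb0 : 0 <= e * b by rewrite mulr_ge0.
have eeb : e * (e * b) <= e * b / 100 by have := ler_wpM2r eb0 es; lra.
have {}w1e : norm2 ((vscale F b q0).1 - b *: q0) <= 2 * e * b.
  apply: le_trans w1e _; have := ler_pM u0 bq00 ue bq0; linear from eb0 eeb.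
have w1n : norm2 (vscale F b q0).1 <= (1 + 6 * e) * b.
  apply: le_trans (norm2_near _ (b *: q0)) _; rewrite norm2Z (ger0_norm b0); linear from w1e bq0.
have [rz2 z2e] := vsub_err u0 (apply_rep rq) rw1.
rewrite -/(step_z q0 b q) in rz2 z2e.
have d12 : norm2 ((apply q).1 - (vscale F b q0).1) <= (1 + 6 * e) * S.
  by apply: le_trans (norm2B _ _) _; rewrite /S; linear from z1n w1n.
have {}z2e : norm2 (step_z q0 b q - ((apply q).1 - (vscale F b q0).1)) <= 11 / 10 * e * S.
  apply: le_trans z2e _.
  have := ler_pM u0 (norm2_ge0 _) ue d12; linear from eS0 eeS.
have z2n : norm2 (step_z q0 b q) <= (1 + 8 * e) * S.
  apply: le_trans (norm2_near _ ((apply q).1 - (vscale F b q0).1)) _; linear from z2e d12 eS0.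
have z2M : norm2 (M *m q - b *: q0 - step_z q0 b q) <= 4 * e * S.
  rewrite norm2_subC.
  have -> : step_z q0 b q - (M *m q - b *: q0) =
    (step_z q0 b q - ((apply q).1 - (vscale F b q0).1)) +
    (((apply q).1 - M *m q) - ((vscale F b q0).1 - b *: q0)).
    move: (step_z _ _ _) (apply q).1 (vscale _ _ _).1 (M *m q) (b *: q0) => v1 v2 v3 v4 v5.
    by apply/matrixP => i j; rewrite !mxE; ring.
  apply: le_trans (norm2D _ _) _; have := norm2B ((apply q).1 - M *m q) ((vscale F b q0).1 - b *: q0).
  have : e <= e * Lam by rewrite ler_peMr.
  move: z2e; rewrite /S; linear from z1e w1e eb0 e0.
have [ra ae] := dot_err u0 rz2 rq; rewrite -/(step_alpha q0 b q) in ra ae.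
move: (step_z q0 b q) (step_alpha q0 b q) rz2 z2n z2M ra ae => z2 al rz2 z2n z2M ra ae.
have z2p := norm2_ge0 z2.
have z2q : norm2 z2 * norm2 q <= 6 / 5 * S.
  by have := ler_pM z2p qp z2n qq; linear from eS0 eeS eS S0.
have {}ae : `|al - inner z2 q| <= 6 / 5 * e * S.
  apply: le_trans ae _.
  have := ler_pM (gam_ge0 u0 n) (mulr_ge0 z2p qp) gam_n_le_e z2q; linear from eS0.
have iz2q : `|inner z2 q| <= 6 / 5 * S := le_trans (cauchy_schwarz _ _) z2q.
have al_le : `|al| <= 5 / 4 * S.
  have := ler_normD (al - inner z2 q) (inner z2 q); rewrite subrK; linear from ae iz2q eS S0.
have [rw2 w2e] := vscale_err u0 ra rq.
have alq : `|al| * norm2 q <= 7 / 5 * S.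
  have := ler_pM (normr_ge0 al) qp al_le qq; linear from S0 eS.
have {}w2e : norm2 ((vscale F al q).1 - al *: q) <= 7 / 5 * e * S.
  apply: le_trans w2e _.
  have := ler_pM u0 (mulr_ge0 (normr_ge0 al) qp) ue alq; linear from eS0.
have w2n : norm2 (vscale F al q).1 <= 3 / 2 * S.
  apply: le_trans (norm2_near _ (al *: q)) _; rewrite norm2Z; linear from w2e alq eS S0.
have [rz3 z3e] := vsub_err u0 rz2 rw2.
move: (vscale F al q).1 (vsub F z2 _).1 rz3 z3e w2e w2n {rw2} => w2 z3 rz3 z3e w2e w2n.
have {}z3e : norm2 (z3 - (z2 - w2)) <= 3 * e * S.
  apply: le_trans z3e _.
  have h : norm2 (z2 - w2) <= 3 * S by apply: le_trans (norm2B _ _) _; linear from z2n w2n eS S0.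
  have := ler_pM u0 (norm2_ge0 _) ue h; linear from eS0.
have z3al : norm2 (z3 - (z2 - al *: q)) <= 5 * e * S.
  have -> : z3 - (z2 - al *: q) = (z3 - (z2 - w2)) - (w2 - al *: q).
    move: (al *: q) => v; by apply/matrixP => i j; rewrite !mxE; ring.
  apply: le_trans (norm2B _ _) _; linear from z3e w2e eS0.
have z3p : norm2 (z3 - (z2 - inner z2 q *: q)) <= 7 * e * S.
  have -> : z3 - (z2 - inner z2 q *: q) = (z3 - (z2 - al *: q)) - (al - inner z2 q) *: q.
    by apply/matrixP => i j; rewrite !mxE; ring.
  apply: le_trans (norm2B _ _) _; rewrite norm2Z.
  have := ler_pM (normr_ge0 _) qp ae qq; linear from z3al eS0 eeS.
split=> //; first by linear from al_le S0.
split.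
- have -> : M *m q - b *: q0 - al *: q - z3 =
    (M *m q - b *: q0 - z2) - (z3 - (z2 - al *: q)).
    move: (M *m q) (b *: q0) (al *: q) => v1 v2 v3.
    by apply/matrixP => i j; rewrite !mxE; ring.
  apply: le_trans (norm2B _ _) _; linear from z2M z3al eS0.
- have -> : inner q z3 = inner (z3 - (z2 - inner z2 q *: q)) q
      - inner z2 q * (inner q q - 1).
    by rewrite !(innerBl, innerZl) (innerC q z3); ring.
  apply: le_trans (ler_normB _ _) _; rewrite normrM.
  have := ler_pM (normr_ge0 _) (normr_ge0 _) iz2q qn.
  have := cauchy_schwarz (z3 - (z2 - inner z2 q *: q)) q.
  have := ler_pM (norm2_ge0 _) qp z3p qq; linear from eS0 eeS.
- apply: le_trans (norm2_near _ (z2 - inner z2 q *: q)) _.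
  have : norm2 (z2 - inner z2 q *: q) <= norm2 z2.
    by apply: norm2_orthogonalize; move: qn; rewrite ler_norml; linear from es e0.
  linear from z2n z3p eS0.
Qed.

End LanczosStep.

Section LanczosLoop.
Context {R : realType} {u : R} (F : fparith u).
Variables (n : nat) (M : 'M[R]_n) (apply : 'cV[R]_n -> fpcomp 'cV[R]_n) (Lam e : R).
Variable K : nat.
Hypothesis u0 : 0 <= u.
Hypothesis gam_e : gam (u := u) n.+1 <= e.
Hypothesis e_small : e <= 1 / 100.
Hypothesis K_small : 100 * K%:R * e <= 1.
Hypothesis Lam1 : 1 <= Lam.
Hypothesis M_le : forall x, norm2 (M *m x) <= Lam * norm2 x.
Hypothesis apply_rep : forall z, representable F z -> representable F (apply z).1.
Hypothesis apply_err : forall z, representable F z ->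
  norm2 ((apply z).1 - M *m z) <= e * norm2 z.

Local Tactic Notation "linear" "from" hyp_list(hs) :=
  clear - hs u0 gam_e e_small K_small Lam1 M_le apply_rep apply_err; lra.

(** Coefficients are at most [3 (Lam + b)], and the off-diagonal entry [b] grows
    to at most [2 Lam K]. *)
Definition lanczos_bound : R := 3 * Lam * (1 + 2 * K%:R).
Definition lanczos_eps : R := 64 * e * (Lam * (1 + 2 * K%:R)).

(** What one pass through the loop guarantees on its triple [t], relative to
    the vector [p] standing for the previous term and to the next vector [q']. *)
Definition step_ok (p : 'cV[R]_n) (t : 'cV[R]_n * R * R) (q' : 'cV[R]_n) : Prop :=
  [/\ representable F t.1.1, fl F t.1.2 = t.1.2, fl F t.2 = t.2 &
  [/\ `|inner t.1.1 t.1.1 - 1| <= lanczos_eps, `|t.1.2| <= lanczos_bound,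
      `|t.2| <= lanczos_bound, `|t.2 * inner t.1.1 q'| <= lanczos_eps &
      norm2 (M *m t.1.1 - p - t.1.2 *: t.1.1 - t.2 *: q') <= lanczos_eps]].

Definition entry (s : seq ('cV[R]_n * R * R)) i := nth (0, 0, 0) s i.

(** The index [j] counts the steps already made: the off-diagonal coefficient
    grows by at most [2 Lam] per step. On breakdown the last coefficient
    is zero, so the vector following the last one is arbitrary. *)
Lemma lanczos_loop_ok m j q0 b q : (j + m <= K)%N -> (0 < m)%N ->
  representable F q0 -> representable F q -> fl F b = b ->
  0 <= b -> b <= 2 * Lam * j%:R -> inner q0 q0 <= 1 + 8 * e ->
  `|inner q q - 1| <= 8 * e ->
  let s := (lanczos_loop F apply m q0 b q).1 in
  exists2 Q : nat -> 'cV[R]_n, Q 0%N = q &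
  [/\ (0 < size s <= m)%N,
      (size s = m /\ norm2 (Q (size s)) <= 2) \/ (entry s (size s).-1).2 = 0,
      forall i, (i < size s)%N -> (entry s i).1.1 = Q i &
      forall i, (i < size s)%N ->
        step_ok (if i is l.+1 then (entry s l).2 *: Q l else b *: q0) (entry s i) (Q i.+1)].
Proof.
have ue := u_le_e u0 gam_e; have e0 := e_ge0 u0 gam_e; have es := e_small; have L1 := Lam1.
have eK := K_small.
elim: m j q0 b q => [//|m IH] j q0 b q jm _ rq0 rq rb b0 bj q0n qn; cbv zeta.
rewrite lanczos_loopS; cbv zeta.
have [] := lanczos_step_err u0 gam_e e_small Lam1 M_le apply_rep apply_err rq0 rq rb b0 q0n qn.
set al := step_alpha F apply q0 b q; set z := step_next F apply q0 b q.
move=> rz ral al_le [zM zq z_le].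
have Lam_ge0 : 0 <= Lam := le_trans ler01 L1.
have K1 : 1 <= K%:R :> R by rewrite ler1n (leq_trans _ jm) // addnS.
have jK : j%:R + 1 <= K%:R :> R by rewrite natr1 ler_nat (leq_trans _ jm) // addnS ltnS leq_addr.
have LjK : Lam * j%:R <= Lam * K%:R by rewrite ler_wpM2l // (le_trans _ jK) // lerDl.
have S_le : Lam + b <= Lam * (1 + 2 * K%:R) by linear from bj LjK.
have S0 : 0 <= Lam + b by rewrite addr_ge0.
have eS : e * (Lam + b) <= e * (Lam * (1 + 2 * K%:R)) by rewrite ler_wpM2l.
have eS0 : 0 <= e * (Lam + b) by rewrite mulr_ge0.
have eL : e <= e * (Lam * (1 + 2 * K%:R)).
  by rewrite ler_peMr // mulr_ege1 // lerDl mulr_ge0.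
have z_le2 : norm2 z <= 2 * (Lam + b).
  by apply: le_trans z_le _; have := ler_wpM2r S0 es; linear from S0.
case: eqP => [nz0|/eqP nz0].
  rewrite nz0.
  exists (fun i : nat => if i is 0%N then q else (0 : 'cV[R]_n)); first by [].
  split=> //; first by right.
    by case.
  case=> //= _; rewrite /step_ok /= scale0r subr0 mul0r normr0.
  have z0 : z = 0.
    have [_] := norm_err u0 (u_le1 u0 gam_e e_small) rz; rewrite nz0 sub0r normrN.
    rewrite (ger0_norm (norm2_ge0 z)) => h.
    have g1 : gam (u := u) n.+1 <= 1 / 2 by have := gam_e; linear from es.
    have z1 := norm2_ge0 z; have z2 := ler_wpM2r z1 g1.
    by apply: norm2_eq0; apply/eqP; rewrite eq_le z1 andbT; linear from h z2.
  split=> //; first by rewrite fl0.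
  rewrite /lanczos_eps /lanczos_bound; split.
  - linear from qn eL e0.
  - linear from al_le S_le.
  - by rewrite !mulr_ge0 // addr_ge0 // mulr_ge0.
  - linear from eS0 eS.
  - by move: zM; rewrite z0 subr0; linear from eS0 eS.
have [rq' nb0 b'_le bq' q'n] := normalize_err u0 gam_e e_small rz nz0.
set b' := (norm F z).1 in nz0 rq' nb0 b'_le bq' q'n *.
set q' := (vdiv F z b').1 in rq' bq' q'n *.
have rb' : fl F b' = b' by have [] := norm_err u0 (u_le1 u0 gam_e e_small) rz.
have e_norm_z : e * norm2 z <= 2 * (e * (Lam + b)).
  by have := ler_wpM2l e0 z_le2; linear from e0.
have b'S : b' <= b + 2 * Lam.
  apply: le_trans b'_le _.
  have : e * (2 * Lam * j%:R) <= Lam / 50.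
    have : Lam * (100 * K%:R * e) <= Lam * 1 by rewrite ler_wpM2l.
    have := ler_wpM2l e0 LjK.
    linear from e0.
  have := ler_wpM2l e0 bj; have : e * Lam <= Lam / 100.
    by have := ler_wpM2r Lam_ge0 es; linear from e0.
  linear from z_le e_norm_z Lam_ge0.
have ok0 : step_ok (b *: q0) (q, al, b') q'.
  split=> //=; rewrite /lanczos_eps /lanczos_bound; split.
  - linear from qn eL e0.
  - linear from al_le S_le.
  - by rewrite gtr0_norm //; have := mulr_ge0 Lam_ge0 (ler0n R K); linear from b'S bj LjK Lam_ge0.
  - have -> : b' * inner q q' = inner q z + inner q (b' *: q' - z).
      by rewrite innerBr innerZr; ring.
    apply: le_trans (ler_normD _ _) _.
    have qq : norm2 q <= 2.
      rewrite -(@ler_sqr R) ?nnegrE ?norm2_ge0 // norm2_sqr.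
      by move: qn; rewrite ler_norml; linear from es.
    have := cauchy_schwarz q (b' *: q' - z).
    have := ler_pM (norm2_ge0 q) (norm2_ge0 _) qq bq'; linear from zq e_norm_z eS eS0.
  - have -> : M *m q - b *: q0 - al *: q - b' *: q' =
        (M *m q - b *: q0 - al *: q - z) - (b' *: q' - z).
      by move: (M *m q - _ - _) (b' *: q') => v w; rewrite opprB addrA subrK.
    apply: le_trans (norm2B _ _) _; linear from zM bq' e_norm_z eS eS0.
case: m IH jm => [|m] IH jm.
  exists (fun i : nat => if i is 0%N then q else q') => //; split=> //=.
  - left; split=> //; rewrite -(@ler_sqr R) ?nnegrE ?norm2_ge0 // norm2_sqr.
    by move: q'n; rewrite ler_norml; linear from es.
  - by case.
  - by case.
have [] := IH j.+1 q b' q' _ isT rq rq' rb' (ltW nb0) _ _ q'n.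
- by rewrite addSnnS.
- by rewrite -natr1; linear from b'S bj.
- by move: qn; rewrite ler_norml; linear from es.
set s := (lanczos_loop F apply m.+1 q b' q').1 => Q Q0 [/andP [s0 sm] hend hQ hstep].
exists (fun i : nat => if i is l.+1 then Q l else q) => //; split=> /=.
- by rewrite ltnS.
- case: hend => [[-> Qs]|hend]; [by left | right].
  by move: hend; rewrite /entry -(prednK s0) /=.
- by case=> //= i; rewrite ltnS; apply: hQ.
- case=> [_|i]; first by rewrite /= Q0.
  rewrite ltnS => /hstep; case: i => [|i] //=.
Qed.

End LanczosLoop.

Lemma cost_lanczos_loop (R : realType) (u : R) (F : fparith u) n
    (apply : 'cV[R]_n -> fpcomp 'cV[R]_n) m q0 b q :
  (0 < n)%N -> (forall z, cost_le (apply z).2 1 0) ->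
  cost_le (lanczos_loop F apply m q0 b q).2 m (10 * n * m).
Proof.
move=> n0 hap; elim: m q0 b q => [|m IH] q0 b q; first exact: cost_le_nil.
pose z := step_z F apply q0 b q; pose al := step_alpha F apply q0 b q.
have step (tl : seq op) : cost_le tl m (10 * n * m + n) ->
  cost_le ((apply q).2 ++ (vscale F b q0).2 ++ (vsub F (apply q).1 (vscale F b q0).1).2 ++
    (dot F z q).2 ++ (vscale F al q).2 ++ (vsub F z (vscale F al q).1).2 ++
    (norm F (step_next F apply q0 b q)).2 ++ tl) m.+1 (10 * n * m.+1).
  move=> ctl.
  apply: cost_le_weaken (cost_le_cat (hap q) (cost_le_cat (cost_vec1 _) (cost_le_cat
    (cost_vec1 _) (cost_le_cat (cost_dot _ _ _) (cost_le_cat (cost_vec1 _) (cost_le_cat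
    (cost_vec1 _) (cost_le_cat (cost_norm _ _) ctl))))))) => //.
  lia.
have -> : (lanczos_loop F apply m.+1 q0 b q).2 = (apply q).2 ++ (vscale F b q0).2 ++
    (vsub F (apply q).1 (vscale F b q0).1).2 ++ (dot F z q).2 ++ (vscale F al q).2 ++
    (vsub F z (vscale F al q).1).2 ++ (norm F (step_next F apply q0 b q)).2 ++
    (if (norm F (step_next F apply q0 b q)).1 == 0 then [::] else
     let q' := vdiv F (step_next F apply q0 b q) (norm F (step_next F apply q0 b q)).1 in
     q'.2 ++ (lanczos_loop F apply m q (norm F (step_next F apply q0 b q)).1 q'.1).2 ++ [::]).
  by rewrite /z /al /step_next /step_alpha /step_z /=; case: ifP.
apply: step; case: ifP => _; first exact: cost_le_weaken cost_le_nil.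
apply: cost_le_weaken (cost_le_cat (cost_vec1 _) (cost_le_cat (IH _ _ _) cost_le_nil)) => //.
  by rewrite add0n addn0.
by rewrite addn0 addnC.
Qed.

(** * Accuracy of the inner solver *)

Section ProjectedSystem.
Context {R : realType}.
Variables (n : nat) (M : 'M[R]_n) (Lam lam B eps : R) (K : nat).
Hypothesis M_sym : M^T = M.
Hypothesis lam0 : 0 < lam.
Hypothesis lam_Lam : lam <= Lam.
Hypothesis Lam1 : 1 <= Lam.
Hypothesis Lam_B : Lam <= B.
Hypothesis M_le : forall x, norm2 (M *m x) <= Lam * norm2 x.
Hypothesis M_ge : forall x, lam * inner x x <= inner x (M *m x).
Hypothesis K0 : (0 < K)%N.
Hypothesis eps0 : 0 <= eps.
Hypothesis eps_small : eps <= 1 / 8.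

(** The shift is lowered by twice this amount at each of at most [K] steps, so
    that half of the lower bound [lam] of the spectrum remains. *)
Definition shift_gap : R := lam / (4 * K%:R).

Hypothesis pivots_small :
  eps * (3 * B + 4 + 2 * (B ^+ 2 / shift_gap) + 4 * K%:R * (1 + (B / shift_gap) ^+ 2))
    * (1 + (B / shift_gap) ^+ 2) < shift_gap.

Variables (q : nat -> 'cV[R]_n) (al b : nat -> R) (k : nat).
Hypothesis kK : (k <= K)%N.
Hypothesis rec_err : forall j, (j < k)%N -> norm2 (recurrence_error M q al b j) <= eps.
Hypothesis q_unit : forall j, (j < k)%N -> `|inner (q j) (q j) - 1| <= eps.
Hypothesis q_local : forall j, (j < k)%N -> `|b j * inner (q j) (q j.+1)| <= eps.
Hypothesis al_B : forall j, (j < k)%N -> `|al j| <= B.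
Hypothesis b_B : forall j, (j < k)%N -> `|b j| <= B.

Let T := tridiag k al b.

Lemma projected_pivot_pos j : (j < k)%N -> 0 < pivot al b (lam - 2 * k%:R * shift_gap) j.
Proof.
have KR : 1 <= K%:R :> R by rewrite ler1n.
have l0 := lam0; have lL := lam_Lam; have LB := Lam_B; have e0 := eps0.
have gap0 : 0 < shift_gap by rewrite divr_gt0 // mulr_gt0 // ltr0n.
have e1 : eps <= 1 by have := eps_small; lra.
have kKR : k%:R <= K%:R :> R by rewrite ler_nat.
have kgap : 2 * k%:R * shift_gap <= lam / 2.
  have -> : lam / 2 = 2 * K%:R * shift_gap by rewrite /shift_gap; field; lra.
  by rewrite ler_wpM2r ?ler_wpM2l // ltW.
apply: (perturbed_pivot_pos M_sym eps0 e1 rec_err q_unit q_local gap0 M_ge al_B b_B) => //.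
- by rewrite gtr0_norm //; lra.
- by lra.
apply: le_lt_trans pivots_small; rewrite ler_wpM2r ?addr_ge0 ?sqr_ge0 //.
rewrite ler_wpM2l // lerD2l ler_wpM2r ?addr_ge0 ?sqr_ge0 // ler_wpM2l //.
Qed.

Lemma projected_shift_ge : lam / 2 <= lam - 2 * k%:R * shift_gap.
Proof.
have KR : 1 <= K%:R :> R by rewrite ler1n.
have : 2 * k%:R * shift_gap <= 2 * K%:R * shift_gap.
  by rewrite ler_wpM2r ?ler_wpM2l ?ler_nat // divr_ge0 ?mulr_ge0 // ltW.
have -> : 2 * K%:R * shift_gap = lam / 2 by rewrite /shift_gap; field; lra.
lra.
Qed.

Lemma projected_form_ge x : lam / 2 * inner x x <= inner x (T *m x).
Proof.
apply: le_trans (tridiag_form_ge x projected_pivot_pos).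
by rewrite ler_wpM2r ?inner_ge0 ?projected_shift_ge.
Qed.

(** The a priori bound [B] grows with [K]. With positivity at hand the diagonal
    entries are Rayleigh quotients up to rounding, so the bound becomes
    independent of [K]; this makes the decay rate independent of the number of
    iterations. *)
Lemma projected_diag_le j : (j < k)%N -> `|al j| <= 2 * Lam.
Proof.
move=> jk; have l0 := lam0; have e0 := eps0; have es := eps_small; have L1 := Lam1.
have alpos : 0 <= al j.
  have := pivot_le_diag (fun i (ij : (i < j)%N) => projected_pivot_pos (ltn_trans ij jk)).
  have := projected_pivot_pos jk; have := projected_shift_ge; lra.
rewrite ger0_norm //.
have E : al j * inner (q j) (q j) = inner (q j) (M *m q j) - inner (q j) (prev q b j)
    - b j * inner (q j) (q j.+1) - inner (q j) (recurrence_error M q al b j).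
  by rewrite /recurrence_error !(innerBr, innerZr); ring.
have qn : norm2 (q j) <= 2.
  have e1 : eps <= 1 by lra.
  exact: (norm2_q e1 q_unit).
have h1 : inner (q j) (M *m q j) <= Lam * inner (q j) (q j).
  apply: le_trans (inner_le _ _) _; rewrite -norm2_sqr expr2 mulrCA.
  by rewrite ler_wpM2l ?norm2_ge0.
have h2 : `|inner (q j) (prev q b j)| <= eps.
  case: (j) jk => [|i] ik /=; first by rewrite innerC inner0l normr0.
  by rewrite innerZr innerC q_local // ltnW.
have h3 := q_local jk.
have h4 : `|inner (q j) (recurrence_error M q al b j)| <= 2 * eps.
  apply: le_trans (cauchy_schwarz _ _) _; apply: ler_pM; rewrite ?norm2_ge0 //.
  exact: rec_err.
have := q_unit jk; move: E h1 h2 h3 h4.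
move: (inner (q j) (q j)) (inner (q j) (M *m q j)) (inner (q j) (prev q b j)) => N a c.
move: (inner (q j) (recurrence_error _ _ _ _ _)) (b j * _) => f d.
rewrite !ler_norml => E h1 h2 h3 h4 hN.
have hN' : 7 / 8 <= N by lra.
have : (al j - Lam) * N <= 1 / 2 by lra.
case: (lerP (al j) Lam) => hal; first by lra.
have : (al j - Lam) * (7 / 8) <= (al j - Lam) * N by rewrite ler_wpM2l //; lra.
lra.
Qed.

Lemma projected_offdiag_le j : (j.+1 < k)%N -> `|b j| <= 2 * Lam.
Proof.
move=> jk; have l0 := lam0; have L1 := Lam1.
have th0 : 0 <= lam - 2 * k%:R * shift_gap by have := projected_shift_ge; lra.
have := offdiag_sqr_le th0 (fun i (ij : (i <= j.+1)%N) => projected_pivot_pos (leq_ltn_trans ij jk)).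
rewrite -(real_normK (num_real (b j))) => h.
rewrite -(@ler_sqr R) ?nnegrE //; last by lra.
apply: le_trans h _; apply: le_trans (ler_norm _) _; rewrite normrM expr2.
by apply: ler_pM; rewrite ?projected_diag_le // ltnW.
Qed.

Lemma projected_norm_le x : norm2 (T *m x) <= 6 * Lam * norm2 x.
Proof.
have L0 : 0 <= 2 * Lam by have := Lam1; lra.
have := norm2_tridiag_le x L0 projected_diag_le projected_offdiag_le.
by rewrite mulrA -natrM.
Qed.

Lemma projected_norm_ge x : lam / 2 * norm2 x <= norm2 (T *m x).
Proof.
have [->|x0] := eqVneq (norm2 x) 0; first by rewrite mulr0 norm2_ge0.
have {}x0 : 0 < norm2 x by rewrite lt_def x0 norm2_ge0.
rewrite -(ler_pM2r x0) -(mulrA _ (norm2 x)) -(expr2 (norm2 x)) norm2_sqr.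
by apply: le_trans (projected_form_ge x) _; rewrite mulrC inner_le.
Qed.

End ProjectedSystem.

Section ProjectedSolution.
Context {R : realType}.
Variables (n : nat) (M : 'M[R]_n) (Lam lam B eps mu : R).
Hypothesis lam0 : 0 < lam.
Hypothesis Lam0 : 0 < Lam.
Hypothesis mu0 : 0 <= mu.
Hypothesis mu_small : mu <= lam / 4.
Hypothesis B0 : 0 <= B.

(** Richardson's contraction factor for a matrix whose form is at least
    [lam / 2] and whose norm is at most [6 Lam]. *)
Definition decay_rate : R := Num.sqrt (1 - (lam / 2 / (6 * Lam)) ^+ 2).

Lemma decay_rate_ge0 : 0 <= decay_rate.
Proof. exact: sqrtr_ge0. Qed.

(** The truncation term [b_(k-1) w_(k-1) q_k] of the Galerkin residual is damped
    by the decay of [T^-1 e_1], and vanishes on breakdown, where [b] ends with a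
    zero. The rest is the backward error [mu] of the tridiagonal solver and the
    local errors of the recurrence. *)
Lemma projected_solution_residual (q : nat -> 'cV[R]_n) (al b : nat -> R) k K
    (w : 'cV[R]_k) (dT : 'M[R]_k) :
  (0 < k <= K)%N ->
  (forall j, (j < k)%N -> norm2 (recurrence_error M q al b j) <= eps) ->
  (forall j, (j < k)%N -> norm2 (q j) <= 2) ->
  (forall j, (j < k)%N -> `|b j| <= B) ->
  (forall x, lam / 2 * inner x x <= inner x (tridiag k al b *m x)) ->
  (forall x, norm2 (tridiag k al b *m x) <= 6 * Lam * norm2 x) ->
  (forall x, lam / 2 * norm2 x <= norm2 (tridiag k al b *m x)) ->
  (k = K /\ norm2 (q k) <= 2) \/ b k.-1 = 0 ->
  specnorm dT <= mu -> (tridiag k al b + dT) *m w = e1 R k ->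
  norm2 w <= 4 / lam /\
  norm2 (M *m (\sum_(i < k) w i 0 *: q i) - q 0%N) <=
    4 / lam * K%:R * (2 * mu + eps)
    + 4 * B / lam * (decay_rate ^+ K.-1 + 4 * mu / lam).
Proof.
case: k w dT => [//|k] w dT /andP [_ kK] hrec hq hb Tform Tle Tge hend hdT Tw.
set T := tridiag k.+1 al b in Tform Tle Tge Tw *.
have [l0 L0 m0 ms] := And4 lam0 Lam0 mu0 mu_small.
have e1n : norm2 (e1 R k.+1) <= 1.
  have -> : e1 R k.+1 = delta_mx ord0 0.
    by apply/matrixP => i j; rewrite !mxE ord1 eqxx andbT.
  rewrite -(@ler_sqr R) ?nnegrE ?norm2_ge0 // norm2_sqr expr1n /inner (bigD1 ord0) //=.
  rewrite big1 => [|i /negPf i0]; rewrite !mxE ?eqxx ?i0 ?mulr0 //.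
  by rewrite mulr1 addr0.
have dTw x : norm2 (dT *m x) <= mu * norm2 x.
  by apply: le_trans (norm2_mulmx _ _) _; rewrite ler_wpM2r ?norm2_ge0.
have TwE : T *m w = e1 R k.+1 - dT *m w by rewrite -Tw mulmxDl addrK.
have wn : norm2 w <= 4 / lam.
  have := Tge w; rewrite TwE => h.
  have := norm2B (e1 R k.+1) (dT *m w); have := dTw w.
  have : mu * norm2 w <= lam / 4 * norm2 w by rewrite ler_wpM2r ?norm2_ge0.
  rewrite ler_pdivlMr //; lra.
split=> //.
have dTwn : norm2 (dT *m w) <= mu * (4 / lam).
  by apply: le_trans (dTw w) _; rewrite ler_wpM2l.
have l20 : 0 < lam / 2 by lra.
have Tunit := unitmx_norm2_ge l20 Tge.
have Tinv x : norm2 (invmx T *m x) <= 2 / lam * norm2 x.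
  have := Tge (invmx T *m x); rewrite mulKVmx // => h.
  have -> : norm2 (invmx T *m x) = 2 / lam * (lam / 2 * norm2 (invmx T *m x)) by field; lra.
  by rewrite ler_wpM2l // divr_ge0 // ltW.
have wlast : `|w ord_max 0| <= 2 / lam * (decay_rate ^+ k + 4 * mu / lam).
  have -> : w = invmx T *m e1 R k.+1 - invmx T *m (dT *m w) by rewrite -mulmxBr -TwE mulKmx.
  have lin (x y : 'cV[R]_k.+1) : (x - y) ord_max 0 = x ord_max 0 - y ord_max 0.
    by rewrite !mxE.
  rewrite lin; apply: le_trans (ler_normB _ _) _; rewrite mulrDr; apply: lerD.
    have TT : T *m (invmx T *m e1 R k.+1) = e1 R k.+1 by rewrite mulKVmx.
    have L6 : 0 < 6 * Lam by rewrite mulr_gt0.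
    apply: le_trans (tridiag_inverse_decay l20 L6 Tform Tle TT) _.
    rewrite mulrC; rewrite ler_wpM2r ?exprn_ge0 ?decay_rate_ge0 //.
    apply: le_trans (Tinv _) _; by rewrite -[X in _ <= X]mulr1 ler_wpM2l ?divr_ge0 ?(ltW lam0).
  apply: le_trans (coord_le _ _) _; apply: le_trans (Tinv _) _.
  rewrite ler_wpM2l ?divr_ge0 ?(ltW lam0) //; apply: le_trans dTwn _.
  by rewrite le_eqVlt; apply/orP; left; apply/eqP; field; lra.
rewrite (lanczos_residual M q al b w) -/T TwE.
have -> : \sum_(i < k.+1) (e1 R k.+1 - dT *m w) i 0 *: q i =
  q 0%N - \sum_(i < k.+1) (dT *m w) i 0 *: q i.
  have -> : q 0%N = \sum_(i < k.+1) (e1 R k.+1) i 0 *: q i.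
    rewrite (bigD1 ord0) //= big1 => [|i i0]; rewrite mxE /= ?scale1r ?addr0 //.
    by rewrite (_ : (i == 0 :> nat) = false) ?scale0r //; apply/negbTE.
  have lin (x y : 'cV[R]_k.+1) i : (x - y) i 0 = x i 0 - y i 0 by rewrite !mxE.
  by rewrite -sumrB; apply: eq_bigr => i _; rewrite lin scalerBl.
set s1 := \sum_(i < k.+1) _; set s2 := \sum_(i < k.+1) _; set t := (_ * _) *: _.
have -> : q 0%N - s1 + t + s2 - q 0%N = (s2 - s1) + t.
  by move: (q 0%N) => v; apply/matrixP => i j; rewrite !mxE; ring.
have kKR : k.+1%:R <= K%:R :> R by rewrite ler_nat.
have s1n : norm2 s1 <= K%:R * 2 * (mu * (4 / lam)).
  apply: le_trans (_ : k.+1%:R * 2 * norm2 (dT *m w) <= _).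
    by apply: (@norm2_comb_le _ _ _ 2) => // i; apply: hq.
  by rewrite ler_pM ?norm2_ge0 ?mulr_ge0 // ler_pM.
have e0 : 0 <= eps by apply: le_trans (hrec 0%N _); rewrite ?norm2_ge0.
have s2n : norm2 s2 <= K%:R * eps * (4 / lam).
  apply: le_trans (_ : k.+1%:R * eps * norm2 w <= _).
    by apply: norm2_comb_le => // i; apply: hrec.
  by rewrite ler_pM ?norm2_ge0 ?mulr_ge0 // ler_pM.
have tn : norm2 t <= 4 * B / lam * (decay_rate ^+ K.-1 + 4 * mu / lam).
  have rhs0 : 0 <= decay_rate ^+ K.-1 + 4 * mu / lam.
    by rewrite addr_ge0 ?exprn_ge0 ?decay_rate_ge0 ?divr_ge0 ?mulr_ge0 // ltW.
  rewrite /t norm2Z; case: hend => [[kE qk]|/= ->]; last first.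
    by rewrite mul0r normr0 mul0r mulr_ge0 // divr_ge0 ?mulr_ge0 // ltW.
  rewrite -kE /= in rhs0 *; rewrite normrM.
  have := ler_pM (mulr_ge0 (normr_ge0 _) (normr_ge0 _)) (norm2_ge0 _)
    (ler_pM (normr_ge0 _) (normr_ge0 _) (hb k (ltnSn k)) wlast) qk.
  move/le_trans; apply; rewrite le_eqVlt; apply/orP; left; apply/eqP; field; lra.
apply: le_trans (norm2D _ _) _; apply: lerD tn.
apply: le_trans (norm2B _ _) _.
have -> : 4 / lam * K%:R * (2 * mu + eps) =
  K%:R * eps * (4 / lam) + K%:R * 2 * (mu * (4 / lam)) by ring.
exact: lerD.
Qed.

End ProjectedSolution.

Lemma lanczos_flops n K k c : (0 < n)%N -> (0 < K)%N -> (k <= K)%N ->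
  (2 * n + 1 + (n + (10 * n * K + (c * K + (n * (2 * k) + n)))) <= n * K * (17 + c))%N.
Proof.
move=> n0 K0 kK; have : (n * k <= n * K)%N by rewrite leq_mul2l kK orbT.
have : (c * K <= n * K * c)%N by rewrite (mulnC c) -mulnA leq_pmull.
have : (n <= n * K)%N by rewrite leq_pmulr.
rewrite mulnDr; move: (n * K * c)%N (c * K)%N => a b.
rewrite mulnCA -mulnA; move: (n * K)%N (n * k)%N => d f; lia.
Qed.

Section LanczosOutput.
Context {R : realType} {u : R} (F : fparith u).
Variables (n : nat) (M : 'M[R]_n) (apply : 'cV[R]_n -> fpcomp 'cV[R]_n).
Variables (slv : tridiag_solver R) (ptri : {poly {poly R}}) (cS : R) (cSn : nat).
Variables (Lam lam e pt : R) (K : nat).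
Hypothesis n0 : (0 < n)%N.
Hypothesis u0 : 0 <= u.
Hypothesis gam_n : gam (u := u) n.+1 <= e.
Hypothesis gam_K : gam (u := u) K <= e.
Hypothesis e_small : e <= 1 / 100.
Hypothesis K0 : (0 < K)%N.
Hypothesis K_small : 100 * K%:R * e <= 1.
Hypothesis M_sym : M^T = M.
Hypothesis Lam1 : 1 <= Lam.
Hypothesis lam0 : 0 < lam.
Hypothesis lam_Lam : lam <= Lam.
Hypothesis M_le : forall x, norm2 (M *m x) <= Lam * norm2 x.
Hypothesis M_ge : forall x, lam * inner x x <= inner x (M *m x).
Hypothesis apply_rep : forall z, representable F z -> representable F (apply z).1.
Hypothesis apply_err : forall z, representable F z ->
  norm2 ((apply z).1 - M *m z) <= e * norm2 z.
Hypothesis apply_cost : forall z, cost_le (apply z).2 1 0.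
Hypothesis slv_ok : backward_stable_tridiag F ptri cS slv.
Hypothesis cS_le : cS <= cSn%:R.
Hypothesis pt0 : 0 <= pt.
Hypothesis ptri_le : forall k, (k <= K)%N -> prefactor ptri k u <= pt.

Let B := lanczos_bound Lam K.
Let eps := lanczos_eps Lam e K.
(** The norm of the projected matrix is at most [6 Lam]. *)
Definition solver_err : R := 6 * Lam * pt * u.

Hypothesis eps_small : eps <= 1 / 8.
Hypothesis pivots_small :
  eps * (3 * B + 4 + 2 * (B ^+ 2 / shift_gap lam K)
         + 4 * K%:R * (1 + (B / shift_gap lam K) ^+ 2))
    * (1 + (B / shift_gap lam K) ^+ 2) < shift_gap lam K.
Hypothesis solver_cond : pt * (12 * Lam / lam) * u < 1.
Hypothesis solver_small : solver_err <= lam / 4.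

Definition galerkin_err : R :=
  4 / lam * K%:R * (2 * solver_err + eps)
  + 4 * B / lam * (decay_rate Lam lam ^+ K.-1 + 4 * solver_err / lam).

(** The first term stems from forming the combination of the basis vectors, the
    last one from normalizing the right-hand side. *)
Definition lanczos_err : R := 2 * (24 * Lam * K%:R * e / lam + galerkin_err) + e.

Local Tactic Notation "linear" "from" hyp_list(hs) :=
  clear - hs n0 u0 gam_n gam_K e_small K0 K_small M_sym Lam1 lam0 lam_Lam M_le M_ge apply_rep
    apply_err apply_cost slv_ok cS_le pt0 ptri_le eps_small pivots_small solver_cond solver_small;
  lra.

(** Apart from the Galerkin error, forming [Q w] and the scaling by the norm
    of [c] only add errors relative to the size of the result. *)
Lemma lanczos_output c : representable F c ->
  let run := lanczos F slv apply K c in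
  [/\ representable F run.1, norm2 (M *m run.1 - c) <= lanczos_err * norm2 c &
      cost_le run.2 K (n * K * (17 + cSn))].
Proof.
move=> rc; cbv zeta.
have ue := u_le_e u0 gam_n; have ul1 := u_le1 u0 gam_n e_small; have e0 := e_ge0 u0 gam_n.
have es := e_small; have L1 := Lam1; have l0 := lam0.
have KR : 1 <= K%:R :> R by rewrite ler1n.
have Lam0 : 0 < Lam by linear from L1.
have Lam_ge0 := ltW Lam0; have l20 : 0 < lam / 2 by rewrite divr_gt0.
have lam_neq0 : lam != 0 by rewrite gt_eqF.
have q00 : inner (0 : 'cV[R]_n) 0 <= 1 + 8 * e by rewrite inner0l; linear from e0.
have B0 : 0 <= B by rewrite /B /lanczos_bound mulr_ge0 //; lra.
have eps0 : 0 <= eps by rewrite /eps /lanczos_eps !mulr_ge0 //; lra.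
have eps1 : eps <= 1 by have := eps_small; lra.
have LB : Lam <= B.
  rewrite /B /lanczos_bound.
  have : Lam * 1 <= Lam * (3 * (1 + 2 * K%:R)) by rewrite ler_wpM2l; lra.
  lra.
have se0 : 0 <= solver_err by rewrite /solver_err !mulr_ge0 //; lra.
have G0 : 0 <= galerkin_err.
  have d0 := decay_rate_ge0 Lam lam.
  by rewrite /galerkin_err; nonneg.
have err0 : 0 <= lanczos_err.
  by rewrite /lanczos_err; nonneg.
rewrite /lanczos /bind; cbv beta; have [rg ge] := norm_err u0 ul1 rc.
have nk : (0 < n * K)%N by rewrite muln_gt0 n0.
case: eqP => [g0|/eqP gn0].
  have c0 : c = 0.
    apply: norm2_eq0; move: ge; rewrite g0 sub0r normrN (ger0_norm (norm2_ge0 c)) => h.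
    have g1 : gam (u := u) n.+1 <= 1 / 2 by have := gam_n; lra.
    have z1 := norm2_ge0 c; have z2 := ler_wpM2r z1 g1.
    by apply/eqP; rewrite eq_le z1 andbT; lra.
  split; [exact: representable0 | by rewrite mulmx0 c0 subrr norm2_0 mulr0 | ].
  apply: cost_le_weaken (leq0n _) _ (cost_le_cat (cost_norm F c) cost_le_nil).
  apply: leq_trans (lanczos_flops cSn n0 K0 (leqnn K)).
  by rewrite addn0 leq_addr.
have [rq1 gpos gle gq1 q1n] := normalize_err u0 gam_n e_small rc gn0.
set g := (norm F c).1 in rg gn0 rq1 gpos gle gq1 q1n *.
set q1 := (vdiv F c g).1 in rq1 gq1 q1n *.
have b00 : (0 : R) <= 2 * Lam * 0%:R by rewrite mulr0.
have Kle : (0 + K <= K)%N by [].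
have := lanczos_loop_ok u0 gam_n e_small K_small Lam1 M_le apply_rep apply_err
  Kle K0 (representable0 F _ _) rq1 (fl0 F) (lexx 0) b00 q00 q1n; cbv zeta.
have := cost_lanczos_loop F K 0 0 q1 n0 apply_cost.
set loop := lanczos_loop F apply K 0 0 q1; set s := loop.1 => cloop.
move=> [Q Q0 [/andP [s0 sK] hend hQ hstep]].
pose al i := (entry s i).1.2; pose b i := (entry s i).2.
have hrec j : (j < size s)%N -> norm2 (recurrence_error M Q al b j) <= eps.
  move=> js; have [_ _ _ [_ _ _ _]] := hstep j js; rewrite hQ //.
  by case: (j) => [|i] //=; rewrite scale0r.
have hunit j : (j < size s)%N -> `|inner (Q j) (Q j) - 1| <= eps.
  by move=> js; have [_ _ _ []] := hstep j js; rewrite hQ.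
have hloc j : (j < size s)%N -> `|b j * inner (Q j) (Q j.+1)| <= eps.
  by move=> js; have [_ _ _ []] := hstep j js; rewrite hQ.
have hal j : (j < size s)%N -> `|al j| <= B.
  by move=> js; have [_ _ _ []] := hstep j js.
have hb j : (j < size s)%N -> `|b j| <= B.
  by move=> js; have [_ _ _ []] := hstep j js.
have Q2 j : (j < size s)%N -> norm2 (Q j) <= 2 by apply: (norm2_q eps1 hunit).
have Tform := projected_form_ge M_sym lam0 lam_Lam LB M_ge K0 eps0 eps_small pivots_small
  sK hrec hunit hloc hal hb.
have Tle := projected_norm_le M_sym lam0 lam_Lam Lam1 LB M_le M_ge K0 eps0 eps_small
  pivots_small sK hrec hunit hloc hal hb.
have Tge := projected_norm_ge M_sym lam0 lam_Lam LB M_ge K0 eps0 eps_small pivots_small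
  sK hrec hunit hloc hal hb.
rewrite -/(lanczos_tridiag s) in Tform Tle Tge.
have Tunit := unitmx_norm2_ge l20 Tge.
have rT : representable F (lanczos_tridiag s).
  apply/representableP => i j; rewrite mxE.
  case: ifP => _; first by have [] := hstep i (ltn_ord i).
  case: ifP => _; first by have [] := hstep i (ltn_ord i).
  case: ifP => _; first by have [] := hstep j (ltn_ord j).
  exact: fl0.
have condT : prefactor ptri (size s) u * cond (lanczos_tridiag s) * u < 1.
  apply: le_lt_trans solver_cond; rewrite ler_wpM2r //.
  apply: le_trans (_ : pt * cond (lanczos_tridiag s) <= _).
    by rewrite ler_wpM2r ?cond_ge0 ?ptri_le.
  rewrite ler_wpM2l //.
  have -> : 12 * Lam / lam = 6 * Lam / (lam / 2) by field.
  by apply: cond_le => //; rewrite mulr_ge0.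
have [slv_rep slv_bs slv_flops slv_size] :=
  @slv_ok (size s) (fun i => (entry s i).1.2) (fun i => (entry s i).2) s0 rT.
rewrite -/(lanczos_tridiag s) in slv_rep slv_bs slv_flops slv_size.
have rw := slv_rep Tunit condT; have [dT dTle dTw] := slv_bs Tunit condT.
have dTmu : specnorm dT <= solver_err.
  apply: le_trans dTle _; rewrite /solver_err.
  have : specnorm (lanczos_tridiag s) <= 6 * Lam by apply: specnorm_le => //; rewrite mulr_ge0.
  have : prefactor ptri (size s) u * u <= pt * u by rewrite ler_wpM2r ?ptri_le.
  have ptu : 0 <= pt * u by rewrite mulr_ge0.
  move=> h1 h2; apply: le_trans (ler_wpM2r (specnorm_ge0 _) h1) _.
  by have := ler_wpM2l ptu h2; linear from l0.
have sKs : (0 < size s <= K)%N by rewrite s0 sK.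
have hend' : (size s = K /\ norm2 (Q (size s)) <= 2) \/ b (size s).-1 = 0 := hend.
have [wn res] := projected_solution_residual lam0 Lam0 se0 solver_small B0
   sKs hrec Q2 hb Tform Tle Tge hend' dTmu dTw.
set w := (slv (lanczos_tridiag s)).1 in rw dTw wn res *.
have basisE : lanczos_basis s *m w = \sum_(i < size s) w i 0 *: Q i.
  apply/matrixP => i j; rewrite ord1 mxE summxE; apply: eq_bigr => l _.
  by rewrite !mxE -(hQ l (ltn_ord l)) mulrC.
have rbasis : representable F (lanczos_basis s).
  apply/representableP => i j; rewrite mxE.
  by have [/representableP r _ _ _] := hstep j (ltn_ord j); apply: r.
have [ry' ye'] := matvec_err u0 rbasis rw.
set y' := (matvec F (lanczos_basis s) w).1 in ry' ye' *.
have [ry ye] := vscale_err u0 rg ry'.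
have sKR : (size s)%:R <= K%:R :> R by rewrite ler_nat.
have wsum : \sum_j `|w j 0| * norm2 (col j (lanczos_basis s)) <= 8 * K%:R / lam.
  apply: le_trans (_ : \sum_(j < size s) 4 / lam * 2 <= _).
    apply: ler_sum => j _; apply: ler_pM; rewrite ?norm2_ge0 //.
      exact: le_trans (coord_le _ _) wn.
    have -> : col j (lanczos_basis s) = Q j; last exact: Q2.
    by apply/matrixP => i l; rewrite !mxE ord1 -(hQ j (ltn_ord j)).
  rewrite sumr_const card_ord -[_ *+ _]mulr_natr.
  have -> : 8 * K%:R / lam = 4 / lam * 2 * K%:R by field.
  by rewrite ler_wpM2l // mulr_ge0 ?divr_ge0 // ltW.
have y'e : norm2 (y' - lanczos_basis s *m w) <= e * (8 * K%:R / lam).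
  apply: le_trans ye' _; apply: ler_pM => //; first exact: gam_ge0.
    by apply: sumr_ge0 => j _; rewrite mulr_ge0 ?norm2_ge0.
  exact: le_trans (gam_le_mono u0 sK) gam_K.
have Kl0 : 0 <= K%:R / lam by rewrite divr_ge0 // ltW.
have Qwn : norm2 (lanczos_basis s *m w) <= 8 * K%:R / lam.
  rewrite basisE; apply: le_trans (norm2_sum _) _; apply: le_trans wsum.
  apply: ler_sum => j _; rewrite norm2Z ler_wpM2l //.
  have -> // : col j (lanczos_basis s) = Q j.
  by apply/matrixP => i l; rewrite !mxE ord1 -(hQ j (ltn_ord j)).
have y'n : norm2 y' <= 16 * (K%:R / lam).
  apply: le_trans (norm2_near _ (lanczos_basis s *m w)) _.
  have := ler_wpM2r Kl0 es; linear from y'e Qwn Kl0.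
have {}ye : norm2 ((vscale F g y').1 - g *: y') <= e * (g * (16 * (K%:R / lam))).
  apply: le_trans ye _; rewrite (gtr0_norm gpos); apply: ler_pM => //.
    by rewrite mulr_ge0 ?norm2_ge0 // ltW.
  by rewrite ler_wpM2l // ltW.
split=> //; last first.
  have slv_cost : cost_le (slv (lanczos_tridiag s)).2 0 (cSn * K).
    apply: cost_le_flops slv_flops _; rewrite -(ler_nat R) natrM; apply: le_trans slv_size _.
    apply: le_trans (ler_wpM2r (ler0n _ _) cS_le) _.
    by rewrite ler_wpM2l.
  have := cost_le_cat (cost_norm F c) (cost_le_cat (cost_vec1 (fun i => fldiv F (c i 0) g))
    (cost_le_cat cloop (cost_le_cat slv_cost (cost_le_cat (cost_matvec F (lanczos_basis s) w)
    (cost_vec1 (fun i => flmul F g (y' i 0))))))).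
  apply: cost_le_weaken; first by rewrite !add0n !addn0.
  exact: lanczos_flops.
have -> : M *m (vscale F g y').1 - c =
  M *m ((vscale F g y').1 - g *: y') + g *: (M *m (y' - lanczos_basis s *m w))
  + g *: (M *m (lanczos_basis s *m w) - q1) + (g *: q1 - c).
  rewrite !mulmxBr -!scalemxAr !scalerBr.
  move: (M *m (vscale F g y').1) (g *: (M *m y')) (g *: (M *m _)) (g *: q1) => v1 v2 v3 v4.
  by apply/matrixP => i j; rewrite !mxE; ring.
rewrite Q0 -basisE in res.
have t1 : norm2 (M *m ((vscale F g y').1 - g *: y')) <= Lam * (e * (g * (16 * (K%:R / lam)))).
  by apply: le_trans (M_le _) _; rewrite ler_wpM2l.
have t2 : norm2 (g *: (M *m (y' - lanczos_basis s *m w))) <= g * (Lam * (e * (8 * K%:R / lam))).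
  rewrite norm2Z (gtr0_norm gpos) ler_wpM2l ?(ltW gpos) //.
  by apply: le_trans (M_le _) _; rewrite ler_wpM2l.
have t3 : norm2 (g *: (M *m (lanczos_basis s *m w) - q1)) <= g * galerkin_err.
  by rewrite norm2Z (gtr0_norm gpos) ler_wpM2l ?(ltW gpos).
apply: le_trans (norm2D _ _) _.
apply: le_trans (lerD (norm2D _ _) gq1) _.
apply: le_trans (lerD (lerD (norm2D _ _) (lexx _)) (lexx _)) _.
have c0 := norm2_ge0 c.
have g2 : g <= 2 * norm2 c by apply: le_trans gle _; rewrite ler_wpM2r //; linear from es.
have bracket : 0 <= 24 * Lam * K%:R * e / lam + galerkin_err.
  by nonneg.
have := ler_wpM2r bracket g2; rewrite /lanczos_err; linear from t1 t2 t3.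
Qed.

End LanczosOutput.

(** * Products with the preconditioned matrix *)

Section Products.
Context {R : realType} {u : R} (F : fparith u).
Variables (n : nat) (A P : 'M[R]_n) (O : products R n) (pmul : {poly {poly R}}).
Variables (H G kappa pm : R).
Hypothesis u0 : 0 <= u.
Hypothesis A_unit : A \in unitmx.
Hypothesis P_unit : P \in unitmx.
Hypothesis O_ok : backward_stable_products F pmul A P O.
Hypothesis H1 : 1 <= H.
Hypothesis G1 : 1 <= G.
Hypothesis pm0 : 0 <= pm.
Hypothesis pm_ge : prefactor pmul n u <= pm.

Let B := A *m invmx P.
Hypothesis B_le : specnorm B <= H.
Hypothesis Binv_le : specnorm (invmx B) <= G.
Hypothesis A_cond : specnorm A * specnorm (invmx A) <= kappa.

(** A product costs [u * cond A], not [u]: [|A| |P^-1 z|], to which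
    the rounding errors are proportional, may exceed [|B z|] by the factor
    [kappa]. *)
Definition unit_err : R := pm * (kappa * u).

Hypothesis unit_err_small : 4 * G * H * unit_err <= 1.

Lemma preconditioned_unitmx : B \in unitmx.
Proof. by rewrite unitmx_mul A_unit unitmx_inv. Qed.

Lemma kappa_ge0 : 0 <= kappa.
Proof. by apply: le_trans A_cond; rewrite mulr_ge0 ?specnorm_ge0. Qed.

Lemma unit_err_ge0 : 0 <= unit_err.
Proof. by rewrite /unit_err !mulr_ge0 ?kappa_ge0. Qed.

Lemma preconditioned_mulP (x : 'cV[R]_n) : B *m (P *m x) = A *m x.
Proof. by rewrite mulmxA mulmxKV. Qed.

(** Since [B = A P^-1] is well conditioned, [P] and [A] are interchangeable in
    norm, and so are their inverses. *)
Lemma specnorm_P_le : specnorm P <= G * specnorm A.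
Proof.
apply: specnorm_le => [|x]; first by rewrite mulr_ge0 ?specnorm_ge0 // (le_trans ler01).
have -> : P *m x = invmx B *m (A *m x) by rewrite -preconditioned_mulP mulKmx ?preconditioned_unitmx.
apply: le_trans (norm2_mulmx _ _) _; rewrite -mulrA.
by apply: ler_pM; rewrite ?specnorm_ge0 ?norm2_ge0 ?norm2_mulmx.
Qed.

Lemma specnorm_Pinv_le : specnorm (invmx P) <= specnorm (invmx A) * H.
Proof.
have H0 : 0 <= H := le_trans ler01 H1.
apply: specnorm_le => [|x]; first by rewrite mulr_ge0 ?specnorm_ge0.
have -> : invmx P *m x = invmx A *m (B *m x) by rewrite /B -mulmxA mulKmx.
apply: le_trans (norm2_mulmx _ _) _; rewrite -mulrA ler_wpM2l ?specnorm_ge0 //.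
by apply: le_trans (norm2_mulmx _ _) _; rewrite ler_wpM2r ?norm2_ge0.
Qed.

Lemma A_Pinv_le : specnorm A * specnorm (invmx P) <= kappa * H.
Proof.
apply: le_trans (ler_wpM2l (specnorm_ge0 A) specnorm_Pinv_le) _.
by rewrite mulrA ler_wpM2r // (le_trans ler01).
Qed.

Lemma prefactor_u_le a : 0 <= a -> prefactor pmul n u * a * u <= pm * a * u.
Proof. by move=> a0; rewrite ler_wpM2r // ler_wpM2r. Qed.

(** Solving with a perturbed [P] (or with its transpose [Q]) changes the result
    by a relative amount [cond P * u], which the preconditioner bounds by a
    multiple of [kappa * u]. *)
Lemma perturbed_solve (Q : 'M[R]_n) (dP : 'M[R]_n) z y : Q \in unitmx ->
  specnorm Q <= specnorm P -> specnorm (invmx Q) <= specnorm (invmx P) ->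
  specnorm dP <= prefactor pmul n u * specnorm P * u -> (Q + dP) *m y = z ->
  norm2 y <= 2 * norm2 (invmx Q *m z) /\
  norm2 (y - invmx Q *m z) <= 2 * G * H * unit_err * norm2 (invmx Q *m z).
Proof.
move=> Qu Qn Qin hdP hy; have H0 := le_trans ler01 H1; have G0 := le_trans ler01 G1.
have E : y - invmx Q *m z = - (invmx Q *m (dP *m y)).
  by rewrite -hy mulmxDl mulmxDr mulKmx // opprD addrA subrr add0r.
have tau : specnorm (invmx Q) * specnorm dP <= G * H * unit_err.
  apply: le_trans (_ : specnorm (invmx P) * (pm * (G * specnorm A) * u) <= _).
    apply: ler_pM; rewrite ?specnorm_ge0 //; apply: le_trans hdP _.
    apply: le_trans (prefactor_u_le (specnorm_ge0 P)) _.
    by rewrite ler_wpM2r // ler_wpM2l // specnorm_P_le.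
  have -> : specnorm (invmx P) * (pm * (G * specnorm A) * u) =
     (specnorm A * specnorm (invmx P)) * (G * pm * u) by ring.
  have -> : G * H * unit_err = kappa * H * (G * pm * u) by rewrite /unit_err; ring.
  by rewrite ler_wpM2r ?A_Pinv_le // !mulr_ge0.
have dy : norm2 (y - invmx Q *m z) <= G * H * unit_err * norm2 y.
  rewrite E norm2N; apply: le_trans (norm2_mulmx _ _) _.
  apply: le_trans (ler_wpM2l (specnorm_ge0 _) (norm2_mulmx _ _)) _.
  by rewrite mulrA ler_wpM2r ?norm2_ge0.
have w0 := unit_err_ge0; have GH0 : 0 <= G * H * unit_err by nonneg.
have y2 : norm2 y <= 2 * norm2 (invmx Q *m z).
  have := norm2_near y (invmx Q *m z).
  have : G * H * unit_err * norm2 y <= 1 / 4 * norm2 y.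
    by rewrite ler_wpM2r ?norm2_ge0 //; have := unit_err_small; lra.
  have := norm2_ge0 y; lra.
split=> //; apply: le_trans dy _.
by have := ler_wpM2l GH0 y2; lra.
Qed.

(** The error of [P^-1 z] is measured after multiplication by [A], where it reads
    [B dP y] and is no longer magnified by [P^-1]. *)
Lemma mulPinv_err z : representable F z ->
  [/\ representable F (mulPinv O z),
      norm2 (A *m mulPinv O z - B *m z) <= 2 * G * H ^+ 2 * unit_err * norm2 z,
      norm2 (Defs.mulA O (mulPinv O z) - B *m z) <= 4 * G * H ^+ 2 * unit_err * norm2 z &
      representable F (Defs.mulA O (mulPinv O z))].
Proof.
move=> rz; have [[_ _ rP _] _ _ [dP dPle dPz] _] := O_ok rz.
have [[rA _ _ _] eA _ _ _] := O_ok rP; set y := mulPinv O z in dPz rP rA eA *.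
have H0 := le_trans ler01 H1; have G0 := le_trans ler01 G1.
have w0 := unit_err_ge0.
have Pz : norm2 (invmx P *m z) <= specnorm (invmx P) * norm2 z := norm2_mulmx _ _.
have [y2 dy] := perturbed_solve P_unit (lexx _) (lexx _) dPle dPz.
have AB : A *m y - B *m z = - (B *m (dP *m y)).
  by rewrite -preconditioned_mulP -mulmxBr -mulmxN -dPz mulmxDl opprD addrA subrr add0r.
have Ay : norm2 (A *m y - B *m z) <= 2 * G * H ^+ 2 * unit_err * norm2 z.
  rewrite AB norm2N; apply: le_trans (norm2_mulmx _ _) _.
  apply: le_trans (_ : H * (pm * (G * specnorm A) * u * (2 * (specnorm (invmx P) * norm2 z))) <= _).
    apply: ler_pM; rewrite ?specnorm_ge0 ?norm2_ge0 //.
    apply: le_trans (norm2_mulmx _ _) _; apply: ler_pM; rewrite ?specnorm_ge0 ?norm2_ge0 //.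
      apply: le_trans dPle _; apply: le_trans (prefactor_u_le (specnorm_ge0 P)) _.
      by rewrite ler_wpM2r // ler_wpM2l // specnorm_P_le.
    by apply: le_trans y2 _; rewrite ler_wpM2l.
  have -> : H * (pm * (G * specnorm A) * u * (2 * (specnorm (invmx P) * norm2 z))) =
     (specnorm A * specnorm (invmx P)) * (2 * G * H * pm * u * norm2 z) by ring.
  have -> : 2 * G * H ^+ 2 * unit_err * norm2 z = kappa * H * (2 * G * H * pm * u * norm2 z).
    by rewrite /unit_err; ring.
  by rewrite ler_wpM2r ?A_Pinv_le // !mulr_ge0 ?norm2_ge0.
split=> //.
have -> : Defs.mulA O y - B *m z = (Defs.mulA O y - A *m y) + (A *m y - B *m z) by rewrite addrA subrK.
apply: le_trans (norm2D _ _) _.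
have {}eA : norm2 (Defs.mulA O y - A *m y) <= 2 * G * H ^+ 2 * unit_err * norm2 z.
  apply: le_trans eA _.
  apply: le_trans (_ : pm * specnorm A * (2 * (specnorm (invmx P) * norm2 z)) * u <= _).
    rewrite ler_wpM2r //; apply: le_trans (_ : pm * specnorm A * norm2 y <= _).
      by rewrite ler_wpM2r ?norm2_ge0 // ler_wpM2r ?specnorm_ge0.
    rewrite ler_wpM2l ?mulr_ge0 ?specnorm_ge0 //.
    by apply: le_trans y2 _; rewrite ler_wpM2l.
  have -> : pm * specnorm A * (2 * (specnorm (invmx P) * norm2 z)) * u =
     (specnorm A * specnorm (invmx P)) * (2 * pm * u * norm2 z) by ring.
  apply: le_trans (_ : kappa * H * (2 * pm * u * norm2 z) <= _).
    by rewrite ler_wpM2r ?A_Pinv_le // !mulr_ge0 ?norm2_ge0.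
  have -> : kappa * H * (2 * pm * u * norm2 z) = 2 * H * unit_err * norm2 z.
    by rewrite /unit_err; ring.
  rewrite ler_wpM2r ?norm2_ge0 // ler_wpM2r //.
  have : 1 * H <= (G * H) * H by rewrite ler_wpM2r // mulr_ege1.
  by rewrite expr2; lra.
lra.
Qed.

Lemma mulPinvt_err r : representable F r ->
  [/\ representable F (mulPinvt O (mulAt O r)),
      norm2 (mulPinvt O (mulAt O r) - B^T *m r) <= 5 * G * H ^+ 2 * unit_err * norm2 r &
      norm2 (mulPinvt O (mulAt O r)) <= 4 * H * norm2 r].
Proof.
move=> rr; have [[_ rAt _ _] _ eAt _ _] := O_ok rr.
have [[_ _ _ rPt] _ _ _ [dP dPle dPz]] := O_ok rAt.
set c1 := mulAt O r in rAt eAt rPt dPle dPz *; set y := mulPinvt O c1 in rPt dPz *.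
have H0 := le_trans ler01 H1; have G0 := le_trans ler01 G1.
have w0 := unit_err_ge0; have r0 := norm2_ge0 r.
have Ptu : P^T \in unitmx by rewrite unitmx_tr.
have Ptn : specnorm P^T <= specnorm P.
  by apply: specnorm_le => [|x]; [apply: specnorm_ge0 | apply: norm2_trmx_mulmx].
have Ptin : specnorm (invmx P^T) <= specnorm (invmx P).
  rewrite -trmx_inv.
  by apply: specnorm_le => [|x]; [apply: specnorm_ge0 | apply: norm2_trmx_mulmx].
have [y2 dy] := perturbed_solve Ptu Ptn Ptin dPle dPz.
have BT : invmx P^T *m (A^T *m r) = B^T *m r by rewrite /B trmx_mul trmx_inv mulmxA.
have dc : norm2 (invmx P^T *m c1 - B^T *m r) <= H * unit_err * norm2 r.
  rewrite -BT -mulmxBr; apply: le_trans (norm2_mulmx _ _) _.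
  apply: le_trans (_ : specnorm (invmx P) * (pm * specnorm A * norm2 r * u) <= _).
    apply: ler_pM; rewrite ?specnorm_ge0 ?norm2_ge0 //; apply: le_trans eAt _.
    by rewrite ler_wpM2r // ler_wpM2r // ler_wpM2r ?specnorm_ge0.
  have -> : specnorm (invmx P) * (pm * specnorm A * norm2 r * u) =
    (specnorm A * specnorm (invmx P)) * (pm * u * norm2 r) by ring.
  have -> : H * unit_err * norm2 r = kappa * H * (pm * u * norm2 r) by rewrite /unit_err; ring.
  by rewrite ler_wpM2r ?A_Pinv_le // !mulr_ge0.
have Br : norm2 (B^T *m r) <= H * norm2 r.
  by apply: le_trans (norm2_trmx_mulmx _ _) _; rewrite ler_wpM2r.
have GH : 1 <= G * H by rewrite mulr_ege1.
have w1 : unit_err <= 1.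
  have : 1 * unit_err <= (G * H) * unit_err by rewrite ler_wpM2r.
  by have := unit_err_small; lra.
have cn : norm2 (invmx P^T *m c1) <= 2 * H * norm2 r.
  apply: le_trans (norm2_near _ (B^T *m r)) _.
  have : (H * norm2 r) * unit_err <= (H * norm2 r) * 1 by rewrite ler_wpM2l // mulr_ge0.
  lra.
split=> //; last by lra.
have -> : y - B^T *m r = (y - invmx P^T *m c1) + (invmx P^T *m c1 - B^T *m r).
  by rewrite addrA subrK.
apply: le_trans (norm2D _ _) _.
have GHw : 0 <= 2 * G * H * unit_err by nonneg.
have := ler_wpM2l GHw cn.
have : (1 * H) * (unit_err * norm2 r) <= ((G * H) * H) * (unit_err * norm2 r).
  by apply: ler_wpM2r; [nonneg | apply: ler_wpM2r].
rewrite expr2; lra.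
Qed.

Lemma apply_normal_err z : representable F z ->
  representable F (apply_normal O z).1 /\
  norm2 ((apply_normal O z).1 - (B^T *m B) *m z) <= 14 * G * H ^+ 3 * unit_err * norm2 z.
Proof.
move=> rz; have [_ _ eA rA] := mulPinv_err rz; have [rt et _] := mulPinvt_err rA.
have -> : (apply_normal O z).1 = mulPinvt O (mulAt O (Defs.mulA O (mulPinv O z))) by [].
split=> //; set r := Defs.mulA O _ in eA rA rt et *.
have H0 := le_trans ler01 H1; have G0 := le_trans ler01 G1.
have w0 := unit_err_ge0; have z0 := norm2_ge0 z.
have rn : norm2 r <= 2 * H * norm2 z.
  apply: le_trans (norm2_near _ (B *m z)) _.
  have : norm2 (B *m z) <= H * norm2 z.
    by apply: le_trans (norm2_mulmx _ _) _; rewrite ler_wpM2r.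
  have : (4 * G * H * unit_err) * (H * norm2 z) <= 1 * (H * norm2 z).
    by rewrite ler_wpM2r ?mulr_ge0.
  move: eA; rewrite expr2; lra.
have -> : mulPinvt O (mulAt O r) - (B^T *m B) *m z =
  (mulPinvt O (mulAt O r) - B^T *m r) + B^T *m (r - B *m z).
  by rewrite mulmxBr (mulmxA B^T B z) addrA subrK.
apply: le_trans (norm2D _ _) _.
have : norm2 (B^T *m (r - B *m z)) <= H * (4 * G * H ^+ 2 * unit_err * norm2 z).
  apply: le_trans (norm2_trmx_mulmx _ _) _.
  by apply: ler_pM; rewrite ?specnorm_ge0 ?norm2_ge0.
have c0 : 0 <= 5 * G * H ^+ 2 * unit_err by nonneg.
have := ler_wpM2l c0 rn; lra.
Qed.

Lemma normal_le x : norm2 ((B^T *m B) *m x) <= H ^+ 2 * norm2 x.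
Proof.
have H0 := le_trans ler01 H1.
rewrite -mulmxA; apply: le_trans (norm2_trmx_mulmx _ _) _.
rewrite expr2 -mulrA; apply: ler_pM; rewrite ?specnorm_ge0 ?norm2_ge0 //.
by apply: le_trans (norm2_mulmx _ _) _; rewrite ler_wpM2r ?norm2_ge0.
Qed.

Lemma preconditioned_ge x : norm2 x <= G * norm2 (B *m x).
Proof.
rewrite -{1}[x](mulKmx preconditioned_unitmx); apply: le_trans (norm2_mulmx _ _) _.
by rewrite ler_wpM2r ?norm2_ge0.
Qed.

Lemma normal_ge x : G ^- 2 * inner x x <= inner x ((B^T *m B) *m x).
Proof.
rewrite -mulmxA -inner_mx -!norm2_sqr mulrC ler_pdivrMr ?exprn_gt0 ?(lt_le_trans ltr01) //.
rewrite mulrC -exprMn ler_sqr ?nnegrE ?mulr_ge0 ?norm2_ge0 ?(le_trans ler01 G1) //.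
exact: preconditioned_ge.
Qed.

Lemma normal_sym : (B^T *m B)^T = B^T *m B.
Proof. by rewrite trmx_mul trmxK. Qed.

End Products.

(** * Iterative refinement *)

Section Refinement.
Context {R : realType} {u : R} (F : fparith u).
Variables (n : nat) (A P : 'M[R]_n) (O : products R n) (pmul : {poly {poly R}}).
Variables (slv : tridiag_solver R) (q flops : nat).
Variables (H G kappa pm epsL : R).
Hypothesis u0 : 0 <= u.
Hypothesis u1 : u <= 1.
Hypothesis A_unit : A \in unitmx.
Hypothesis P_unit : P \in unitmx.
Hypothesis O_ok : backward_stable_products F pmul A P O.
Hypothesis H1 : 1 <= H.
Hypothesis G1 : 1 <= G.
Hypothesis pm0 : 0 <= pm.
Hypothesis pm_ge : prefactor pmul n u <= pm.

Let B := A *m invmx P.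
Hypothesis B_le : specnorm B <= H.
Hypothesis Binv_le : specnorm (invmx B) <= G.
Hypothesis A_cond : specnorm A * specnorm (invmx A) <= kappa.
Hypothesis kappa_u : kappa * u <= 1.

Let w := unit_err (u := u) kappa pm.
Hypothesis w_small : 4 * G * H * w <= 1.

Hypothesis epsL0 : 0 <= epsL.
Hypothesis lanczos_ok : forall c, representable F c ->
  let run := lanczos F slv (apply_normal O) q c in
  [/\ representable F run.1, norm2 ((B^T *m B) *m run.1 - c) <= epsL * norm2 c &
      cost_le run.2 q flops].

(** Relative error of [A dx] as an approximation of the computed residual, and
    the resulting factor by which the residual shrinks. *)
Definition step_err : R := 4 * G * H * epsL + 9 * G ^+ 2 * H ^+ 2 * w.
Definition contraction : R := 8 * w + 2 * u + 4 * step_err.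

Hypothesis step_err_small : step_err <= 1.

Variable bh : 'cV[R]_n.
Hypothesis bh_rep : representable F bh.
Let xs := invmx A *m bh.

(** The level at which refinement stagnates: the rounding error of one residual,
    proportional to [u] without the factor [kappa]. *)
Definition attainable : R := (8 * pm + 1) * u * (specnorm A * norm2 xs).

Local Tactic Notation "linear" "from" hyp_list(hs) :=
  clear - hs u0 u1 A_unit P_unit O_ok H1 G1 pm0 pm_ge B_le Binv_le A_cond kappa_u w_small epsL0
    lanczos_ok step_err_small bh_rep; lra.

Lemma A_iterate_le y : specnorm A * norm2 y <= specnorm A * norm2 xs + kappa * norm2 (bh - A *m y).
Proof.
have -> : norm2 y = norm2 (xs - invmx A *m (bh - A *m y)).
  by rewrite mulmxBr mulKmx // /xs opprB addrC subrK.
apply: le_trans (ler_wpM2l (specnorm_ge0 A) (norm2B _ _)) _.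
rewrite mulrDr lerD2l; apply: le_trans (ler_wpM2l (specnorm_ge0 A) (norm2_mulmx _ _)) _.
by rewrite mulrA ler_wpM2r ?norm2_ge0.
Qed.

(** One refinement step: relative to the current residual everything is
    reproduced up to [kappa * u] and the accuracy of the inner solver, while
    the absolute part stems from the rounding of [A x] only. *)
Lemma refine_err x : representable F x ->
  let run := refine F slv O q bh x in
  [/\ representable F run.1,
      norm2 (bh - A *m run.1) <= contraction * norm2 (bh - A *m x) + attainable &
      cost_le run.2 (q + 4) (2 * n + flops)].
Proof.
move=> rx; cbv zeta.
have H0 := le_trans ler01 H1; have G0 := le_trans ler01 G1.
have k0 : 0 <= kappa := kappa_ge0 A_cond.
have w0 : 0 <= w := unit_err_ge0 u0 pm0 A_cond.
have z0 : 0 <= step_err by rewrite /step_err; nonneg.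
have [[rA _ _ _] eA _ _ _] := O_ok rx.
have [rr er] := vsub_err u0 bh_rep rA.
set s := Defs.mulA O x in rA eA rr er *; set r := (vsub F bh s).1 in rr er *.
have [rc ec cn] := mulPinvt_err u0 A_unit P_unit O_ok H1 G1 pm0 pm_ge B_le Binv_le A_cond
  w_small rr.
set c := mulPinvt O (mulAt O r) in rc ec cn *.
have [rdy edy costL] := lanczos_ok rc.
set dy := (lanczos F slv (apply_normal O) q c).1 in rdy edy *.
have [rdx edx _ _] := mulPinv_err u0 A_unit P_unit O_ok H1 G1 pm0 pm_ge B_le Binv_le A_cond
  w_small rdy.
set dx := mulPinv O dy in rdx edx *; rewrite -/w in ec edx.
have [rx' ex'] := vadd_err u0 rx rdx.
have runE : (refine F slv O q bh x).1 = (vadd F x dx).1 by [].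
split; first by rewrite runE.
- rewrite runE; set x' := (vadd F x dx).1 in rx' ex' *.
  pose rho := bh - A *m x.
  have rho0 := norm2_ge0 rho; have r0 := norm2_ge0 r.
  pose nu := pm * u * (specnorm A * norm2 x).
  have nu0 : 0 <= nu by rewrite /nu !mulr_ge0 ?specnorm_ge0 ?norm2_ge0.
  have {}eA : norm2 (s - A *m x) <= nu.
    apply: le_trans eA _; rewrite /nu.
    have -> : pm * u * (specnorm A * norm2 x) = pm * (specnorm A * norm2 x) * u by ring.
    by rewrite mulrA ler_wpM2r // ler_wpM2r ?norm2_ge0 // ler_wpM2r ?specnorm_ge0.
  have bs : norm2 (bh - s) <= norm2 rho + nu.
    have -> : bh - s = rho - (s - A *m x) by rewrite /rho opprB addrA subrK.
    by apply: le_trans (norm2B _ _) _; rewrite lerD2l.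
  have rrho : norm2 (r - rho) <= 2 * nu + u * norm2 rho.
    have -> : r - rho = (r - (bh - s)) - (s - A *m x).
      by rewrite /rho; move: (A *m x) => v; apply/matrixP => i j; rewrite !mxE; ring.
    apply: le_trans (norm2B _ _) _.
    have := ler_wpM2l u0 bs; have : u * nu <= 1 * nu by rewrite ler_wpM2r.
    linear from eA er.
  have rn : norm2 r <= 2 * norm2 rho + 2 * nu.
    have := norm2_near r rho; have : u * norm2 rho <= 1 * norm2 rho by rewrite ler_wpM2r.
    linear from rrho.
  (* [B^-T] recovers the residual from [c]; it costs only the factor [G]. *)
  have Bunit := preconditioned_unitmx A_unit P_unit.
  have BTK v : invmx B^T *m (B^T *m v) = v by rewrite mulKmx // unitmx_tr.
  have Bdy : norm2 (B *m dy - r) <= (4 * G * H * epsL + 5 * G ^+ 2 * H ^+ 2 * w) * norm2 r.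
    have -> : B *m dy - r = invmx B^T *m ((B^T *m B *m dy - c) + (c - B^T *m r)).
      by rewrite addrA subrK mulmxBr BTK -mulmxA BTK.
    apply: le_trans (_ : G * norm2 ((B^T *m B *m dy - c) + (c - B^T *m r)) <= _).
      rewrite -trmx_inv; apply: le_trans (norm2_trmx_mulmx _ _) _.
      by rewrite ler_wpM2r ?norm2_ge0.
    have -> : (4 * G * H * epsL + 5 * G ^+ 2 * H ^+ 2 * w) * norm2 r =
      G * (epsL * (4 * H * norm2 r) + 5 * G * H ^+ 2 * w * norm2 r) by ring.
    rewrite ler_wpM2l //; apply: le_trans (norm2D _ _) _; apply: lerD ec.
    by apply: le_trans edy _; rewrite ler_wpM2l.
  have Bdyn : norm2 (B *m dy) <= 2 * norm2 r.
    apply: le_trans (norm2_near _ r) _.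
    have h : 4 * G * H * epsL + 5 * G ^+ 2 * H ^+ 2 * w <= 1.
      have : 0 <= 4 * G ^+ 2 * H ^+ 2 * w by nonneg.
      by have := step_err_small; rewrite /step_err; linear from r0.
    by have := ler_wpM2r r0 h; linear from Bdy.
  have dyn : norm2 dy <= G * (2 * norm2 r).
    by apply: le_trans (preconditioned_ge A_unit P_unit Binv_le dy) _; rewrite ler_wpM2l.
  have Adx : norm2 (A *m dx - r) <= step_err * norm2 r.
    have -> : A *m dx - r = (A *m dx - B *m dy) + (B *m dy - r) by rewrite addrA subrK.
    apply: le_trans (norm2D _ _) _.
    have c0 : 0 <= 2 * G * H ^+ 2 * w by nonneg.
    by have := ler_wpM2l c0 dyn; rewrite /step_err; linear from edx Bdy.
  have rest : norm2 (rho - A *m dx) <= 4 * nu + (u + 2 * step_err) * norm2 rho.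
    have -> : rho - A *m dx = - ((r - rho) + (A *m dx - r)).
      by move: (A *m dx) => v; apply/matrixP => i j; rewrite !mxE; ring.
    rewrite norm2N; apply: le_trans (norm2D _ _) _.
    have := ler_wpM2l z0 rn; have : step_err * nu <= 1 * nu by rewrite ler_wpM2r.
    linear from rrho Adx.
  (* Rounding errors are proportional to [|A| |x + dx|], which is compared with
     the exact solution: the difference is again a multiple of the residual. *)
  have xdx : specnorm A * norm2 (x + dx) <=
      specnorm A * norm2 xs + kappa * norm2 (rho - A *m dx).
    by apply: le_trans (A_iterate_le _) _; rewrite mulmxDr opprD addrA.
  have nux : nu <= pm * u * (specnorm A * norm2 xs) + w * norm2 rho.
    have -> : w * norm2 rho = pm * u * (kappa * norm2 rho) by rewrite /w /unit_err; ring.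
    by rewrite -mulrDr ler_wpM2l ?mulr_ge0 // A_iterate_le.
  have -> : bh - A *m x' = (rho - A *m dx) - A *m (x' - (x + dx)).
    rewrite mulmxBr mulmxDr /rho.
    move: (A *m x') (A *m x) (A *m dx) => v1 v2 v3.
    by apply/matrixP => i j; rewrite !mxE; ring.
  apply: le_trans (norm2B _ _) _.
  have up : norm2 (A *m (x' - (x + dx))) <= u * (specnorm A * norm2 (x + dx)).
    apply: le_trans (norm2_mulmx _ _) _; rewrite mulrCA.
    by rewrite ler_wpM2l ?specnorm_ge0.
  have up2 := ler_wpM2l u0 xdx.
  have kr : kappa * u * norm2 (rho - A *m dx) <= 1 * norm2 (rho - A *m dx).
    by rewrite ler_wpM2r ?norm2_ge0.
  rewrite -/rho /contraction /attainable.
  move: up up2 kr rest nux; rewrite /nu; linear from rho0.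
- have -> : (refine F slv O q bh x).2 = [:: MulA] ++ (vsub F bh s).2 ++ [:: MulAt] ++
    [:: MulPinvt] ++ (lanczos F slv (apply_normal O) q c).2 ++ [:: MulPinv] ++ (vadd F x dx).2.
    by [].
  have one o : o != Flop -> cost_le [:: o] 1 0 by case: o => //= _; split=> [[]|].
  have := cost_le_cat (one MulA isT) (cost_le_cat (cost_vec1 (fun i => flsub F (bh i 0) (s i 0)))
    (cost_le_cat (one MulAt isT) (cost_le_cat (one MulPinvt isT) (cost_le_cat costL
    (cost_le_cat (one MulPinv isT) (cost_vec1 (fun i => fladd F (x i 0) (dx i 0)))))))).
  by apply: cost_le_weaken; clear; lia.
Qed.

Lemma attainable_ge0 : 0 <= attainable.
Proof. by rewrite /attainable !mulr_ge0 ?specnorm_ge0 ?norm2_ge0 // addr_ge0 // mulr_ge0. Qed.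

Lemma contraction_ge0 : 0 <= contraction.
Proof.
have H0 := le_trans ler01 H1; have G0 := le_trans ler01 G1.
have w0 : 0 <= w := unit_err_ge0 u0 pm0 A_cond.
have z0 : 0 <= step_err by rewrite /step_err; nonneg.
by rewrite /contraction; nonneg.
Qed.

Hypothesis contraction_half : contraction <= 1 / 2.

Lemma refine_iter_err t x : representable F x ->
  let run := refine_iter F slv O t q bh x in
  [/\ representable F run.1,
      norm2 (bh - A *m run.1) <=
        contraction ^+ t * norm2 (bh - A *m x) + 2 * (1 - contraction ^+ t) * attainable &
      cost_le run.2 (t * (q + 4)) (t * (2 * n + flops))].
Proof.
elim: t x => [|t IH] x rx; cbv zeta.
  split=> //; first by rewrite /= mul1r subrr mulr0 mul0r addr0.
have [rx' ex' cx'] := refine_err rx; have [rx'' ex'' cx''] := IH _ rx'.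
have -> : refine_iter F slv O t.+1 q bh x =
  bind (refine F slv O q bh x) (fun x' => refine_iter F slv O t q bh x') by [].
split=> //; last by rewrite !mulSn; apply: cost_le_cat cx' cx''.
apply: le_trans ex'' _; have c0 := contraction_ge0; have ct0 := exprn_ge0 t c0.
have := ler_wpM2l ct0 ex'; have X0 := attainable_ge0.
have : contraction * (contraction ^+ t * attainable) <= 1 / 2 * (contraction ^+ t * attainable).
  by rewrite ler_wpM2r // mulr_ge0.
rewrite exprS; lra.
Qed.

End Refinement.

(** * Sizes of the error bounds *)

Section PowerBounds.
Context {R : realType}.
Variable g : R.
Hypothesis g_ge : 1000 <= g.

(** [a] is of size [x] up to a polynomial factor, measured by a power of the
    gauge [g]; with [x = 1] it is of polynomial size. *)
Definition pow_le (x : R) (i : nat) (a : R) : Prop := 0 <= a /\ a <= g ^+ i * x.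

Lemma g_ge1 : 1 <= g.
Proof. by have := g_ge; lra. Qed.

Lemma pow_le_base a : 0 <= a -> a <= g -> pow_le 1 1 a.
Proof. by move=> a0 ag; split=> //; rewrite mulr1. Qed.

Lemma pow_le_nat m : (m <= 1000)%N -> pow_le 1 1 m%:R.
Proof.
by move=> m1; apply: pow_le_base => //; apply: le_trans g_ge; rewrite ler_nat.
Qed.

Lemma pow_le_weaken x i j a : 0 <= x -> (i <= j)%N -> pow_le x i a -> pow_le x j a.
Proof.
move=> x0 ij [a0 ai]; split=> //; apply: le_trans ai _.
by rewrite ler_wpM2r // ler_weXn2l ?g_ge1.
Qed.

Lemma pow_leD x i j a c : 0 <= x -> pow_le x i a -> pow_le x j c ->
  pow_le x (maxn i j).+1 (a + c).
Proof.
move=> x0 /(pow_le_weaken x0 (leq_maxl i j)) [a0 ai].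
move=> /(pow_le_weaken x0 (leq_maxr i j)) [c0 ci].
split; first exact: addr_ge0.
have gx : 0 <= g ^+ maxn i j * x by rewrite mulr_ge0 // exprn_ge0 // (le_trans ler01 g_ge1).
have : 2 * (g ^+ maxn i j * x) <= g * (g ^+ maxn i j * x).
  by rewrite ler_wpM2r //; have := g_ge; lra.
by rewrite exprS -mulrA; lra.
Qed.

Lemma pow_leM x i j a c : pow_le 1 i a -> pow_le x j c -> pow_le x (i + j) (a * c).
Proof.
move=> [a0 ai] [c0 cj]; split; first exact: mulr_ge0.
rewrite exprD -mulrA; move: ai; rewrite mulr1 => ai.
exact: ler_pM.
Qed.

Lemma pow_leMr x i j a c : pow_le x i a -> pow_le 1 j c -> pow_le x (i + j) (a * c).
Proof. by move=> ha hc; rewrite mulrC addnC; apply: pow_leM. Qed.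

Lemma pow_leX m i a : pow_le 1 i a -> pow_le 1 (i * m) (a ^+ m).
Proof.
move=> [a0 ai]; split; first exact: exprn_ge0.
rewrite mulr1 exprM; move: ai; rewrite mulr1 => ai.
by apply: lerXn2r; rewrite // nnegrE exprn_ge0 // (le_trans ler01 g_ge1).
Qed.

Lemma pow_le_small x N i a : 0 <= x -> g ^+ N * x <= 1 -> pow_le x i a -> (i < N)%N ->
  a <= 1 / 1000.
Proof.
move=> x0 gN [a0 ai] iN.
have gx : 0 <= g ^+ i * x by rewrite mulr_ge0 // exprn_ge0 // (le_trans ler01 g_ge1).
have h : g ^+ i.+1 * x <= 1.
  by apply: le_trans gN; rewrite ler_wpM2r // ler_weXn2l ?g_ge1.
move: h; rewrite exprS -mulrA.
have : 1000 * (g ^+ i * x) <= g * (g ^+ i * x) by rewrite ler_wpM2r.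
lra.
Qed.

End PowerBounds.

Ltac pow_le_tac := first
  [ eassumption
  | eapply pow_le_nat; [eassumption | done]
  | eapply pow_leX; [eassumption | solve [pow_le_tac]]
  | eapply pow_leD; [eassumption | eassumption | solve [pow_le_tac] | solve [pow_le_tac]]
  | eapply pow_leM; [solve [pow_le_tac] | solve [pow_le_tac]]
  | eapply pow_leMr; [solve [pow_le_tac] | solve [pow_le_tac]] ].

Ltac size_le :=
  eapply pow_le_weaken; [eassumption | eassumption | | pow_le_tac]; done.

Section Accuracy.
Context {R : realType} {u : R} (F : fparith u).
Variables (n : nat) (A P : 'M[R]_n) (O : products R n) (pmul ptri : {poly {poly R}}).
Variables (slv : tridiag_solver R) (K cSn : nat) (cS : R).
Variables (H G kappa pm pt g : R).
Hypothesis n0 : (0 < n)%N.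
Hypothesis u0 : 0 <= u.
Hypothesis A_unit : A \in unitmx.
Hypothesis P_unit : P \in unitmx.
Hypothesis O_ok : backward_stable_products F pmul A P O.
Hypothesis slv_ok : backward_stable_tridiag F ptri cS slv.
Hypothesis cS_le : cS <= cSn%:R.
Hypothesis H1 : 1 <= H.
Hypothesis G1 : 1 <= G.
Hypothesis pm0 : 0 <= pm.
Hypothesis pm_ge : prefactor pmul n u <= pm.
Hypothesis pt0 : 0 <= pt.
Hypothesis pt_ge : forall k, (k <= K)%N -> prefactor ptri k u <= pt.
Hypothesis K0 : (0 < K)%N.

Let B := A *m invmx P.
Hypothesis B_le : specnorm B <= H.
Hypothesis Binv_le : specnorm (invmx B) <= G.
Hypothesis A_cond : specnorm A * specnorm (invmx A) <= kappa.
Hypothesis kappa1 : 1 <= kappa.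

Let x := kappa * u.
Hypothesis g_ge : 1000 <= g.
Hypothesis n_g : n.+1%:R <= g.
Hypothesis K_g : K%:R <= g.
Hypothesis H_g : H <= g.
Hypothesis G_g : G <= g.
Hypothesis pm_g : pm <= g.
Hypothesis pt_g : pt <= g.
Hypothesis small : g ^+ 200 * x <= 1.
Hypothesis decay : decay_rate (H ^+ 2) (G ^- 2) ^+ K.-1 <= 2 * x.

(** A common bound for the rounding errors of inner products and of products
    with the normal matrix. *)
Definition basic_err : R := 30 * H ^+ 3 * G * (n.+1%:R + K%:R + pm) * x.

Lemma x_ge0 : 0 <= x.
Proof. by rewrite mulr_ge0 // (le_trans ler01 kappa1). Qed.

Lemma u_le_x : u <= x.
Proof. by rewrite ler_peMl. Qed.

Lemma basic_err_ge y : 0 <= y -> y <= 30 * H ^+ 3 * G * (n.+1%:R + K%:R + pm) ->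
  y * x <= basic_err.
Proof. by move=> y0 yle; rewrite /basic_err ler_wpM2r ?x_ge0. Qed.

Lemma HG_mul_ge1 y : 0 <= y -> y <= 30 * H ^+ 3 * G * y.
Proof.
move=> y0; rewrite ler_peMl // mulr_ege1 // mulr_ege1 ?exprn_ege1 //.
by rewrite ler1n.
Qed.

Lemma gam_le_basic_err m : (m <= n.+1 + K)%N -> gam (u := u) m <= basic_err.
Proof.
move=> mn; have mR : m%:R <= n.+1%:R + K%:R :> R by rewrite -natrD ler_nat.
have m0 : 0 <= m%:R :> R by [].
have small1 : 1000 * x <= 1.
  have px : pow_le g x 0 x by split; rewrite ?expr0 ?mul1r // x_ge0.
  have := pow_le_small g_ge x_ge0 small px isT; lra.
have hm : m%:R * u <= 2 * g * x.
  have := ler_pM m0 u0 (le_trans mR (lerD n_g K_g)) u_le_x; lra.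
have gx : 2 * (2 * g * x) <= 1.
  have px : pow_le g x 1 (g * x) by split; rewrite ?expr1 // mulr_ge0 ?x_ge0 // (le_trans _ g_ge).
  have := pow_le_small g_ge x_ge0 small px isT; lra.
have h1 : 2 * m%:R * u <= 1 by lra.
apply: le_trans (gam_le u0 h1) _.
apply: le_trans (_ : 2 * m%:R * x <= _); first by rewrite ler_wpM2l ?u_le_x // mulr_ge0.
have y0 : 0 <= n.+1%:R + K%:R + pm by rewrite !addr_ge0.
apply: basic_err_ge; first by rewrite mulr_ge0.
have := HG_mul_ge1 y0; have HG : 30 <= 30 * H ^+ 3 * G.
  by rewrite -mulrA ler_peMr // mulr_ege1 // exprn_ege1.
have := ler_wpM2r y0 HG; have := pm0; lra.
Qed.

Lemma parameter_sizes :
  [/\ pow_le g x 0 u, pow_le g x 0 x, pow_le g 1 1 1 &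
  [/\ pow_le g 1 1 H, pow_le g 1 1 G, pow_le g 1 1 n.+1%:R &
  [/\ pow_le g 1 1 K%:R, pow_le g 1 1 pm & pow_le g 1 1 pt]]].
Proof.
have H0 := le_trans ler01 H1; have G0 := le_trans ler01 G1.
split; last split; last split; try exact: pow_le_base.
- by split=> //; rewrite expr0 mul1r u_le_x.
- by split; rewrite ?expr0 ?mul1r // x_ge0.
- exact: (pow_le_nat g_ge (isT : (1 <= 1000)%N)).
Qed.

(** The exponents are generous; all that matters is that they stay below the
    exponent [200] of the smallness assumption. *)
Lemma error_sizes :
  let e := basic_err in let epsL := lanczos_err (u := u) (H ^+ 2) (G ^- 2) e pt K in
  [/\ pow_le g x 10 e, pow_le g x 40 epsL, pow_le g x 60 (step_err (u := u) H G kappa pm epsL) &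
      pow_le g x 70 (contraction (u := u) H G kappa pm epsL)].
Proof.
have H0 := le_trans ler01 H1; have G0 := le_trans ler01 G1.
have x0 := x_ge0; have one0 : 0 <= (1 : R) by [].
have [pu px p1 [pH pG pn [pK ppm ppt]]] := parameter_sizes.
cbv zeta.
have pe : pow_le g x 10 basic_err.
  by rewrite /basic_err; size_le.
have pw : pow_le g x 1 (unit_err (u := u) kappa pm).
  by rewrite /unit_err; size_le.
have pB : pow_le g 1 10 (lanczos_bound (H ^+ 2) K).
  by rewrite /lanczos_bound; size_le.
have peps : pow_le g x 20 (lanczos_eps (H ^+ 2) basic_err K).
  by rewrite /lanczos_eps; size_le.
have pse : pow_le g x 10 (solver_err (u := u) (H ^+ 2) pt).
  by rewrite /solver_err; size_le.
have pdec : pow_le g x 1 (decay_rate (H ^+ 2) (G ^- 2) ^+ K.-1).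
  split; first by rewrite exprn_ge0 // decay_rate_ge0.
  by apply: le_trans decay _; rewrite expr1 ler_wpM2r //; have := g_ge; lra.
have pL : pow_le g x 40 (lanczos_err (u := u) (H ^+ 2) (G ^- 2) basic_err pt K).
  by rewrite /lanczos_err /galerkin_err invrK; size_le.
have ps : pow_le g x 60 (step_err (u := u) H G kappa pm
    (lanczos_err (u := u) (H ^+ 2) (G ^- 2) basic_err pt K)).
  by rewrite /step_err; size_le.
split=> //.
by rewrite /contraction; size_le.
Qed.

(** Each smallness condition needed by the inner solver has the form
    (polynomial factor) [* x <= 1 / 1000]. *)
Lemma inner_solver_accurate c : representable F c ->
  let run := lanczos F slv (apply_normal O) K c in
  [/\ representable F run.1,
      norm2 ((B^T *m B) *m run.1 - c) <=
        lanczos_err (u := u) (H ^+ 2) (G ^- 2) basic_err pt K * norm2 c &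
      cost_le run.2 K (n * K * (17 + cSn))].
Proof.
move=> rc.
have H0 := le_trans ler01 H1; have G0 := le_trans ler01 G1.
have x0 := x_ge0; have one0 : 0 <= (1 : R) by [].
have [pu px p1 [pH pG pn [pK ppm ppt]]] := parameter_sizes.
have [pe _ _ _] := error_sizes.
have pw : pow_le g x 1 (unit_err (u := u) kappa pm).
  by rewrite /unit_err; size_le.
have pB : pow_le g 1 10 (lanczos_bound (H ^+ 2) K).
  by rewrite /lanczos_bound; size_le.
have peps : pow_le g x 20 (lanczos_eps (H ^+ 2) basic_err K).
  by rewrite /lanczos_eps; size_le.
have KR : 1 <= K%:R :> R by rewrite ler1n.
have gapE : (shift_gap (G ^- 2) K)^-1 = 4 * K%:R * G ^+ 2.
  by rewrite /shift_gap invf_div invrK.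
have gap0 : 0 < shift_gap (G ^- 2) K.
  by rewrite /shift_gap divr_gt0 ?invr_gt0 ?exprn_gt0 ?mulr_gt0 ?ltr0n ?(lt_le_trans ltr01 G1).
have w_small : 4 * G * H * unit_err (u := u) kappa pm <= 1.
  have h : pow_le g x 10 (4 * G * H * unit_err (u := u) kappa pm).
    by size_le.
  by have := pow_le_small g_ge x0 small h isT; lra.
have e_small : basic_err <= 1 / 100.
  by have := pow_le_small g_ge x0 small pe isT; lra.
have K_small : 100 * K%:R * basic_err <= 1.
  have h : pow_le g x 20 (100 * K%:R * basic_err).
    by size_le.
  by have := pow_le_small g_ge x0 small h isT; lra.
have eps_small : lanczos_eps (H ^+ 2) basic_err K <= 1 / 8.
  by have := pow_le_small g_ge x0 small peps isT; lra.
have H21 : 1 <= H ^+ 2 by rewrite exprn_ege1.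
have G21 : 1 <= G ^+ 2 by rewrite exprn_ege1.
have lam0 : 0 < G ^- 2 by rewrite invr_gt0 (lt_le_trans ltr01).
have lamL : G ^- 2 <= H ^+ 2 by apply: le_trans H21; rewrite invf_le1 // (lt_le_trans ltr01).
have app_rep z : representable F z -> representable F (apply_normal O z).1.
  by case/(apply_normal_err u0 A_unit P_unit O_ok H1 G1 pm0 pm_ge B_le Binv_le A_cond w_small).
have app_err z : representable F z ->
    norm2 ((apply_normal O z).1 - B^T *m B *m z) <= basic_err * norm2 z.
  case/(apply_normal_err u0 A_unit P_unit O_ok H1 G1 pm0 pm_ge B_le Binv_le A_cond w_small) => _.
  move=> /le_trans; apply; rewrite ler_wpM2r ?norm2_ge0 //.
  have -> : 14 * G * H ^+ 3 * unit_err (u := u) kappa pm = 14 * G * H ^+ 3 * pm * x.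
    by rewrite /unit_err /x; ring.
  apply: basic_err_ge; first by nonneg.
  have -> : 14 * G * H ^+ 3 * pm = H ^+ 3 * G * (14 * pm) by ring.
  have -> : 30 * H ^+ 3 * G * (n.+1%:R + K%:R + pm) =
     H ^+ 3 * G * (30 * (n.+1%:R + K%:R + pm)) by ring.
  apply: ler_wpM2l; first by nonneg.
  have := ler0n R n.+1; have := pm0; lra.
have app_cost z : cost_le (apply_normal O z).2 1 0 by split=> [[]|].
apply: (lanczos_output n0 u0 (gam_le_basic_err _) (gam_le_basic_err _) e_small K0 K_small (normal_sym A P)
  H21 lam0 lamL (normal_le H1 B_le) (normal_ge A_unit P_unit G1 Binv_le)
  app_rep app_err app_cost slv_ok cS_le pt0 pt_ge eps_small _ _ _ rc).
- by rewrite leq_addr.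
- by rewrite leq_addl.
- rewrite -[X in _ < X]mul1r -ltr_pdivrMr // gapE.
  have pq : pow_le g 1 40 (1 + (lanczos_bound (H ^+ 2) K * (4 * K%:R * G ^+ 2)) ^+ 2).
    by size_le.
  have pfac : pow_le g 1 60 (3 * lanczos_bound (H ^+ 2) K + 4
      + 2 * (lanczos_bound (H ^+ 2) K ^+ 2 * (4 * K%:R * G ^+ 2))
      + 4 * K%:R * (1 + (lanczos_bound (H ^+ 2) K * (4 * K%:R * G ^+ 2)) ^+ 2)).
    by size_le.
  apply: (@le_lt_trans _ _ (1 / 1000)); last by lra.
  apply: (pow_le_small (i := 150) g_ge x0 small _ isT).
  eapply pow_le_weaken; [eassumption| eassumption | | eapply pow_leMr; [eapply pow_leMr;
    [eapply pow_leMr; [exact: peps | exact: pfac] | exact: pq] | pow_le_tac]].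
  done.
- rewrite invrK; apply: (@le_lt_trans _ _ (1 / 1000)); last by lra.
  apply: (pow_le_small (i := 50) g_ge x0 small _ isT).
  by size_le.
- rewrite ler_pdivlMr // -[X in _ <= X]mul1r ler_pdivlMr ?exprn_gt0 ?(lt_le_trans ltr01 G1) //.
  apply: (@le_trans _ _ (1 / 1000)); last by lra.
  apply: (pow_le_small (i := 50) g_ge x0 small _ isT).
  by rewrite /solver_err; size_le.
Qed.

(** One factor [kappa * u] of the square pays for the polynomial factors, so a
    refinement step gains at least half of the digits of [kappa * u]. *)
Lemma contraction_sqr_le :
  contraction (u := u) H G kappa pm (lanczos_err (u := u) (H ^+ 2) (G ^- 2) basic_err pt K) ^+ 2
    <= x.
Proof.
have [_ _ _ [c0 c1]] := error_sizes; have x0 := x_ge0; have g1 := g_ge1 g_ge.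
set c := contraction _ _ _ _ _ in c0 c1 *.
apply: le_trans (_ : (g ^+ 70 * x) ^+ 2 <= _); first by apply: lerXn2r; rewrite ?nnegrE // (le_trans c0).
have -> : (g ^+ 70 * x) ^+ 2 = (g ^+ 140 * x) * x by ring.
rewrite -[X in _ <= X]mul1r ler_wpM2r //; apply: le_trans small.
by rewrite ler_wpM2r // ler_weXn2l.
Qed.

Local Tactic Notation "linear" "from" hyp_list(hs) :=
  clear - hs n0 u0 A_unit P_unit O_ok slv_ok cS_le H1 G1 pm0 pm_ge pt0 pt_ge K0 B_le Binv_le
    A_cond kappa1 g_ge n_g K_g H_g G_g pm_g pt_g small decay; lra.

(** Once the residual is [O(u |A| |xs|)], the solution norm can be replaced by the
    norm of the output because their difference is at most [kappa] times the
    residual, hence small. The storage error of [b] is of the same order. *)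
Lemma refinement_backward_error t (b : 'cV[R]_n) :
  contraction (u := u) H G kappa pm (lanczos_err (u := u) (H ^+ 2) (G ^- 2) basic_err pt K) ^+ t
    <= u ->
  let run := meta_solver F slv O t K b in
  norm2 (b - A *m run.1) <= (32 * pm + 10) * u * specnorm A * norm2 run.1 /\
  cost_le run.2 (t * (K + 4)) (t * (2 * n + n * K * (17 + cSn))).
Proof.
move=> ct; cbv zeta.
have [pe pL ps pc] := error_sizes; have x0 := x_ge0; have k1 := kappa1.
have H0 := le_trans ler01 H1; have G0 := le_trans ler01 G1.
have one0 : 0 <= (1 : R) by [].
have [pu px p1 [pH pG pn [pK ppm ppt]]] := parameter_sizes.
have x1 := pow_le_small g_ge x0 small px isT.
have ux := u_le_x; have u1 : u <= 1 by lra.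
have w_small : 4 * G * H * unit_err (u := u) kappa pm <= 1.
  have h : pow_le g x 10 (4 * G * H * unit_err (u := u) kappa pm).
    by rewrite /unit_err; size_le.
  by have := pow_le_small g_ge x0 small h isT; lra.
have w1000 : pm * x <= 1 / 1000.
  have h : pow_le g x 5 (pm * x).
    by size_le.
  exact: (pow_le_small g_ge x0 small h isT).
set epsL := lanczos_err _ _ _ _ _ in ct pL ps pc *.
set c := contraction _ _ _ _ _ in ct pc *.
have [epsL0 _] := pL.
have s1 : step_err (u := u) H G kappa pm epsL <= 1.
  by have := pow_le_small g_ge x0 small ps isT; lra.
have c1 : c <= 1 / 2 by have := pow_le_small g_ge x0 small pc isT; lra.
have kx : kappa * u <= 1 by apply: le_trans x1 _; linear from.
have rbh := representable_fl F b; set bh := map_mx (fl F) b in rbh.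
have := refine_iter_err u0 u1 A_unit P_unit O_ok H1 G1 pm0 pm_ge B_le Binv_le A_cond kx w_small
  epsL0 inner_solver_accurate s1 rbh c1 t (representable0 F n 1); cbv zeta.
rewrite -/(meta_solver F slv O t K b); set run := meta_solver F slv O t K b.
move=> [_ err cost]; split=> //; move: err; rewrite -/c mulmx0 subr0 => err.
have bs : norm2 (b - bh) <= u * norm2 b by rewrite norm2_subC fl_vec_err.
have xs0 : 0 <= specnorm A * norm2 (invmx A *m bh) by rewrite mulr_ge0 ?specnorm_ge0 ?norm2_ge0.
have bx : norm2 bh <= specnorm A * norm2 (invmx A *m bh).
  by rewrite -{1}[bh](mulKVmx A_unit) norm2_mulmx.
have AX : specnorm A * norm2 (invmx A *m bh) <=
    specnorm A * norm2 run.1 + kappa * norm2 (bh - A *m run.1).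
  have -> : invmx A *m bh = run.1 + invmx A *m (bh - A *m run.1).
    by rewrite mulmxBr mulKmx // addrC subrK.
  apply: le_trans (ler_wpM2l (specnorm_ge0 A) (norm2D _ _)) _; rewrite mulrDr lerD2l.
  apply: le_trans (ler_wpM2l (specnorm_ge0 A) (norm2_mulmx _ _)) _.
  by rewrite mulrA ler_wpM2r ?norm2_ge0.
move: err AX bx xs0; rewrite /attainable.
move: (specnorm A * norm2 (invmx A *m bh)) => X err AX bx X0.
have ct0 : 0 <= c ^+ t by rewrite exprn_ge0 //; case: pc.
have res : norm2 (bh - A *m run.1) <= (16 * pm + 3) * u * X.
  apply: le_trans err _.
  have := ler_pM ct0 (norm2_ge0 bh) ct bx.
  have : 0 <= c ^+ t * ((8 * pm + 1) * u * X) by nonneg.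
  have := mulr_ge0 u0 X0; linear from X0.
have kres : kappa * norm2 (bh - A *m run.1) <= 1 / 4 * X.
  have := ler_wpM2l (le_trans ler01 k1) res.
  have -> : kappa * ((16 * pm + 3) * u * X) = 16 * (pm * x * X) + 3 * (x * X) by rewrite /x; ring.
  have := ler_wpM2r X0 w1000; have := ler_wpM2r X0 x1; linear from X0.
have X2 : X <= 2 * (specnorm A * norm2 run.1) by linear from AX kres X0.
have bn : norm2 b <= 2 * X.
  have := norm2_near b bh; have : u * norm2 b <= 1 / 1000 * norm2 b.
    by rewrite ler_wpM2r ?norm2_ge0 //; linear from ux x1.
  have := norm2_ge0 b; linear from bs bx X0.
have -> : b - A *m run.1 = (bh - A *m run.1) + (b - bh).
  by rewrite [RHS]addrC addrA subrK.
apply: le_trans (norm2D _ _) _.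
have := ler_wpM2l u0 bn.
have c0 : 0 <= (16 * pm + 5) * u by nonneg.
have := ler_wpM2l c0 X2; linear from res bs.
Qed.

End Accuracy.

(** * Prefactors and rates *)

Section PolynomialGrowth.
Context {R : realType}.

Lemma horner_growth (p : {poly R}) : exists K : R, exists a : nat, 0 <= K /\
  forall y, 0 <= y -> `|p.[y]| <= K * (1 + y) ^+ a.
Proof.
elim/poly_ind: p => [|p c [K [a [K0 hp]]]].
  by exists 0, 0%N; split=> // y _; rewrite horner0 normr0 mul0r.
exists (K + `|c|), a.+1; split=> [|y y0]; first by rewrite addr_ge0.
rewrite hornerMXaddC; apply: le_trans (ler_normD _ _) _; rewrite mulrDl.
have y1 : 1 <= 1 + y by rewrite lerDl.
apply: lerD; last by rewrite ler_peMr // exprn_ege1.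
rewrite normrM (ger0_norm y0) exprSr mulrA.
apply: ler_pM => //; first exact: hp.
by rewrite lerDr.
Qed.

(** A common shape for all prefactors: powers of a single such expression then
    dominate everything built from them. *)
Lemma horner2_growth (p : {poly {poly R}}) : exists K : R, exists a : nat, 0 <= K /\
  forall z y, 0 <= z -> 0 <= y -> `|p.[z, y]| <= K * ((1 + z) * (1 + y)) ^+ a.
Proof.
elim/poly_ind: p => [|p c [K [a [K0 hp]]]].
  by exists 0, 0%N; split=> // z y _ _; rewrite !horner0 normr0 mul0r.
have [K' [a' [K'0 hc]]] := horner_growth c.
exists (K + K'), (a.+1 + a')%N; split=> [|z y z0 y0]; first by rewrite addr_ge0.
rewrite hornerMXaddC hornerD hornerM hornerC.
have y1 : 1 <= 1 + y by rewrite lerDl.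
have z1 : 1 <= 1 + z by rewrite lerDl.
have N1 : 1 <= (1 + z) * (1 + y) by rewrite mulr_ege1.
apply: le_trans (ler_normD _ _) _; rewrite mulrDl; apply: lerD.
  apply: le_trans (_ : K * ((1 + z) * (1 + y)) ^+ a.+1 <= _).
    rewrite normrM (ger0_norm z0) exprSr (mulrA K); apply: ler_pM => //; first by apply: hp.
    by apply: le_trans (_ : 1 + z <= _); [rewrite lerDr | rewrite ler_peMr // addr_ge0].
  by rewrite ler_wpM2l // ler_weXn2l // leq_addr.
apply: le_trans (hc y y0) _; rewrite ler_wpM2l //.
apply: le_trans (_ : ((1 + z) * (1 + y)) ^+ a' <= _); last by rewrite ler_weXn2l // leq_addl.
apply: lerXn2r; rewrite ?nnegrE ?mulr_ge0 ?addr_ge0 //.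
by rewrite ler_peMl // addr_ge0.
Qed.

(** The right-hand side of the previous estimate, as a polynomial. *)
Definition gauge (K : R) (a : nat) : {poly {poly R}} :=
  K%:P%:P * (('X + 1) * ('X + 1)%:P) ^+ a.

Lemma prefactor_gauge K a n u :
  prefactor (gauge K a) n u = K * ((1 + n%:R) * (1 + ln u^-1)) ^+ a.
Proof.
by rewrite /prefactor /gauge !(hornerM, horner_exp, hornerD, hornerX, hornerC) (addrC n%:R) (addrC (ln _)).
Qed.

Lemma prefactorM (p r : {poly {poly R}}) n u :
  prefactor (p * r) n u = prefactor p n u * prefactor r n u.
Proof. by rewrite /prefactor !hornerM. Qed.

Lemma prefactorX (p : {poly {poly R}}) m n u :
  prefactor (p ^+ m) n u = prefactor p n u ^+ m.
Proof. by rewrite /prefactor !horner_exp. Qed.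

Lemma prefactorC (c : R) n u : prefactor c%:P%:P n u = c.
Proof. by rewrite /prefactor !hornerC. Qed.

End PolynomialGrowth.

Section Rates.
Context {R : realType}.

Lemma decay_rate_itv (Lam lam : R) : 1 <= Lam -> 0 < lam -> lam <= 1 ->
  1 / 2 <= decay_rate Lam lam < 1.
Proof.
move=> L1 l0 l1; set r := lam / 2 / (6 * Lam).
have r0 : 0 < r by rewrite !divr_gt0 // mulr_gt0 // (lt_le_trans ltr01).
have r1 : r <= 1 / 12.
  rewrite /r ler_pdivrMr ?mulr_gt0 ?(lt_le_trans ltr01) //; lra.
have q0 : 0 <= 1 - r ^+ 2 by nra.
apply/andP; split.
  rewrite -(@ler_sqr R) ?nnegrE ?sqrtr_ge0 //; last by lra.
  by rewrite (sqr_sqrtr q0); nra.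
rewrite -(@ltr_sqr R) ?nnegrE ?sqrtr_ge0 // (sqr_sqrtr q0); nra.
Qed.

Lemma expr_le_of_ln (c y : R) m : 0 < c -> 0 < y -> - ln y <= - ln c * m%:R -> c ^+ m <= y.
Proof.
move=> c0 y0 h; rewrite -(@ler_ln R) ?posrE ?exprn_gt0 // lnXn // -mulr_natr; lra.
Qed.

End Rates.

(** * Backward stability of the refined solver *)

Unset Implicit Arguments.

Theorem theorem6p3 (R : realType) (C lo hi : R) (hlo : 0 < lo) :
  exists cq ct : R, 0 < cq /\ 0 < ct /\
  forall Kq Kt cS : R, cq <= Kq -> ct <= Kt ->
  exists Kcost : R,
  forall pmul ptri : {poly {poly R}},
  exists pfull pback : {poly {poly R}},
  forall (n : nat) (u : R) (F : fparith u) (A P : 'M[R]_n) (b : 'cV[R]_n)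
         (prods : products R n) (slv : tridiag_solver R) (q t : nat),
  (0 < n)%N -> 0 < u -> u < 1 ->
  A \in unitmx -> P \in unitmx ->
  let kappa := cond A in
  kappa * u * prefactor pfull n u <= 1 ->
  cond (A *m invmx P) <= C ->
  lo <= specnorm (A *m invmx P) -> specnorm (A *m invmx P) <= hi ->
  backward_stable_products F pmul A P prods ->
  backward_stable_tridiag F ptri cS slv ->
  cq * ln (kappa * u)^-1 <= q%:R -> q%:R <= Kq * ln (kappa * u)^-1 ->
  ct * (ln u^-1 / ln (kappa * u)^-1) <= t%:R ->
  t%:R <= Kt * (ln u^-1 / ln (kappa * u)^-1) ->
  let run := meta_solver F slv prods t q b in
  backward_stable_output pback u A b run.1 /\
  (forall o, o != Flop -> (count_mem o run.2)%:R <= Kcost * ln u^-1) /\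
  (count_mem Flop run.2)%:R <= Kcost * n%:R * ln u^-1.
Proof.
(* [H] and [G] bound the norms of [A P^-1] and of its inverse. *)
pose H : R := `|hi| + 1; pose G : R := (`|C| + 1) / lo + 1.
have H1 : 1 <= H by rewrite /H lerDr.
have G1 : 1 <= G by rewrite /G lerDr divr_ge0 ?addr_ge0 // ltW.
pose rho := decay_rate (H ^+ 2) (G ^- 2).
have G2 : 1 <= G ^+ 2 by rewrite exprn_ege1.
have /andP [rho2 rho1] : 1 / 2 <= rho < 1.
  apply: decay_rate_itv; rewrite ?exprn_ege1 ?invr_gt0 ?(lt_le_trans ltr01) //.
  by rewrite invf_le1 // (lt_le_trans ltr01).
have rho0 : 0 < rho by apply: lt_le_trans rho2; lra.
have lnrho : 0 < - ln rho by rewrite oppr_gt0 ln_lt0 // rho0.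
(* [q] steps damp by [rho ^ q <= kappa u]; [t] steps, each gaining a factor
   [sqrt (kappa u)], reach [u]. *)
exists (- ln rho)^-1, 2; split; first by rewrite invr_gt0.
split=> // Kq Kt cS cqKq ctKt.
have Kq0 : 0 <= Kq by apply: le_trans cqKq; rewrite invr_ge0 ltW.
have Kt0 : 0 <= Kt by apply: le_trans ctKt.
pose cSn := (Num.trunc cS).+1; have cS_le : cS <= cSn%:R by rewrite ltW // truncnS_gt.
(* In [t * q] the factor [log (1 / (kappa u))] cancels. *)
exists ((19 + cSn)%:R * (Kq * Kt)) => pmul ptri.
have [Km [am [Km0 hpm]]] := horner2_growth pmul.
have [Kp [ap [Kp0 hpt]]] := horner2_growth ptri.
pose Kc : R := 1000 + H + G + Kq + Km + Kp * (1 + Kq) ^+ ap.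
have H0 := le_trans ler01 H1; have G0 := le_trans ler01 G1.
have Kp' : 0 <= Kp * (1 + Kq) ^+ ap by rewrite mulr_ge0 // exprn_ge0 // addr_ge0.
have [Kc_1000 Kc_H Kc_G [Kc_Kq Kc_Km Kc_Kp]] :
    [/\ 1000 <= Kc, H <= Kc, G <= Kc & [/\ Kq <= Kc, Km <= Kc & Kp * (1 + Kq) ^+ ap <= Kc]].
  by split; [| | | split]; rewrite /Kc; move: (Kp * _) Kp'; clear -H0 G0 Kq0 Km0 => *; lra.
have Kc_1 : 1 <= Kc by apply: le_trans Kc_1000; rewrite ler1n.
(* The tridiagonal systems have order at most [q = O(log (1 / u))], which is
   where the exponent [2 * ap] comes from. *)
pose gp := gauge Kc (1 + am + 2 * ap).
(* [42 * gp] bounds the factor [32 * pm + 10] of the final backward error. *)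
exists (gp ^+ 200), (42%:P%:P * gp).
move=> n u F A P b prods slv q t n0 u0 u1 Au Pu kappa.
move=> hfull hcond hB_lo hB_hi O_ok slv_ok q_ge q_le t_ge t_le run.
rewrite /backward_stable_output prefactorM prefactorC prefactor_gauge.
move: hfull; rewrite prefactorX prefactor_gauge.
set L := ln u^-1 in t_ge t_le *; set N := (1 + n%:R) * (1 + L); set g := Kc * _ => hfull.
have L0 : 0 <= L by rewrite ln_ge0 // invf_ge1 // ltW.
have n1 : 1 <= 1 + n%:R :> R by rewrite lerDl.
have L1 : 1 <= 1 + L by rewrite lerDl.
have N1 : 1 <= N by rewrite mulr_ege1.
have nN : 1 + n%:R <= N by rewrite ler_peMr // (le_trans ler01).
have LN : 1 + L <= N by rewrite ler_peMl // (le_trans ler01).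
have Bunit := preconditioned_unitmx Au Pu.
have B0 : 0 < specnorm (A *m invmx P) by apply: lt_le_trans hB_lo.
have B_le : specnorm (A *m invmx P) <= H.
  by apply: le_trans hB_hi _; rewrite /H (le_trans (ler_norm hi)) // lerDl.
have Binv_le : specnorm (invmx (A *m invmx P)) <= G.
  have h : specnorm (A *m invmx P) * specnorm (invmx (A *m invmx P)) <= `|C| + 1.
    apply: le_trans (specnorm_inv_le_cond n0 Bunit) _; apply: le_trans hcond _.
    by rewrite (le_trans (ler_norm C)) // lerDl.
  apply: le_trans (_ : (`|C| + 1) / lo <= _); last by rewrite /G lerDl.
  rewrite ler_pdivlMr //; apply: le_trans h; rewrite mulrC.
  by rewrite ler_wpM2r ?specnorm_ge0.
have A_cond := specnorm_inv_le_cond n0 Au; rewrite -/kappa in A_cond.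
have kappa1 : 1 <= kappa := le_trans (specnorm_inv_ge1 n0 Au) A_cond.
have Kc_g y m : 0 <= y -> y <= Kc -> (m <= 1 + am + 2 * ap)%N -> y * N ^+ m <= g.
  move=> y0 yK mm; apply: ler_pM => //; first by rewrite exprn_ge0 // (le_trans ler01).
  by rewrite ler_weXn2l.
have Kc_g0 y : 0 <= y -> y <= Kc -> y <= g.
  by move=> y0 yK; have := Kc_g y 0%N y0 yK isT; rewrite expr0 mulr1.
have g_ge : 1000 <= g by apply: Kc_g0.
have H_g : H <= g by apply: Kc_g0.
have G_g : G <= g by apply: Kc_g0.
have g0 : 0 <= g := le_trans H0 H_g.
have g1 : 1 <= g := le_trans H1 H_g.
have n_g : n.+1%:R <= g.
  apply: le_trans (_ : 1 * N ^+ 1 <= _); first by rewrite mul1r expr1 -addn1 natrD addrC.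
  by apply: Kc_g.
have x0 : 0 < kappa * u by rewrite mulr_gt0 // (lt_le_trans ltr01).
have ux : u <= kappa * u by rewrite ler_peMl // ltW.
have x1 : kappa * u < 1.
  have : kappa * u * 1000 <= 1.
    apply: le_trans hfull; rewrite ler_pM2l //; apply: le_trans g_ge _.
    by rewrite -{1}[g]expr1 ler_weXn2l.
  by clear; lra.
set l := ln (kappa * u)^-1 in q_ge q_le t_ge t_le.
have l0 : 0 < l by rewrite ln_gt0 // invf_gt1.
have lL : l <= L by rewrite ler_ln ?posrE ?invr_gt0 // lef_pV2 ?posrE.
have q0 : (0 < q)%N.
  rewrite -(ltr0n R); apply: lt_le_trans q_ge; rewrite mulr_gt0 // invr_gt0 //.
have qL : q%:R <= Kq * L by apply: le_trans q_le _; rewrite ler_wpM2l.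
have q_g : q%:R <= g.
  apply: le_trans (_ : Kq * N ^+ 1 <= _); last by apply: Kc_g.
  by apply: le_trans qL _; rewrite ler_wpM2l // expr1 (le_trans _ LN) // lerDr.
pose pm : R := `|prefactor pmul n u|.
have pm_g : pm <= g.
  apply: le_trans (hpm n%:R L (ler0n _ _) L0) _; apply: Kc_g => //.
  by rewrite addnAC leq_addl.
pose pt : R := Kp * (1 + Kq) ^+ ap * N ^+ (2 * ap).
have pt0 : 0 <= pt by rewrite mulr_ge0 // exprn_ge0 // (le_trans ler01).
have pt_g : pt <= g.
  by apply: Kc_g => //; rewrite leq_addl.
have pt_ge k : (k <= q)%N -> prefactor ptri k u <= pt.
  move=> kq; apply: le_trans (ler_norm _) _.
  apply: le_trans (hpt k%:R L (ler0n _ _) L0) _; rewrite /pt -mulrA ler_wpM2l //.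
  rewrite exprM -exprMn.
  have kR : k%:R <= Kq * L by apply: le_trans qL; rewrite ler_nat.
  apply: lerXn2r; rewrite ?nnegrE ?mulr_ge0 ?addr_ge0 ?sqr_ge0 //.
  apply: le_trans (_ : ((1 + Kq) * (1 + L)) * (1 + L) <= _).
    rewrite ler_wpM2r ?addr_ge0 //.
    by have := mulr_ge0 Kq0 L0; move: kR L0 Kq0; clear; lra.
  rewrite -mulrA ler_wpM2l ?addr_ge0 // -expr2.
  by apply: lerXn2r; rewrite ?nnegrE ?addr_ge0 // (le_trans ler01).
have decay : decay_rate (H ^+ 2) (G ^- 2) ^+ q.-1 <= 2 * (kappa * u).
  have h : rho ^+ q <= kappa * u.
    apply: expr_le_of_ln => //; rewrite -lnV ?posrE // -/l.
    by move: q_ge; rewrite mulrC ler_pdivrMr // mulrC.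
  have E : rho ^+ q = rho * rho ^+ q.-1 by rewrite -exprS prednK.
  have := ler_wpM2r (exprn_ge0 q.-1 (ltW rho0)) rho2; rewrite -E -/rho; move: h; clear; lra.
have small : g ^+ 200 * (kappa * u) <= 1 by rewrite mulrC.
have pm0 : 0 <= pm by apply: normr_ge0.
have pm_ge : prefactor pmul n u <= pm by apply: ler_norm.
have u0' := ltW u0.
pose c := contraction (u := u) H G kappa pm
  (lanczos_err (u := u) (H ^+ 2) (G ^- 2) (basic_err (u := u) n q H G kappa pm) pt q).
have c2 : c ^+ 2 <= kappa * u.
  exact: (contraction_sqr_le u0' H1 G1 pm0 pt0 kappa1 g_ge n_g q_g H_g G_g pm_g pt_g
    small decay).
have ct : c ^+ t <= u.
  have ct2 : (c ^+ t) ^+ 2 <= u ^+ 2.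
    rewrite exprAC; apply: le_trans (_ : (kappa * u) ^+ t <= _).
      by apply: lerXn2r; rewrite // nnegrE ?sqr_ge0 // ltW.
    apply: expr_le_of_ln; rewrite ?exprn_gt0 // lnXn // mulr2n opprD -[- ln u]lnV ?posrE //.
    rewrite -[- ln (kappa * u)]lnV ?posrE // -/L -/l.
    have := ler_wpM2l (ltW l0) t_ge.
    have -> : l * (2 * (L / l)) = L + L by field; rewrite gt_eqF.
    by [].
  case: (lerP (c ^+ t) 0) => [/le_trans|c0]; first by apply.
  by move: ct2; rewrite ler_sqr ?nnegrE // ltW.
have [res cost] := refinement_backward_error n0 u0' Au Pu O_ok slv_ok cS_le H1 G1 pm0 pm_ge pt0 pt_ge q0
  B_le Binv_le A_cond kappa1 g_ge n_g q_g H_g G_g pm_g pt_g small decay b ct.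
rewrite -/run in res cost.
have tq : t%:R * q%:R <= Kq * Kt * L.
  apply: le_trans (ler_pM (ler0n _ _) (ler0n _ _) t_le q_le) _.
  by have -> : Kt * (L / l) * (Kq * l) = Kq * Kt * L by field; rewrite gt_eqF.
split; last first.
  have [muls flops] := cost; split=> [o oF|].
    apply: le_trans (_ : (5 * (t * q))%:R <= _).
      rewrite ler_nat; apply: leq_trans (muls o oF) _.
      by rewrite mulnCA leq_mul2l; apply/orP; right; move: q0; clear; lia.
    rewrite natrM natrM -mulrA ler_pM ?mulr_ge0 //.
    by rewrite ler_nat -[5%N]/(5 + 0)%N leq_add.
  apply: le_trans (_ : ((19 + cSn) * n * (t * q))%:R <= _).
    rewrite ler_nat; apply: leq_trans flops _.
    have : (2 * n <= 2 * (n * q))%N by rewrite leq_mul2l leq_pmulr.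
    have -> : ((19 + cSn) * n * (t * q) = t * (2 * (n * q) + n * q * (17 + cSn)))%N by ring.
    by move=> h; rewrite leq_mul2l leq_add2r h orbT.
  rewrite natrM natrM [(t * q)%:R]natrM.
  have -> : (19 + cSn)%:R * (Kq * Kt) * n%:R * L = (19 + cSn)%:R * n%:R * (Kq * Kt * L) by ring.
  by rewrite ler_wpM2l // mulr_ge0.
move=> _ _; apply: residual_backward_error.
  by have nA := specnorm_ge0 A; nonneg.
apply: le_trans res _; rewrite ler_wpM2r ?norm2_ge0 // ler_wpM2r ?specnorm_ge0 //.
rewrite ler_wpM2r //; move: pm_g g1; clear; lra.
Qed.
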